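(* Consider an edge-to-edge tiling of a flat torus by unit-area tiles, each of which is either congruent to one fixed efficient pentagon or is a non-convex quadrilateral (any number of different non-convex quadrilaterals being allowed). Then the perimeter per tile of the tiling is not less than the perimeter per tile of a Cairo/Prismatic tiling, i.e. it is not less than half the perimeter of a unit-area Cairo (or Prismatic) pentagon, namely $\sqrt{2+\sqrt3}$.
   Context: All tilings are by unit-area polygons and edge-to-edge: adjacent tiles meet only along entire edges or at vertices. The perimeter per tile of a tiling of a flat torus is the total length of all edges of the tiling (each edge counted once) divided by the number of tiles. A Cairo (respectively Prismatic) pentagon is a pentagon with three angles of $2\pi/3$ and two right angles which are nonadjacent (respectively adjacent), circumscribed about a circle; at unit area both have perimeter $2\sqrt{2+\sqrt3}\approx 3.86$. A unit-area pentagon is efficient if its perimeter is less than or equal to that of a unit-area Cairo pentagon. ''An efficient pentagon'' (singular) means that all efficient pentagons in the tiling are congruent to one another. *)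

(* Defs.v *)
From HB Require Import structures.
From mathcomp Require Import all_boot all_order all_algebra.
From mathcomp Require Import all_classical all_reals all_analysis.

Set Implicit Arguments.
Unset Strict Implicit.
Unset Printing Implicit Defensive.

Import Order.TTheory GRing.Theory Num.Theory.
Import numFieldNormedType.Exports.

Local Open Scope classical_set_scope.
Local Open Scope ring_scope.

Section Plane.
Context {R : realType}.
Implicit Types (x y z u a b : R * R) (A : set (R * R)).

Definition dot x y : R := x.1 * y.1 + x.2 * y.2.

Definition cross x y : R := x.1 * y.2 - x.2 * y.1.

(* The library's norm on [R * R] is the sup norm, hence these two. *)
Definition enorm x : R := Num.sqrt (dot x x).
Definition edist x y : R := enorm (y - x).

Definition point_at x y (t : R) : R * R := (1 - t) *: x + t *: y.

Definition segment x y : set (R * R) :=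
  [set point_at x y t | t in [set t : R | 0 <= t <= 1]].

(* The unoriented angle xyz at y, between 0 and pi. *)
Definition angle x y z : R :=
  acos (dot (x - y) (z - y) / (enorm (x - y) * enorm (z - y))).

Definition isometry (f : R * R -> R * R) : Prop :=
  forall x y, edist (f x) (f y) = edist x y.

Definition shift u A : set (R * R) := [set u + x | x in A].

Definition lattice a b : set (R * R) :=
  [set u | exists m n : int, u = a *~ m + b *~ n].

End Plane.

Section Polygons.
Context {R : realType}.

(* Vertex and edge indices are read cyclically; edge k joins vertices k and
   k + 1. *)
Definition vertex (v : seq (R * R)) (k : nat) : R * R :=
  nth (0, 0) v (k %% size v).

Definition edge (v : seq (R * R)) (k : nat) : set (R * R) :=
  segment (vertex v k) (vertex v k.+1).

(* The closed broken line through v has no self-intersection: distinct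
   parameters, in the half-open edges, give distinct points. *)
Definition simple_closed (v : seq (R * R)) : Prop :=
  forall (k l : nat) (s t : R),
    (k < size v)%N -> (l < size v)%N -> 0 <= s < 1 -> 0 <= t < 1 ->
    point_at (vertex v k) (vertex v k.+1) s =
    point_at (vertex v l) (vertex v l.+1) t ->
    k = l /\ s = t.

(* No straight angles, so that an n-gon has exactly n corners. *)
Definition true_corners (v : seq (R * R)) : Prop :=
  forall k : nat,
    cross (vertex v k.+1 - vertex v k) (vertex v k.+2 - vertex v k.+1) != 0.

(* A polygon is the list of its vertices together with the closed region it
   bounds. By the Jordan curve theorem the region is determined by the
   vertices: it is the only nonempty compact, regular closed set whose
   topological boundary is the broken line. It need not be convex, and the
   vertices may be listed in either direction. *)
Record polygon := Polygon {
  verts : seq (R * R);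
  region : set (R * R);
  polygon_size : (2 < size verts)%N;
  polygon_simple : simple_closed verts;
  polygon_corners : true_corners verts;
  region_compact : compact region;
  region_regular : closure (interior region) = region;
  region_boundary : region `\` interior region =
    \bigcup_(k in [set k | (k < size verts)%N]) edge verts k }.

Implicit Types P Q : polygon.

Definition nsides P : nat := size (verts P).

Definition pentagon P : Prop := nsides P = 5.
Definition quadrilateral P : Prop := nsides P = 4.

Definition nonconvex P : Prop := ~ convex_set (region P).

Definition side_length P (k : nat) : R :=
  edist (vertex (verts P) k) (vertex (verts P) k.+1).

Definition perimeter P : R := \sum_(k < nsides P) side_length P k.

Definition unit_area P : Prop :=
  (lebesgue_measure \x lebesgue_measure)%E (region P) = 1%E.

Definition congruent P Q : Prop :=
  exists f : R * R -> R * R,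
    [/\ isometry f, f @` region P = region Q &
        f @` [set` verts P] = [set` verts Q]].

(* The interior angle of P at vertex k + 1, provided that P is convex. *)
Definition convex_angle P (k : nat) : R :=
  angle (vertex (verts P) k) (vertex (verts P) k.+1) (vertex (verts P) k.+2).

(* A closed disk contained in P and touching every edge: its circle is then
   tangent to all edges. *)
Definition circumscribed P : Prop :=
  exists (c : R * R) (r : R),
    [/\ 0 < r,
        forall x, edist c x <= r -> region P x &
        forall k, (k < nsides P)%N ->
          exists2 x, edge (verts P) k x & edist c x = r].

(* Interior angles pi/2 at two corners whose indices differ by d mod 5, and
   2 pi/3 at the three others. All of them being less than pi, such a pentagon
   is convex. *)
Definition tangential_pentagon (d : nat) P : Prop :=
  [/\ pentagon P, convex_set (region P), circumscribed P &
      exists2 i : nat, (i < 5)%N &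
        forall k : nat, (k < 5)%N ->
          convex_angle P k =
            if (k == i) || (k == (i + d) %% 5)%N then pi / 2 else 2 * pi / 3].

Definition cairo P : Prop := tangential_pentagon 2 P.
Definition prismatic P : Prop := tangential_pentagon 1 P.

Definition efficient P : Prop :=
  exists C : polygon, [/\ unit_area C, cairo C & perimeter P <= perimeter C].

End Polygons.

Arguments polygon R : clear implicits.

Section Tilings.
Context {R : realType}.
Variables (a b : R * R) (N : nat) (T : 'I_N -> polygon R).

(* A tiling with N tiles of the flat torus R^2 / (Z a + Z b), given through its
   lift to the plane: T chooses one lift of each tile, and the tiles of the
   lifted tiling are the lattice translates of the T i. A tile may thus be
   adjacent to itself in the torus. *)
Record torus_tiling : Prop := TorusTiling {
  tiling_lattice : cross a b != 0;
  tiling_cover : forall x : R * R,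
    exists i u, lattice a b u /\ shift u (region (T i)) x;
  tiling_disjoint : forall i j u, lattice a b u -> ~ (i = j /\ u = 0) ->
    interior (shift u (region (T i))) `&` interior (region (T j)) = set0;
  tiling_edge_to_edge : forall i j u, lattice a b u -> ~ (i = j /\ u = 0) ->
    forall x, shift u (region (T i)) x -> region (T j) x ->
      (shift u [set` verts (T i)] x /\ [set` verts (T j)] x) \/
      (exists k l : nat,
         shift u (edge (verts (T i)) k) = edge (verts (T j)) l /\
         edge (verts (T j)) l x) }.

(* The pairs (tile, side of it); the same edge of the torus may occur several
   times, up to lattice translation. *)
Definition tile_side := {i : 'I_N & 'I_(nsides (T i))}.

Definition side_edge (d : tile_side) : set (R * R) :=
  edge (verts (T (tag d))) (tagged d).

Definition same_torus_edge : rel tile_side :=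
  fun d e => `[< exists2 u, lattice a b u & shift u (side_edge d) = side_edge e >].

(* One representative for each edge of the torus. *)
Definition torus_edges : {set tile_side} :=
  transversal (equivalence_partition same_torus_edge [set: tile_side]%SET)
    [set: tile_side]%SET.

Definition total_edge_length : R :=
  \sum_(d in torus_edges) side_length (T (tag d)) (tagged d).

Definition perimeter_per_tile : R := total_edge_length / N%:R.

End Tilings.

(* Main.v *)
Require Import Defs.
From HB Require Import structures.
From mathcomp Require Import all_boot all_order all_algebra.
From mathcomp Require Import all_classical all_reals all_analysis.
From mathcomp Require Import measurable_realfun.
From mathcomp Require Import zify ring lra.

Set Implicit Arguments.
Unset Strict Implicit.
Unset Printing Implicit Defensive.

Import Order.TTheory GRing.Theory Num.Theory.
Import numFieldNormedType.Exports.
Import Defs.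

Local Open Scope classical_set_scope.
Local Open Scope ring_scope.

(** Every edge of the torus belongs to at most two sides, so it is enough to show that the
    perimeters of the tiles have mean at least c = 2 sqrt (2 + sqrt 3).

    A non-convex quadrilateral of area 1 lies in the triangle of three of its vertices, hence
    has perimeter at least 432^(1/4) > 4.55. If some pentagon of area 1 has perimeter less
    than c, then it is in convex position (otherwise a quadrilateral contains it and its
    perimeter is at least 4), and L'Huilier's inequality P^2 >= 4 A (sum of the tangents of
    the half exterior angles) shows that its perimeter is still at least 3.78, that any two
    of its interior angles have sum larger than pi, and that each of them is larger than
    2 pi / 5. Give weight 2 to the smallest angle of the pentagon, 3 to its other angles, 5 to
    the reflex angle of a quadrilateral and 0 to its other angles. As the angles around a
    vertex add up to 2 pi, their weights add up to at most 9; counting all weights, there are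
    at most eight pentagons for each quadrilateral, and 8 * 3.78 + 4.55 > 9 c.

    A tangential pentagon with the given angles has tangent lengths r or r / sqrt 3, so its
    perimeter is 2 r (2 + sqrt 3); its area, at least r / 2 times the perimeter, is 1, hence
    its perimeter is at most c. *)

(** * Vectors and angles *)

(** [orient a b c] is twice the signed area of a triangle; positions are expressed below by its
    sign. A region is given only as a compact regular closed set with a known boundary, so facts
    about it come from following a segment or a ray until it meets the boundary, and from
    star-shaped sets that avoid the boundary. For the same reason an angle of a tile is the Lebesgue
    measure of the set of directions in [0, 2 pi[ that enter the tile: the sum 2 pi around a vertex
    is then additivity of measure.

    Congruence matters because the weights compare angles of different tiles. All pentagons share
    one smallest angle, and the cap 9 at a vertex rests on two facts about it: its sum with any
    other angle exceeds pi, and five copies of it exceed 2 pi. Vertices are never counted: pairing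
    each corner with the angle sum at its vertex gives one linear inequality between weights and
    angles, which the multiplier 17/200 combines with the perimeters tile by tile.

    The bounds on the half tangents are tangent lines of tan at pi/6 and pi/4, the half exterior
    angles of the Cairo pentagon, so they are exact where they have to be. *)

Definition orient (R : realType) (a b c : R * R) : R := cross (b - a) (c - a).
Ltac vsimp := rewrite /orient /point_at /cross /dot /=; rewrite ?/GRing.scale /=.

Lemma pair_ext (R : realType) (x y : R * R) : x.1 = y.1 -> x.2 = y.2 -> x = y.
Proof. by case: x y => [? ?] [? ?] /= -> ->. Qed.

Ltac vring := apply: pair_ext; vsimp; ring.

Section Vectors.
Context {R : realType}.

Implicit Types (x y z u v w a b c : R * R).


Lemma orient_rot a b c : orient b c a = orient a b c.
Proof. by rewrite /orient /cross /=; ring. Qed.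

Lemma orient_swap a b c : orient a c b = - orient a b c.
Proof. by rewrite /orient /cross /=; ring. Qed.

Lemma dot_ge0 x : 0 <= dot x x.
Proof. by rewrite /dot addr_ge0 // -expr2 sqr_ge0. Qed.

Lemma enorm_ge0 x : 0 <= enorm x.
Proof. exact: sqrtr_ge0. Qed.

Lemma enormK x : enorm x * enorm x = dot x x.
Proof. by rewrite -expr2 sqr_sqrtr // dot_ge0. Qed.

Lemma dot_eq0 x : (dot x x == 0) = (x == 0).
Proof.
case: x => x1 x2; rewrite /dot /= paddr_eq0 -?expr2 ?sqr_ge0 //.
by rewrite !sqrf_eq0.
Qed.

Lemma enorm_eq0 x : (enorm x == 0) = (x == 0).
Proof. by rewrite -dot_eq0 -enormK mulf_eq0 orbb. Qed.

Lemma enorm_gt0 x : (0 < enorm x) = (x != 0).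
Proof. by rewrite lt_neqAle enorm_ge0 andbT eq_sym enorm_eq0. Qed.

Lemma dotC x y : dot x y = dot y x.
Proof. by rewrite /dot; ring. Qed.

Lemma crossC x y : cross x y = - cross y x.
Proof. by rewrite /cross; ring. Qed.

Lemma lagrange x y : dot x y ^+ 2 + cross x y ^+ 2 = dot x x * dot y y.
Proof. by rewrite /dot /cross; ring. Qed.

Lemma enormN x : enorm (- x) = enorm x.
Proof. by rewrite /enorm; congr Num.sqrt; rewrite /dot /=; ring. Qed.

Lemma enormZ (t : R) x : 0 <= t -> enorm (t *: x) = t * enorm x.
Proof.
move=> t0; rewrite /enorm; have -> : dot (t *: x) (t *: x) = t ^+ 2 * dot x x.
  by rewrite /dot /= /GRing.scale /=; ring.
by rewrite sqrtrM ?sqr_ge0 // sqrtr_sqr ger0_norm.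
Qed.

Lemma enormM_sqr x y : (enorm x * enorm y) ^+ 2 = dot x y ^+ 2 + cross x y ^+ 2.
Proof. by rewrite lagrange -!enormK; ring. Qed.

Lemma dot_le x y : dot x y <= enorm x * enorm y.
Proof.
apply: le_trans (ler_norm _) _.
rewrite -ler_sqr ?nnegrE ?mulr_ge0 ?enorm_ge0 // real_normK ?num_real //.
by rewrite enormM_sqr lerDl sqr_ge0.
Qed.

Lemma cross_le x y : `|cross x y| <= enorm x * enorm y.
Proof.
rewrite -ler_sqr ?nnegrE ?mulr_ge0 ?enorm_ge0 // real_normK ?num_real //.
by rewrite enormM_sqr lerDr sqr_ge0.
Qed.

Lemma enormD x y : enorm (x + y) <= enorm x + enorm y.
Proof.
rewrite -ler_sqr ?nnegrE ?addr_ge0 ?enorm_ge0 // expr2 enormK.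
have -> : dot (x + y) (x + y) = dot x x + dot y y + 2 * dot x y.
  by rewrite /dot /=; ring.
have := dot_le x y; rewrite -!enormK => h.
by rewrite [leRHS](_ : _ = enorm x * enorm x + enorm y * enorm y + 2 * (enorm x * enorm y));
  [lra | ring].
Qed.

Lemma edistC x y : edist x y = edist y x.
Proof. by rewrite /edist -enormN opprB. Qed.

Lemma edist_triangle x y z : edist x z <= edist x y + edist y z.
Proof.
rewrite /edist; apply: le_trans (enormD _ _).
by have -> : y - x + (z - y) = z - x by rewrite addrC subrKA.
Qed.

Lemma cross_neq0l x y : cross x y != 0 -> x != 0.
Proof. by apply: contraNneq => ->; rewrite /cross /=; apply/eqP; ring. Qed.

Lemma cross_neq0r x y : cross x y != 0 -> y != 0.
Proof. by apply: contraNneq => ->; rewrite /cross /=; apply/eqP; ring. Qed.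

Definition ang u v : R := acos (dot u v / (enorm u * enorm v)).

Lemma angleE x y z : angle x y z = ang (x - y) (z - y).
Proof. by []. Qed.

Lemma cos_bound u v : u != 0 -> v != 0 ->
  -1 <= dot u v / (enorm u * enorm v) <= 1.
Proof.
rewrite -!enorm_gt0 => u0 v0; have uv0 := mulr_gt0 u0 v0.
rewrite ler_pdivrMr // ler_pdivlMr // mul1r dot_le andbT mulN1r.
rewrite lerNl (_ : - dot u v = dot (- u) v); first by rewrite -(enormN u) dot_le.
by rewrite /dot /=; ring.
Qed.

Lemma ang_cos u v : u != 0 -> v != 0 ->
  dot u v = enorm u * enorm v * cos (ang u v).
Proof.
move=> u0 v0; rewrite acosK ?in_itv /= ?cos_bound // mulrC divfK //.
by rewrite mulf_neq0 // enorm_eq0.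
Qed.

Lemma ang_itv u v : u != 0 -> v != 0 -> 0 <= ang u v <= pi.
Proof. by move=> u0 v0; rewrite acos_ge0 ?acos_lepi ?cos_bound. Qed.

Lemma ang_sin u v : u != 0 -> v != 0 ->
  `|cross u v| = enorm u * enorm v * sin (ang u v).
Proof.
move=> u0 v0; have s0 := sin_ge0_pi (ang_itv u0 v0).
apply/eqP; rewrite -(eqrXn2 (n := 2)) ?mulr_ge0 ?enorm_ge0 //.
rewrite exprMn sin2cos2 mulrBr mulr1 -exprMn -ang_cos // enormM_sqr addrC addKr.
by rewrite real_normK ?num_real.
Qed.

Lemma angE u v (t : R) : u != 0 -> v != 0 -> 0 <= t <= pi ->
  dot u v = enorm u * enorm v * cos t -> ang u v = t.
Proof.
move=> u0 v0 tp e; rewrite /ang e mulrAC divff ?mul1r ?cosK ?in_itv //=.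
by rewrite mulf_neq0 // enorm_eq0.
Qed.

Lemma ang_gt0 u v : 0 < cross u v -> 0 < ang u v < pi.
Proof.
move=> c0; have u0 := cross_neq0l (lt0r_neq0 c0).
have v0 := cross_neq0r (lt0r_neq0 c0).
have /andP[a0 ap] := ang_itv u0 v0.
have e := ang_sin u0 v0; rewrite gtr0_norm // in e.
rewrite !lt_neqAle a0 ap !andbT; apply/andP; split; apply/eqP => h.
  by move: c0; rewrite e -h sin0 mulr0 ltxx.
by move: c0; rewrite e h sinpi mulr0 ltxx.
Qed.

Lemma angC u v : ang v u = ang u v.
Proof. by rewrite /ang dotC [enorm v * _]mulrC. Qed.

Lemma angNN u v : ang (- u) (- v) = ang u v.
Proof. by rewrite /ang !enormN; congr (acos (_ / _)); rewrite /dot /=; ring. Qed.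

Lemma angN u v : u != 0 -> v != 0 -> ang (- u) v = pi - ang u v.
Proof.
move=> u0 v0; rewrite /ang enormN -acosN ?cos_bound // -mulNr.
by congr (acos (_ / _)); rewrite /dot /=; ring.
Qed.

Lemma angZ (t : R) u v : 0 < t -> ang (t *: u) v = ang u v.
Proof.
move=> t0; rewrite /ang enormZ ?ltW //.
have -> : dot (t *: u) v = t * dot u v by rewrite /dot /= /GRing.scale /=; ring.
by rewrite -[t * enorm u * _]mulrA -mulf_div divff ?mul1r ?gt_eqF.
Qed.

(** The addition formulas show that the sum of the two angles has the sine and the cosine of the
    angle from [u] to [w]. The positive [cross u w] makes that sine positive, which excludes a sum
    beyond pi. *)
Lemma angD u v w : 0 < cross u v -> 0 < cross v w -> 0 < cross u w ->
  ang u w = ang u v + ang v w.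
Proof.
move=> uv vw uw.
have u0 := cross_neq0l (lt0r_neq0 uv).
have v0 := cross_neq0r (lt0r_neq0 uv).
have w0 := cross_neq0r (lt0r_neq0 vw).
have /andP[a0 ap] := ang_gt0 uv; have /andP[b0 bp] := ang_gt0 vw.
have ac := ang_cos u0 v0; have bc := ang_cos v0 w0.
have as' := ang_sin u0 v0; have bs := ang_sin v0 w0.
rewrite !gtr0_norm // in as' bs.
have nu : 0 < enorm u by rewrite enorm_gt0.
have nv : 0 < enorm v by rewrite enorm_gt0.
have nw : 0 < enorm w by rewrite enorm_gt0.
have e2 : dot v v = enorm v * enorm v by rewrite enormK.
have sE : enorm u * enorm w * sin (ang u v + ang v w) = cross u w.
  apply: (mulfI (lt0r_neq0 (mulr_gt0 nv nv))).
  transitivity (cross u v * dot v w + dot u v * cross v w).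
    by rewrite sinD ac bc as' bs; ring.
  by rewrite -e2; vsimp; ring.
have cE : enorm u * enorm w * cos (ang u v + ang v w) = dot u w.
  apply: (mulfI (lt0r_neq0 (mulr_gt0 nv nv))).
  transitivity (dot u v * dot v w - cross u v * cross v w).
    by rewrite cosD ac bc as' bs; ring.
  by rewrite -e2; vsimp; ring.
apply: angE => //; rewrite addr_ge0 ?ltW //=.
case: ltP => // lt.
have : sin (ang u v + ang v w) <= 0.
  rewrite -[X in sin X](subrK pi) sinDpi oppr_le0 sin_ge0_pi //.
  by apply/andP; split; lra.
by rewrite leNgt -(pmulr_rgt0 _ (mulr_gt0 nu nw)) sE uw.
Qed.

(** With [u], [v] two consecutive edge vectors, the third is [u + v] up to sign, and [angD] splits
    the angle from [u] to [v] at [u + v]; the angle at [b] is its supplement. *)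
Lemma triangle_ang a b c : 0 < orient a b c ->
  ang (b - a) (c - a) + ang (c - b) (a - b) + ang (a - c) (b - c) = pi.
Proof.
rewrite /orient => h.
have [abE acE bcE] : [/\ a - b = - (b - a), a - c = - (c - a) & b - c = - (c - b)].
  by rewrite !opprB.
have cE : c - a = (b - a) + (c - b) by vring.
rewrite abE acE bcE cE; rewrite {}cE in h.
move: {abE acE bcE} (b - a) (c - b) h => u v h.
have uv : 0 < cross u v by move: h; vsimp; lra.
have u0 := cross_neq0l (lt0r_neq0 uv).
have v0 := cross_neq0r (lt0r_neq0 uv).
rewrite angNN [ang v _]angC (angN u0 v0) (@angD u (u + v) v) //; first by ring.
by move: uv; vsimp; lra.
Qed.

End Vectors.

(** * Areas of triangles *)

Section Area.
Context {R : realType}.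

Definition area (A : set (R * R)) : \bar R :=
  (lebesgue_measure \x lebesgue_measure)%E A.

Lemma nbhs_boxP (x : R * R) (A : set (R * R)) :
  nbhs x A <-> exists2 e : R, 0 < e &
    forall y, `|y.1 - x.1| < e -> `|y.2 - x.2| < e -> A y.
Proof.
split.
  move=> /nbhs_ballP[e /= e0 h]; exists e => // y h1 h2; apply: h.
  by split; rewrite /ball /= distrC.
move=> [e e0 h]; apply/nbhs_ballP; exists e => //= y [].
by rewrite /ball /= => h1 h2; apply: h; rewrite distrC.
Qed.

Lemma open_measurable2 (A : set (R * R)) : open A -> measurable A.
Proof.
move=> oA.
pose box (p q r s : rat) : set (R * R) :=
  [set` `](ratr p : R), (ratr q : R)[] `*` [set` `](ratr r : R), (ratr s : R)[].
(* Only the rational boxes contained in [A] are kept; the others are replaced by the empty set, so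
   that a plain countable union over four rationals gives [A]. *)
pose F p q r s := if `[< box p q r s `<=` A >] then box p q r s else set0.
suff -> : A = \bigcup_p \bigcup_q \bigcup_r \bigcup_s F p q r s.
  do 4! apply: bigcupT_measurable_rat => ?; rewrite /F; case: ifP => // _.
  exact: measurableX.
apply/seteqP; split => [x Ax|x [p _ [q _ [r _ [s _]]]]]; last first.
  by rewrite /F; case: asboolP => // h /h.
have /nbhs_boxP[e e0 h] : nbhs x A by exact: open_nbhs_nbhs.
have lo (t : R) : exists p : rat, t - e < ratr p < t.
  have [y [/= h1 [p _ py]]] := @dense_rat R `]t - e, t[%classic ltac:(by exists (t - e/2); rewrite /= in_itv /=; lra) ltac:(exact: interval_open).
  by exists p; rewrite py; move: h1; rewrite in_itv.
have hi (t : R) : exists p : rat, t < ratr p < t + e.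
  have [p /andP[p1 p2]] := lo (t + e).
  by exists p; rewrite p2 andbT; lra.
have [p /andP[p1 p2]] := lo x.1; have [q /andP[q1 q2]] := hi x.1.
have [r /andP[r1 r2]] := lo x.2; have [s /andP[s1 s2]] := hi x.2.
exists p => //; exists q => //; exists r => //; exists s => //.
rewrite /F asboolT.
  by split; rewrite /= in_itv /= ?p2 ?r2.
move=> y [] /=; rewrite !in_itv /= => /andP[a1 a2] /andP[b1 b2].
by apply: h; rewrite ltr_norml; lra.
Qed.

Lemma closed_measurable2 (A : set (R * R)) : closed A -> measurable A.
Proof.
move=> cA; rewrite -[A]setCK; apply: measurableC; apply: open_measurable2.
by rewrite openC.
Qed.

Lemma area_le (A B : set (R * R)) : measurable A -> measurable B ->
  A `<=` B -> (area A <= area B)%E.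
Proof. by move=> mA mB AB; apply: le_measure; rewrite ?inE. Qed.

Lemma areaU_le (A B : set (R * R)) : measurable A -> measurable B ->
  (area (A `|` B) <= area A + area B)%E.
Proof. by move=> mA mB; apply: measureU2. Qed.

Lemma areaU (A B : set (R * R)) : measurable A -> measurable B ->
  A `&` B = set0 -> (area (A `|` B) = area A + area B)%E.
Proof. by move=> mA mB AB; apply: measureU. Qed.

Lemma area_vertical (p : R) : area ([set p] `*` setT) = 0%E.
Proof. by rewrite /area product_measure1E //= lebesgue_measure_set1 mul0e. Qed.

Lemma lebesgue_measure_side (b : bool) (u v : R) : u <= v ->
  lebesgue_measure [set` Interval (BSide b u) (BSide (~~ b) v)] = (v - u)%:E.
Proof.
move=> uv; rewrite lebesgue_measure_itv /= lte_fin.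
by move: uv; rewrite le_eqVlt => /predU1P[->|->]; rewrite ?ltxx ?subrr // EFinB.
Qed.

Lemma integral_affine (p q m k : R) : p <= q ->
  (\int[lebesgue_measure]_(x in `[p, q]) (m * x + k)%:E =
   (m / 2 * (q ^+ 2 - p ^+ 2) + k * (q - p))%:E)%E.
Proof.
rewrite le_eqVlt => /predU1P[->|pq].
  by rewrite set_itv1 integral_set1 !subrr !mulr0 addr0.
have dF (x : R) : is_derive x 1 (fun x : R => m / 2 * x ^+ 2 + k * x) (m * x + k).
  apply: is_derive_eq; rewrite /GRing.scale /= !mulr1 ?expr1.
  by field.
have cF (x : R) : {for x, continuous (fun x : R => m / 2 * x ^+ 2 + k * x)}.
  by apply: differentiable_continuous; apply/derivable1_diffP; case: (dF x).
rewrite (@continuous_FTC2 _ _ (fun x => m / 2 * x ^+ 2 + k * x)) //.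
- by rewrite -EFinB; congr EFin; ring.
- apply: continuous_subspaceT => x.
  apply: cvgD; [apply: cvgM; [exact: cvg_cst|exact: cvg_id]|exact: cvg_cst].
- split; [by move=> x _; case: (dF x)| |].
    by apply: cvg_at_right_filter; exact: cF.
  by apply: cvg_at_left_filter; exact: cF.
- by move=> x _; rewrite derive1E; apply: derive_val.
Qed.

(** Region over an interval between two affine graphs. The boolean makes all four sides closed
    ([true]) or open ([false]), so that outer and inner approximations of triangles share one area
    computation. *)
Definition trapezoid (c : bool) (p q m k m' k' : R) : set (R * R) :=
  [set z | (z.1 \in Interval (BSide c p) (BSide (~~ c) q)) /\
     (z.2 \in Interval (BSide c (m * z.1 + k)) (BSide (~~ c) (m' * z.1 + k')))].

Lemma trapezoid_measurable (c : bool) (p q m k m' k' : R) :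
  measurable (trapezoid c p q m k m' k').
Proof.
have mf (m0 k0 : R) : measurable_fun setT (fun z : R * R => m0 * z.1 + k0).
  by apply: measurable_funD => //; apply: measurable_funM => //; exact: measurable_fst.
have m1 : measurable_fun setT (fun z : R * R => z.1) by exact: measurable_fst.
have m2 : measurable_fun setT (fun z : R * R => z.2) by exact: measurable_snd.
have H (f g : R * R -> R) : measurable_fun setT f -> measurable_fun setT g ->
    measurable [set z | f z <= g z] /\ measurable [set z | f z < g z].
  move=> hf hg; split.
    have := measurable_fun_ler hf hg measurableT (Y := [set true]) ltac:(by []).
    by rewrite setTI; congr measurable; apply/seteqP; split => z /=; case: (_ <= _).
  have := measurable_fun_ltr hf hg measurableT (Y := [set true]) ltac:(by []).
  by rewrite setTI; congr measurable; apply/seteqP; split => z /=; case: (_ < _).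
have [a1 b1] := H _ _ (measurable_cst p) m1.
have [a2 b2] := H _ _ m1 (measurable_cst q).
have [a3 b3] := H _ _ (mf m k) m2.
have [a4 b4] := H _ _ m2 (mf m' k').
case: c.
  rewrite (_ : trapezoid _ _ _ _ _ _ _ = [set z | p <= z.1] `&` [set z | z.1 <= q] `&`
    ([set z | m * z.1 + k <= z.2] `&` [set z | z.2 <= m' * z.1 + k'])).
    by do 3! [apply: measurableI => //].
  by apply/seteqP; split => z; rewrite /trapezoid /= !in_itv /=;
    [move=> [/andP[-> ->] /andP[-> ->]]|move=> [[-> ->] [-> ->]]].
rewrite (_ : trapezoid _ _ _ _ _ _ _ = [set z | p < z.1] `&` [set z | z.1 < q] `&`
  ([set z | m * z.1 + k < z.2] `&` [set z | z.2 < m' * z.1 + k'])).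
  by do 3! [apply: measurableI => //].
by apply/seteqP; split => z; rewrite /trapezoid /= !in_itv /=;
  [move=> [/andP[-> ->] /andP[-> ->]]|move=> [[-> ->] [-> ->]]].
Qed.

Lemma trapezoid_area (c : bool) (p q m k m' k' : R) : p <= q ->
  (forall x, p <= x <= q -> m * x + k <= m' * x + k') ->
  area (trapezoid c p q m k m' k') =
  ((m' - m) / 2 * (q ^+ 2 - p ^+ 2) + (k' - k) * (q - p))%:E.
Proof.
move=> pq h; rewrite -integral_affine // /area /product_measure1.
transitivity (\int[lebesgue_measure]_(x in [set` Interval (BSide c p) (BSide (~~ c) q)])
  ((m' - m) * x + (k' - k))%:E)%E.
  rewrite [RHS]integral_mkcond; apply: eq_integral => x _ /=.
  rewrite patchE; case: ifPn => hx.
    have pxq : p <= x <= q.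
      by move: hx; case: c; rewrite inE /= in_itv /= => /andP[] ? ?; lra.
    rewrite (_ : xsection _ _ =
      [set` Interval (BSide c (m * x + k)) (BSide (~~ c) (m' * x + k'))]).
      by rewrite lebesgue_measure_side ?h //; congr EFin; ring.
    apply/seteqP; split => y; rewrite /xsection /= !inE /trapezoid /=.
      by case.
    by move=> hy; split => //; move: hx; rewrite inE.
  rewrite (_ : xsection _ _ = set0) ?measure0 //.
  apply/seteqP; split => y //; rewrite /xsection /= !inE /trapezoid /= => -[hx' _].
  by move: hx; rewrite notin_setE /= hx'.
case: c => //=.
rewrite integral_itv_bndo_bndc ?integral_itv_obnd_cbnd //.
  apply/measurable_EFinP; apply: measurable_funD => //; apply: measurable_funM => //.
apply/measurable_EFinP; apply: measurable_funD => //; apply: measurable_funM => //.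
Qed.

(** [V] contains the triangle with apex [(p, y)] whose opposite side is vertical, at abscissa [q]
    from [s] to [t]. Slopes are multiplied out by [q - p] so that the flat case [p = q], where [V]
    is a null vertical line, fits the same statement. *)
Lemma vtri_closed_left (p q y s t : R) : p <= q -> s <= t ->
  exists V : set (R * R), [/\ measurable V, area V = ((t - s) * (q - p) / 2)%:E &
    forall z, p <= z.1 <= q -> (s - y) * (z.1 - p) <= (z.2 - y) * (q - p) ->
      (z.2 - y) * (q - p) <= (t - y) * (z.1 - p) -> V z].
Proof.
rewrite le_eqVlt => /predU1P[<-|pq] st.
  exists ([set p] `*` setT); split.
  - exact: measurableX.
  - by rewrite area_vertical subrr mulr0 mul0r.
  - by move=> z /andP[h1 h2] _ _; split => //=; apply/le_anti/andP.
have d0 : 0 < q - p by rewrite subr_gt0.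
pose m v : R := (v - y) / (q - p).
exists (trapezoid true p q (m s) (y - m s * p) (m t) (y - m t * p)); split.
- exact: trapezoid_measurable.
- rewrite trapezoid_area ?ltW //.
    by congr EFin; rewrite /m; field; rewrite lt0r_neq0.
  move=> x /andP[px xq].
  rewrite -subr_ge0 (_ : _ - _ = (t - s) / (q - p) * (x - p)).
    by rewrite !mulr_ge0 ?invr_ge0 ?subr_ge0 // ltW.
  by rewrite /m; field; rewrite lt0r_neq0.
- move=> z pzq h1 h2; split; rewrite /= in_itv //=.
  have e v : m v * z.1 + (y - m v * p) = y + (v - y) * (z.1 - p) / (q - p).
    by rewrite /m; field; rewrite lt0r_neq0.
  by rewrite !e; apply/andP; split; [rewrite -lerBrDl ler_pdivrMr|rewrite -lerBlDl ler_pdivlMr].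
Qed.

Lemma vtri_closed_right (p q y s t : R) : p <= q -> s <= t ->
  exists V : set (R * R), [/\ measurable V, area V = ((t - s) * (q - p) / 2)%:E &
    forall z, p <= z.1 <= q -> (s - y) * (q - z.1) <= (z.2 - y) * (q - p) ->
      (z.2 - y) * (q - p) <= (t - y) * (q - z.1) -> V z].
Proof.
rewrite le_eqVlt => /predU1P[<-|pq] st.
  exists ([set p] `*` setT); split.
  - exact: measurableX.
  - by rewrite area_vertical subrr mulr0 mul0r.
  - by move=> z /andP[h1 h2] _ _; split => //=; apply/le_anti/andP.
have d0 : 0 < q - p by rewrite subr_gt0.
pose m v : R := (v - y) / (q - p).
exists (trapezoid true p q (- m s) (y + m s * q) (- m t) (y + m t * q)); split.
- exact: trapezoid_measurable.
- rewrite trapezoid_area ?ltW //.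
    by congr EFin; rewrite /m; field; rewrite lt0r_neq0.
  move=> x /andP[px xq].
  rewrite -subr_ge0 (_ : _ - _ = (t - s) / (q - p) * (q - x)).
    by rewrite !mulr_ge0 ?invr_ge0 ?subr_ge0 // ltW.
  by rewrite /m; field; rewrite lt0r_neq0.
- move=> z pzq h1 h2; split; rewrite /= in_itv //=.
  have e v : - m v * z.1 + (y + m v * q) = y + (v - y) * (q - z.1) / (q - p).
    by rewrite /m; field; rewrite lt0r_neq0.
  by rewrite !e; apply/andP; split; [rewrite -lerBrDl ler_pdivrMr|rewrite -lerBlDl ler_pdivlMr].
Qed.

(** Inner counterpart of [vtri_closed_left]: here the measurable set is contained in the open
    triangle, and in the flat case it is empty. *)
Lemma vtri_open_left (p q y s t : R) : p <= q -> s <= t ->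
  exists V : set (R * R), [/\ measurable V, area V = ((t - s) * (q - p) / 2)%:E &
    forall z, V z -> [/\ p < z.1 < q, (s - y) * (z.1 - p) < (z.2 - y) * (q - p) &
      (z.2 - y) * (q - p) < (t - y) * (z.1 - p)]].
Proof.
rewrite le_eqVlt => /predU1P[<-|pq] st.
  exists set0; split => //.
  by rewrite /area measure0 subrr mulr0 mul0r.
have d0 : 0 < q - p by rewrite subr_gt0.
pose m v : R := (v - y) / (q - p).
exists (trapezoid false p q (m s) (y - m s * p) (m t) (y - m t * p)); split.
- exact: trapezoid_measurable.
- rewrite trapezoid_area ?ltW //.
    by congr EFin; rewrite /m; field; rewrite lt0r_neq0.
  move=> x /andP[px xq].
  rewrite -subr_ge0 (_ : _ - _ = (t - s) / (q - p) * (x - p)).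
    by rewrite !mulr_ge0 ?invr_ge0 ?subr_ge0 // ltW.
  by rewrite /m; field; rewrite lt0r_neq0.
- move=> z []; rewrite /= !in_itv /=.
  have e v : m v * z.1 + (y - m v * p) = y + (v - y) * (z.1 - p) / (q - p).
    by rewrite /m; field; rewrite lt0r_neq0.
  rewrite !e => -> /andP[]; rewrite -ltrBrDl ltr_pdivrMr // => ->.
  by rewrite -ltrBlDl ltr_pdivlMr // => ->.
Qed.

Lemma vtri_open_right (p q y s t : R) : p <= q -> s <= t ->
  exists V : set (R * R), [/\ measurable V, area V = ((t - s) * (q - p) / 2)%:E &
    forall z, V z -> [/\ p < z.1 < q, (s - y) * (q - z.1) < (z.2 - y) * (q - p) &
      (z.2 - y) * (q - p) < (t - y) * (q - z.1)]].
Proof.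
rewrite le_eqVlt => /predU1P[<-|pq] st.
  exists set0; split => //.
  by rewrite /area measure0 subrr mulr0 mul0r.
have d0 : 0 < q - p by rewrite subr_gt0.
pose m v : R := (v - y) / (q - p).
exists (trapezoid false p q (- m s) (y + m s * q) (- m t) (y + m t * q)); split.
- exact: trapezoid_measurable.
- rewrite trapezoid_area ?ltW //.
    by congr EFin; rewrite /m; field; rewrite lt0r_neq0.
  move=> x /andP[px xq].
  rewrite -subr_ge0 (_ : _ - _ = (t - s) / (q - p) * (q - x)).
    by rewrite !mulr_ge0 ?invr_ge0 ?subr_ge0 // ltW.
  by rewrite /m; field; rewrite lt0r_neq0.
- move=> z []; rewrite /= !in_itv /=.
  have e v : - m v * z.1 + (y + m v * q) = y + (v - y) * (q - z.1) / (q - p).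
    by rewrite /m; field; rewrite lt0r_neq0.
  rewrite !e => -> /andP[]; rewrite -ltrBrDl ltr_pdivrMr // => ->.
  by rewrite -ltrBlDl ltr_pdivlMr // => ->.
Qed.

(** Certificate form: an equality that follows from a known one [p = q] is reduced to a polynomial
    identity once the multiplier [k] is supplied. *)
Lemma eq_from_multiple (x y k p q : R) : p = q -> x - y = k * (p - q) -> x = y.
Proof. by move=> ->; rewrite subrr mulr0 => /eqP; rewrite subr_eq0 => /eqP. Qed.

Implicit Types a b c z : R * R.

Definition tri a b c : set (R * R) :=
  [set z | exists al be ga : R, [/\ 0 <= al, 0 <= be, 0 <= ga, al + be + ga = 1 &
    z = al *: a + be *: b + ga *: c]].

Definition otri a b c : set (R * R) :=
  [set z | exists al be ga : R, [/\ 0 < al, 0 < be, 0 < ga, al + be + ga = 1 &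
    z = al *: a + be *: b + ga *: c]].

Lemma tri_swap12 a b c : tri a b c `<=` tri b a c.
Proof.
move=> z [al [be [ga [h1 h2 h3 h4 ->]]]]; exists be, al, ga; split => //.
  by rewrite -h4; ring.
by rewrite [be *: b + _]addrC.
Qed.

Lemma tri_swap23 a b c : tri a b c `<=` tri a c b.
Proof.
move=> z [al [be [ga [h1 h2 h3 h4 ->]]]]; exists al, ga, be; split => //.
  by rewrite -h4; ring.
by rewrite addrAC.
Qed.

Lemma otri_swap12 a b c : otri a b c `<=` otri b a c.
Proof.
move=> z [al [be [ga [h1 h2 h3 h4 ->]]]]; exists be, al, ga; split => //.
  by rewrite -h4; ring.
by rewrite [be *: b + _]addrC.
Qed.

Lemma otri_swap23 a b c : otri a b c `<=` otri a c b.
Proof.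
move=> z [al [be [ga [h1 h2 h3 h4 ->]]]]; exists al, ga, be; split => //.
  by rewrite -h4; ring.
by rewrite addrAC.
Qed.

Lemma orient_tri a b c u v (al be ga : R) : al + be + ga = 1 ->
  orient u v (al *: a + be *: b + ga *: c) =
  al * orient u v a + be * orient u v b + ga * orient u v c.
Proof.
move=> e; have -> : al = 1 - be - ga by rewrite -e; ring.
by vsimp; ring.
Qed.


(** The vertical line through the middle vertex [b] cuts the triangle into two triangles with a
    common vertical side, from [b] to the point of ordinate [l] on the side [a c]. Barycentric
    coordinates then verify the slope inequalities of the two pieces. *)
Lemma tri_area_sorted a b c : a.1 <= b.1 <= c.1 -> a.1 < c.1 ->
  exists V : set (R * R), [/\ measurable V, tri a b c `<=` V &
    (area V <= (`|orient a b c| / 2)%:E)%E].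
Proof.
move=> /andP[ab bc] ac.
pose l := (a.2 * (c.1 - b.1) + c.2 * (b.1 - a.1)) / (c.1 - a.1).
have oE : orient a b c = (l - b.2) * (c.1 - a.1).
  by rewrite /l; vsimp; field; lra.
pose s := Num.min l b.2; pose t := Num.max l b.2.
have st : s <= t by rewrite /s /t le_max !ge_min lexx.
have tsE : `|orient a b c| / 2 = (t - s) * (b.1 - a.1) / 2 + (t - s) * (c.1 - b.1) / 2.
  rewrite oE normrM (gtr0_norm (_ : 0 < c.1 - a.1)) ?subr_gt0 //.
  have -> : `|l - b.2| = t - s.
    by rewrite /t /s; case: leP => h; [rewrite ler0_norm|rewrite gtr0_norm]; lra.
  by ring.
have [V1 [mV1 aV1 h1]] := vtri_closed_left a.2 ab st.
have [V2 [mV2 aV2 h2]] := vtri_closed_right c.2 bc st.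
exists (V1 `|` V2); split.
- exact: measurableU.
- move=> z [al [be [ga [al0 be0 ga0 e zE]]]].
  have e1 : al = 1 - be - ga by rewrite -e; ring.
  have z1 : z.1 = a.1 + be * (b.1 - a.1) + ga * (c.1 - a.1).
    by rewrite zE e1; vsimp; ring.
  have z2 : z.2 = a.2 + be * (b.2 - a.2) + ga * (c.2 - a.2).
    by rewrite zE e1; vsimp; ring.
  have lE : l * (c.1 - a.1) = a.2 * (c.1 - b.1) + c.2 * (b.1 - a.1).
    by rewrite /l divfK // subr_eq0 gt_eqF.
  have D0 : 0 < c.1 - a.1 by lra.
  have az : a.1 <= z.1 by rewrite z1 -addrA lerDl addr_ge0 // mulr_ge0 // subr_ge0 // ltW.
  have zc : z.1 <= c.1.
    rewrite -subr_ge0 (_ : _ - _ = al * (c.1 - a.1) + be * (c.1 - b.1)).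
      by rewrite addr_ge0 // mulr_ge0 // subr_ge0 // ltW.
    by rewrite z1 e1; ring.
  have u1 : (z.2 - a.2) * (b.1 - a.1) - (b.2 - a.2) * (z.1 - a.1) = ga * (l - b.2) * (c.1 - a.1).
    by apply: (eq_from_multiple (k := - ga) lE); rewrite z1 z2; ring.
  have u2 : ((z.2 - a.2) * (b.1 - a.1) - (l - a.2) * (z.1 - a.1)) * (c.1 - a.1) =
      (b.1 - a.1) * be * (b.2 - l) * (c.1 - a.1).
    by apply: (eq_from_multiple (k := - ga * (c.1 - a.1)) lE); rewrite z1 z2; ring.
  have {}u2 := mulIf (lt0r_neq0 D0) u2.
  have v1 : (z.2 - c.2) * (c.1 - b.1) - (b.2 - c.2) * (c.1 - z.1) = al * (l - b.2) * (c.1 - a.1).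
    by apply: (eq_from_multiple (k := - al) lE); rewrite z1 z2 e1; ring.
  have v2 : ((z.2 - c.2) * (c.1 - b.1) - (l - c.2) * (c.1 - z.1)) * (c.1 - a.1) =
      (c.1 - b.1) * be * (b.2 - l) * (c.1 - a.1).
    by apply: (eq_from_multiple (k := - al * (c.1 - a.1)) lE); rewrite z1 z2 e1; ring.
  have {}v2 := mulIf (lt0r_neq0 D0) v2.
  have ab0 : 0 <= b.1 - a.1 by rewrite subr_ge0.
  have bc0 : 0 <= c.1 - b.1 by rewrite subr_ge0.
  have D1 : 0 <= c.1 - a.1 by exact: ltW.
  have [lb|bl] := leP l b.2.
    have sE : s = l by exact: min_l.
    have tE : t = b.2 by exact: max_r.
    rewrite sE tE in h1 h2.
    have lb0 : 0 <= b.2 - l by rewrite subr_ge0.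
    have p1 := mulr_ge0 (mulr_ge0 ga0 lb0) D1; have p2 := mulr_ge0 (mulr_ge0 ab0 be0) lb0.
    have q1 := mulr_ge0 (mulr_ge0 al0 lb0) D1; have q2 := mulr_ge0 (mulr_ge0 bc0 be0) lb0.
    have u1' : (b.2 - a.2) * (z.1 - a.1) - (z.2 - a.2) * (b.1 - a.1) =
      ga * (b.2 - l) * (c.1 - a.1) by rewrite -opprB u1; ring.
    have v1' : (b.2 - c.2) * (c.1 - z.1) - (z.2 - c.2) * (c.1 - b.1) =
      al * (b.2 - l) * (c.1 - a.1) by rewrite -opprB v1; ring.
    have [zb|bz] := leP z.1 b.1; [left; apply: h1|right; apply: h2].
    + by rewrite az zb.
    + by rewrite -subr_ge0 u2.
    + by rewrite -subr_ge0 u1'.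
    + by rewrite zc ltW.
    + by rewrite -subr_ge0 v2.
    + by rewrite -subr_ge0 v1'.
  have sE : s = b.2 by apply: min_r; exact: ltW.
  have tE : t = l by apply: max_l; exact: ltW.
  rewrite sE tE in h1 h2.
  have lb0 : 0 <= l - b.2 by rewrite subr_ge0 ltW.
  have p1 := mulr_ge0 (mulr_ge0 ga0 lb0) D1; have p2 := mulr_ge0 (mulr_ge0 ab0 be0) lb0.
  have q1 := mulr_ge0 (mulr_ge0 al0 lb0) D1; have q2 := mulr_ge0 (mulr_ge0 bc0 be0) lb0.
  have u2' : (l - a.2) * (z.1 - a.1) - (z.2 - a.2) * (b.1 - a.1) =
    (b.1 - a.1) * be * (l - b.2) by rewrite -opprB u2; ring.
  have v2' : (l - c.2) * (c.1 - z.1) - (z.2 - c.2) * (c.1 - b.1) =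
    (c.1 - b.1) * be * (l - b.2) by rewrite -opprB v2; ring.
  have [zb|bz] := leP z.1 b.1; [left; apply: h1|right; apply: h2].
  + by rewrite az zb.
  + by rewrite -subr_ge0 u1.
  + by rewrite -subr_ge0 u2'.
  + by rewrite zc ltW.
  + by rewrite -subr_ge0 v1.
  + by rewrite -subr_ge0 v2'.
- apply: le_trans (areaU_le mV1 mV2) _.
  by rewrite aV1 aV2 tsE EFinD.
Qed.


(** Same vertical cut as for the closed triangle, from inside: a point of either open piece has
    positive barycentric coordinates. Two of them are read off from the inequalities of the piece,
    the third from the abscissa. *)
Lemma otri_area_sorted a b c : a.1 <= b.1 <= c.1 -> orient a b c != 0 ->
  exists V : set (R * R), [/\ measurable V, V `<=` otri a b c &
    ((`|orient a b c| / 2)%:E <= area V)%E].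
Proof.
move=> /andP[ab bc] o0.
have ac : a.1 < c.1.
  rewrite lt_neqAle (le_trans ab bc) andbT; apply: contraNneq o0 => h.
  have hb : b.1 = a.1 by apply/le_anti; rewrite ab h bc.
  by apply/eqP; vsimp; rewrite hb -h; ring.
pose l := (a.2 * (c.1 - b.1) + c.2 * (b.1 - a.1)) / (c.1 - a.1).
have oE : orient a b c = (l - b.2) * (c.1 - a.1).
  by rewrite /l; vsimp; field; lra.
pose s := Num.min l b.2; pose t := Num.max l b.2.
have st : s <= t by rewrite /s /t le_max !ge_min lexx.
have tsE : `|orient a b c| / 2 = (t - s) * (b.1 - a.1) / 2 + (t - s) * (c.1 - b.1) / 2.
  rewrite oE normrM (gtr0_norm (_ : 0 < c.1 - a.1)) ?subr_gt0 //.
  have -> : `|l - b.2| = t - s.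
    by rewrite /t /s; case: leP => h; [rewrite ler0_norm|rewrite gtr0_norm]; lra.
  by ring.
have [V1 [mV1 aV1 h1]] := vtri_open_left a.2 ab st.
have [V2 [mV2 aV2 h2]] := vtri_open_right c.2 bc st.
exists (V1 `|` V2); split.
- exact: measurableU.
- have D0 : 0 < c.1 - a.1 by lra.
  have lE : l * (c.1 - a.1) = a.2 * (c.1 - b.1) + c.2 * (b.1 - a.1).
    by rewrite /l divfK // subr_eq0 gt_eqF.
  have bary z (al be ga : R) : al + be + ga = 1 ->
      be * orient a b c = orient a z c -> ga * orient a b c = orient a b z ->
      0 < al -> 0 < be -> 0 < ga -> otri a b c z.
    move=> e eb eg al0 be0 ga0; exists al, be, ga; split => //.
    have -> : al = 1 - be - ga by rewrite -e; ring.
    apply: pair_ext; vsimp; apply: (mulfI o0).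
      transitivity (a.1 * orient a b c + be * orient a b c * (b.1 - a.1) +
        ga * orient a b c * (c.1 - a.1)); last by ring.
      by rewrite eb eg; vsimp; ring.
    transitivity (a.2 * orient a b c + be * orient a b c * (b.2 - a.2) +
        ga * orient a b c * (c.2 - a.2)); last by ring.
    by rewrite eb eg; vsimp; ring.
  (* The barycentric coordinates are quotients of oriented areas. *)
  move=> z Vz; pose be := orient a z c / orient a b c; pose ga := orient a b z / orient a b c.
  pose al := orient z b c / orient a b c.
  have eb : be * orient a b c = orient a z c by rewrite divfK.
  have eg : ga * orient a b c = orient a b z by rewrite divfK.
  have ea : al * orient a b c = orient z b c by rewrite divfK.
  have e1 : al + be + ga = 1.
    by apply: (mulIf o0); rewrite !mulrDl ea eb eg mul1r; vsimp; ring.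
  suff [al0 be0 ga0] : [/\ 0 < al, 0 < be & 0 < ga] by apply: (bary z al be ga).
  have oz : orient a z c = (l - z.2) * (c.1 - a.1) + (c.2 - a.2) * (z.1 - b.1).
    by rewrite mulrBl lE; vsimp; ring.
  have lam : al = 1 - be - ga by rewrite -e1; ring.
  have z1 : z.1 - a.1 = be * (b.1 - a.1) + ga * (c.1 - a.1).
    apply: (mulIf o0); transitivity (be * orient a b c * (b.1 - a.1) +
      ga * orient a b c * (c.1 - a.1)); last by ring.
    by rewrite eb eg; vsimp; ring.
  have z2 : z.2 - a.2 = be * (b.2 - a.2) + ga * (c.2 - a.2).
    apply: (mulIf o0); transitivity (be * orient a b c * (b.2 - a.2) +
      ga * orient a b c * (c.2 - a.2)); last by ring.
    by rewrite eb eg; vsimp; ring.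
  have u1 : (z.2 - a.2) * (b.1 - a.1) - (b.2 - a.2) * (z.1 - a.1) = ga * orient a b c.
    by rewrite eg; vsimp; ring.
  have z1' : z.1 = a.1 + be * (b.1 - a.1) + ga * (c.1 - a.1) by rewrite -addrA -z1; ring.
  have z2' : z.2 = a.2 + be * (b.2 - a.2) + ga * (c.2 - a.2) by rewrite -addrA -z2; ring.
  have u2 : (z.2 - a.2) * (b.1 - a.1) - (l - a.2) * (z.1 - a.1) = (b.1 - a.1) * be * (b.2 - l).
    apply: (mulIf (lt0r_neq0 D0)).
    by apply: (eq_from_multiple (k := - ga * (c.1 - a.1)) lE); rewrite z1' z2'; ring.
  have v1 : (z.2 - c.2) * (c.1 - b.1) - (b.2 - c.2) * (c.1 - z.1) = al * orient a b c.
    by rewrite ea; vsimp; ring.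
  have v2 : (z.2 - c.2) * (c.1 - b.1) - (l - c.2) * (c.1 - z.1) = (c.1 - b.1) * be * (b.2 - l).
    apply: (mulIf (lt0r_neq0 D0)).
    by apply: (eq_from_multiple (k := - al * (c.1 - a.1)) lE); rewrite z1' z2' lam; ring.
  have lb : l - b.2 != 0.
    by apply: contraNneq o0 => h; rewrite oE h mul0r.
  rewrite oE in u1 v1.
  have sgn : (l < b.2 /\ s = l /\ t = b.2) \/ (b.2 < l /\ s = b.2 /\ t = l).
    by rewrite /s /t; case: ltgtP lb => h; [left|right|rewrite h subrr eqxx].
  case: Vz => [/h1|/h2] [/andP[x1 x2] x3 x4].
    have ab' : 0 < b.1 - a.1 by rewrite subr_gt0 (lt_trans x1).
    have [be0 ga0] : 0 < be /\ 0 < ga.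
      case: sgn => -[lb' [sE tE]]; rewrite sE -subr_gt0 in x3; rewrite tE -subr_lt0 in x4.
        have l1 : 0 < b.2 - l by rewrite subr_gt0.
        have l2 : (l - b.2) * (c.1 - a.1) < 0 by rewrite pmulr_llt0 // subr_lt0.
        by move: x3 x4; rewrite u2 u1 (pmulr_lgt0 _ l1) (pmulr_rgt0 _ ab') (nmulr_llt0 _ l2).
      have l1 : b.2 - l < 0 by rewrite subr_lt0.
      have l2 : 0 < (l - b.2) * (c.1 - a.1) by rewrite mulr_gt0 // subr_gt0.
      by move: x4 x3; rewrite u2 u1 (pmulr_lgt0 _ l2) (nmulr_llt0 _ l1) (pmulr_rgt0 _ ab').
    split=> //; rewrite lam.
    have : 0 <= ga * (c.1 - b.1) by rewrite mulr_ge0 ?subr_ge0 // ltW.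
    rewrite -(pmulr_lgt0 _ ab'); clear -z1 x2; lra.
  have bc' : 0 < c.1 - b.1 by rewrite subr_gt0 (lt_trans x1).
  have [be0 al0] : 0 < be /\ 0 < al.
    case: sgn => -[lb' [sE tE]]; rewrite sE -subr_gt0 in x3; rewrite tE -subr_lt0 in x4.
      have l1 : 0 < b.2 - l by rewrite subr_gt0.
      have l2 : (l - b.2) * (c.1 - a.1) < 0 by rewrite pmulr_llt0 // subr_lt0.
      by move: x3 x4; rewrite v2 v1 (pmulr_lgt0 _ l1) (pmulr_rgt0 _ bc') (nmulr_llt0 _ l2).
    have l1 : b.2 - l < 0 by rewrite subr_lt0.
    have l2 : 0 < (l - b.2) * (c.1 - a.1) by rewrite mulr_gt0 // subr_gt0.
    by move: x4 x3; rewrite v2 v1 (pmulr_lgt0 _ l2) (nmulr_llt0 _ l1) (pmulr_rgt0 _ bc').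
  split=> //.
  have gE : ga = 1 - al - be by rewrite -e1; ring.
  have : 0 <= al * (b.1 - a.1) by rewrite mulr_ge0 ?subr_ge0 // ltW.
  rewrite -(pmulr_lgt0 _ bc'); move: z1; rewrite gE; clear -x1; lra.
- rewrite areaU //.
    by rewrite aV1 aV2 -EFinD lee_fin tsE.
  apply/seteqP; split => z // [/h1[/andP[_ x1] _ _] /h2[/andP[x2 _] _ _]].
  by have := lt_trans x1 x2; rewrite ltxx.
Qed.


Lemma sort3_ind (P : R * R -> R * R -> R * R -> Prop) :
  (forall a b c, P a b c -> P b a c) -> (forall a b c, P a b c -> P a c b) ->
  (forall a b c, a.1 <= b.1 <= c.1 -> P a b c) -> forall a b c, P a b c.
Proof.
move=> s12 s23 H a b c.
have [ab|/ltW ab] := leP a.1 b.1; have [bc|/ltW bc] := leP b.1 c.1;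
  have [ac|/ltW ac] := leP a.1 c.1.
- by apply: H; rewrite ab bc.
- by apply: H; rewrite ab bc.
- by apply: (s23); apply: H; rewrite ac bc.
- by apply: (s23); apply: (s12); apply: H; rewrite ac ab.
- by apply: (s12); apply: H; rewrite ab ac.
- by apply: (s12); apply: (s23); apply: H; rewrite bc ac.
- by apply: (s23); apply: (s12); apply: (s23); apply: H; rewrite bc ab.
- by apply: (s23); apply: (s12); apply: (s23); apply: H; rewrite bc ab.
Qed.

(** A measurable set around the triangle is all that upper bounds on areas require; [otri_area] is
    its counterpart for lower bounds. A triangle with its three vertices on one vertical line is
    covered by that null line. *)
Lemma tri_area a b c :
  exists V : set (R * R), [/\ measurable V, tri a b c `<=` V &
    (area V <= (`|orient a b c| / 2)%:E)%E].
Proof.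
move: a b c; apply: sort3_ind => a b c.
- move=> [V [mV sV aV]]; exists V; split => //.
    by apply: subset_trans sV; exact: tri_swap12.
  by rewrite -(orient_rot b a c) orient_swap normrN.
- move=> [V [mV sV aV]]; exists V; split => //.
    by apply: subset_trans sV; exact: tri_swap23.
  by rewrite orient_swap normrN.
- move=> abc; have [ac|ca] := ltP a.1 c.1; first exact: tri_area_sorted.
  move: abc => /andP[ab bc].
  have bE : b.1 = a.1 by apply/le_anti; rewrite ab (le_trans bc ca).
  have cE : c.1 = a.1 by apply/le_anti; rewrite ca (le_trans ab bc).
  exists ([set a.1] `*` setT); split.
  + exact: measurableX.
  + move=> z [al [be [ga [_ _ _ e ->]]]]; split => //; vsimp; rewrite bE cE.
    by rewrite -!mulrDl e mul1r.
  + by rewrite area_vertical lee_fin divr_ge0.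
Qed.

Lemma otri_area a b c :
  exists V : set (R * R), [/\ measurable V, V `<=` otri a b c &
    ((`|orient a b c| / 2)%:E <= area V)%E].
Proof.
have [h0|] := eqVneq (orient a b c) 0.
  exists set0; split => //.
  by rewrite h0 normr0 mul0r /area measure0.
move: a b c; apply: sort3_ind => a b c.
- move=> H o0; have [|V [mV sV aV]] := H.
    by rewrite -orient_rot orient_swap oppr_eq0.
  exists V; split => //; first by apply: subset_trans sV _; exact: otri_swap12.
  by rewrite -(orient_rot b a c) orient_swap normrN.
- move=> H o0; have [|V [mV sV aV]] := H.
    by rewrite orient_swap oppr_eq0.
  exists V; split => //; first by apply: subset_trans sV _; exact: otri_swap23.
  by rewrite orient_swap normrN.
- by move=> abc o0; apply: otri_area_sorted.
Qed.

End Area.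

(** * L'Huilier's inequality *)

Section Lhuilier.
Context {R : realType}.
Implicit Types (u v w : R * R).

(** For consecutive edge vectors of a polygon, [ang u v] is the exterior angle, so this is the
    tangent of half of it, the quantity summed in L'Huilier's inequality. *)
Definition thalf u v : R := tan (ang u v / 2).

Lemma tan_half_bound (x : R) : 0 < x < pi ->
  [/\ 0 < tan (x / 2), sin x = 2 * tan (x / 2) / (1 + tan (x / 2) ^+ 2) &
    cos x = (1 - tan (x / 2) ^+ 2) / (1 + tan (x / 2) ^+ 2)].
Proof.
move=> /andP[x0 xp].
have c0 : 0 < cos (x / 2) by apply: cos_gt0_pihalf; lra.
have s0 : 0 < sin (x / 2) by apply: sin_gt0_pihalf; lra.
have e := cos2Dsin2 (x / 2).
have d0 : 1 + tan (x / 2) ^+ 2 = (cos (x / 2) ^+ 2)^-1.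
  by rewrite -(cos2_tan2 (lt0r_neq0 c0)).
split.
- by rewrite /tan divr_gt0.
- rewrite d0 invrK {1}(_ : x = x / 2 + x / 2); last by lra.
  by rewrite sinD /tan; field; exact: lt0r_neq0.
- rewrite d0 invrK {1}(_ : x = x / 2 + x / 2); last by lra.
  rewrite cosD /tan; field; exact: lt0r_neq0.
Qed.

Lemma thalf_spec u v : 0 < cross u v ->
  [/\ 0 < thalf u v,
    cross u v = enorm u * enorm v * (2 * thalf u v / (1 + thalf u v ^+ 2)) &
    dot u v = enorm u * enorm v * ((1 - thalf u v ^+ 2) / (1 + thalf u v ^+ 2))].
Proof.
move=> c0; have u0 := cross_neq0l (lt0r_neq0 c0).
have v0 := cross_neq0r (lt0r_neq0 c0).
have [h1 h2 h3] := tan_half_bound (ang_gt0 c0).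
rewrite /thalf -h2 -h3 -ang_cos //; split => //.
by rewrite -ang_sin // gtr0_norm.
Qed.

Lemma thalfE u v : 0 < cross u v ->
  thalf u v = cross u v / (enorm u * enorm v + dot u v).
Proof.
move=> c0; have [h1 -> ->] := thalf_spec c0.
have u0 : 0 < enorm u by rewrite enorm_gt0 (cross_neq0l (lt0r_neq0 c0)).
have v0 : 0 < enorm v by rewrite enorm_gt0 (cross_neq0r (lt0r_neq0 c0)).
have t2 : 0 < 1 + thalf u v ^+ 2 by rewrite ltr_pwDl // sqr_ge0.
field; rewrite ?(lt0r_neq0 t2) ?(lt0r_neq0 u0) ?(lt0r_neq0 v0) //=.
rewrite (_ : _ + _ = 2 * (enorm u * enorm v)); last by ring.
by rewrite !mulf_neq0 // ?lt0r_neq0.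
Qed.

(** Addition formula of tan. Both sides being positive, so is the denominator, which gives the bound
    on the product. *)
Lemma thalfD u v w : 0 < cross u v -> 0 < cross v w -> 0 < cross u w ->
  thalf u v * thalf v w < 1 /\
  thalf u w = (thalf u v + thalf v w) / (1 - thalf u v * thalf v w).
Proof.
move=> uv vw uw.
have half_cos x : 0 < x < pi -> cos (x / 2) != 0 :> R.
  by move=> ?; apply: lt0r_neq0; apply: cos_gt0_pihalf; lra.
have E : thalf u w = (thalf u v + thalf v w) / (1 - thalf u v * thalf v w).
  by rewrite /thalf (angD uv vw uw) mulrDl tanD // half_cos // ang_gt0.
split=> //.
have [h1 _ _] := thalf_spec uv; have [h2 _ _] := thalf_spec vw.
have [h3 _ _] := thalf_spec uw; move: h3; rewrite E.
by rewrite pmulr_rgt0 ?addr_gt0 // invr_gt0 subr_gt0.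
Qed.

(* Prolonging the edges [e0] and [e2] until they meet replaces the edge [e1] by
   [l *: e0 + k *: e2]. The half perimeter grows by [a], the sum of the half
   tangents by [al], and the area by [a ^+ 2 / al]. *)
Lemma prolong_edges e0 e1 e2 : 0 < cross e0 e1 -> 0 < cross e1 e2 ->
  0 < cross e0 e2 ->
  exists l k a al : R, [/\ 0 < l, 0 < k, 0 < al, e1 = l *: e0 + k *: e2 &
    [/\ l * enorm e0 + k * enorm e2 = enorm e1 + 2 * a,
      thalf e0 e2 = thalf e0 e1 + thalf e1 e2 + al &
      l * k * cross e0 e2 / 2 = a ^+ 2 / al]].
Proof.
move=> c01 c12 c02.
have [pq1 tE] := thalfD c01 c12 c02.
have [p0 c01E _] := thalf_spec c01; have [q0 c12E _] := thalf_spec c12.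
have [t0 c02E _] := thalf_spec c02; rewrite tE in c02E.
set p := thalf e0 e1 in pq1 tE p0 c01E c02E *.
set q := thalf e1 e2 in pq1 tE q0 c12E c02E *.
have n0 : 0 < enorm e0 by rewrite enorm_gt0 (cross_neq0l (lt0r_neq0 c01)).
have n1 : 0 < enorm e1 by rewrite enorm_gt0 (cross_neq0r (lt0r_neq0 c01)).
have n2 : 0 < enorm e2 by rewrite enorm_gt0 (cross_neq0r (lt0r_neq0 c02)).
have d0 : 0 < 1 - p * q by rewrite subr_gt0.
have pqs : 0 < p + q by rewrite addr_gt0.
have p2 : 0 < 1 + p ^+ 2 by rewrite ltr_pwDl // sqr_ge0.
have q2 : 0 < 1 + q ^+ 2 by rewrite ltr_pwDl // sqr_ge0.
have T2 : 1 + ((p + q) / (1 - p * q)) ^+ 2 =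
    (1 + p ^+ 2) * (1 + q ^+ 2) / (1 - p * q) ^+ 2.
  by field; exact: lt0r_neq0.
rewrite T2 in c02E.
(* The first two witnesses are Cramer's coefficients of [e1] in the basis [e0], [e2]. The last is
   the excess of the tangent of a sum over the sum of the tangents, (p + q) / (1 - p q) - (p +
   q). *)
exists (cross e1 e2 / cross e0 e2), (cross e0 e1 / cross e0 e2),
  (enorm e1 * (p * q) / (1 - p * q)), ((p + q) * (p * q) / (1 - p * q)).
have pq0 : 0 < p * q := mulr_gt0 p0 q0.
split.
- exact: divr_gt0.
- exact: divr_gt0.
- exact: divr_gt0 (mulr_gt0 pqs pq0) d0.
- by apply: pair_ext; vsimp; field; exact: (lt0r_neq0 c02).
- split.
  + rewrite c01E c12E c02E; field; rewrite ?lt0r_neq0 //=.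
  + by rewrite tE; field; exact: lt0r_neq0.
  + rewrite c01E c12E c02E; field; rewrite ?lt0r_neq0 //=.
Qed.

(** Every triangle has an inscribed circle, so equality holds. The proof writes each half tangent
    with the side lengths and ends with Heron's formula. *)
Lemma lhuilier_triangle u v w : u + v + w = 0 -> 0 < cross u v ->
  4 * (cross u v / 2) * (thalf u v + thalf v w + thalf w u) <=
  (enorm u + enorm v + enorm w) ^+ 2.
Proof.
move=> s0 uv.
have wE : w = - (u + v) by apply/eqP; rewrite -subr_eq0 opprK addrC s0.
have vw : cross v w = cross u v by rewrite wE; vsimp; ring.
have wu : cross w u = cross u v by rewrite wE; vsimp; ring.
have wv0 : 0 < cross v w by rewrite vw.
have wu0 : 0 < cross w u by rewrite wu.
rewrite !thalfE // vw wu.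
have du := enormK u; have dv := enormK v; have dw := enormK w.
have uv2 : dot u v = (enorm w ^+ 2 - enorm u ^+ 2 - enorm v ^+ 2) / 2.
  by rewrite !expr2 du dv dw wE; vsimp; field.
have vw2 : dot v w = (enorm u ^+ 2 - enorm v ^+ 2 - enorm w ^+ 2) / 2.
  by rewrite !expr2 du dv dw wE; vsimp; field.
have wu2 : dot w u = (enorm v ^+ 2 - enorm w ^+ 2 - enorm u ^+ 2) / 2.
  by rewrite !expr2 du dv dw wE; vsimp; field.
have [t1 _ _] := thalf_spec uv; have [t2 _ _] := thalf_spec wv0.
have [t3 _ _] := thalf_spec wu0.
have D2 := enormM_sqr u v.
rewrite thalfE // in t1; rewrite thalfE // in t2; rewrite thalfE // in t3.
rewrite pmulr_rgt0 // invr_gt0 uv2 in t1; rewrite pmulr_rgt0 // invr_gt0 vw2 in t2.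
rewrite pmulr_rgt0 // invr_gt0 wu2 in t3; rewrite uv2 in D2.
rewrite uv2 vw2 wu2.
move: (enorm u) (enorm v) (enorm w) (cross u v) t1 t2 t3 D2 uv => a b c D t1 t2 t3 D2 D0.
have x1 : (c + a - b) * (c + b - a) = 2 * (a * b + (c ^+ 2 - a ^+ 2 - b ^+ 2) / 2) by field.
have x2 : (a + b - c) * (a + c - b) = 2 * (b * c + (a ^+ 2 - b ^+ 2 - c ^+ 2) / 2) by field.
have x3 : (b + c - a) * (b + a - c) = 2 * (c * a + (b ^+ 2 - c ^+ 2 - a ^+ 2) / 2) by field.
rewrite le_eqVlt; apply/orP; left; apply/eqP.
have n1 : (c + a - b) * (c + b - a) != 0 by rewrite x1 mulf_neq0 // lt0r_neq0.
have n2 : (a + b - c) * (a + c - b) != 0 by rewrite x2 mulf_neq0 // lt0r_neq0.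
rewrite (_ : a * b + _ = (c + a - b) * (c + b - a) / 2); last by rewrite x1; field.
rewrite (_ : b * c + _ = (a + b - c) * (a + c - b) / 2); last by rewrite x2; field.
rewrite (_ : c * a + _ = (b + c - a) * (b + a - c) / 2); last by rewrite x3; field.
move: n1 n2; rewrite !mulf_eq0 !negb_or => /andP[k1 k2] /andP[k3 k4].
have k5 : b + c - a != 0 by rewrite [b + c]addrC.
have D2' : D ^+ 2 = (a + b + c) * (a + b - c) * (a + c - b) * (b + c - a) / 4.
  by apply: (@addrI _ (((c ^+ 2 - a ^+ 2 - b ^+ 2) / 2) ^+ 2)); rewrite -D2; field.
transitivity (4 * (D ^+ 2) * (a + b + c) / ((a + b - c) * (a + c - b) * (b + c - a))).
  field; rewrite ?k1 ?k2 ?k3 ?k4 ?k5 //=.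
rewrite D2'; field; rewrite ?k1 ?k2 ?k3 ?k4 ?k5 //=.
Qed.

(** Induction step of L'Huilier's inequality, from the polygon with prolonged edges back to the
    original one. It is the Cauchy-Schwarz inequality q^2 / (S + al) <= (q - a)^2 / S + a^2 / al,
    whose defect is an explicit square. *)
Lemma cut_corner (q a al A S : R) : 0 < al -> 0 <= S ->
  (A + a ^+ 2 / al) * (S + al) <= q ^+ 2 -> A * S <= (q - a) ^+ 2.
Proof.
move=> al0 S0 h.
have S1 : 0 < S + al by lra.
have hA : A <= q ^+ 2 / (S + al) - a ^+ 2 / al.
  by rewrite lerBrDr ler_pdivlMr.
apply: le_trans (ler_wpM2r S0 hA) _.
rewrite -subr_ge0 (_ : _ - _ = (q * al - a * (S + al)) ^+ 2 / (al * (S + al))).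
  by rewrite divr_ge0 ?sqr_ge0 // mulr_ge0 // ltW.
by field; rewrite !lt0r_neq0.
Qed.

Lemma thalfZ (s t : R) u v : 0 < s -> 0 < t -> thalf (s *: u) (t *: v) = thalf u v.
Proof. by move=> s0 t0; rewrite /thalf angZ // angC angZ // angC. Qed.

(** Prolonging [e0], [e2] over [e1] and [e2], [e4] over [e3] encloses the pentagon in a triangle
    with sides parallel to [e0], [e2], [e4]. Equality for that triangle is carried back by cutting
    its two extra corners. *)
Lemma lhuilier_pentagon_cut e0 e1 e2 e3 e4 : e0 + e1 + e2 + e3 + e4 = 0 ->
  0 < cross e0 e1 -> 0 < cross e1 e2 -> 0 < cross e2 e3 -> 0 < cross e3 e4 ->
  0 < cross e4 e0 -> 0 < cross e0 e2 -> 0 < cross e2 e4 ->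
  (cross e0 e1 + cross (e0 + e1) e2 + cross (e0 + e1 + e2) e3) / 2 *
  (thalf e0 e1 + thalf e1 e2 + thalf e2 e3 + thalf e3 e4 + thalf e4 e0) <=
  ((enorm e0 + enorm e1 + enorm e2 + enorm e3 + enorm e4) / 2) ^+ 2.
Proof.
move=> s0 c01 c12 c23 c34 c40 c02 c24.
have [l [k [a [al [l0 k0 al0 e1E [nE tE aE]]]]]] := prolong_edges c01 c12 c02.
have [l' [k' [a' [al' [l0' k0' al0' e3E [nE' tE' aE']]]]]] := prolong_edges c23 c34 c24.
have [t01 _ _] := thalf_spec c01; have [t12 _ _] := thalf_spec c12.
have [t23 _ _] := thalf_spec c23; have [t34 _ _] := thalf_spec c34.
have [t40 _ _] := thalf_spec c40.
pose u := (1 + l) *: e0; pose v := (1 + k + l') *: e2; pose w := (1 + k') *: e4.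
have ul : 0 < 1 + l by rewrite addr_gt0.
have vl : 0 < 1 + k + l' by rewrite !addr_gt0.
have wl : 0 < 1 + k' by rewrite addr_gt0.
have uvw : u + v + w = 0.
  by rewrite -s0 e1E e3E /u /v /w !scalerDl !scale1r; vring.
have uv : cross u v = (1 + l) * (1 + k + l') * cross e0 e2.
  by rewrite /u /v; vsimp; ring.
have uv0 : 0 < cross u v by rewrite uv !mulr_gt0.
have tri := lhuilier_triangle uvw uv0.
rewrite /u /v /w !thalfZ // -/u -/v in tri.
have nu : enorm u = (1 + l) * enorm e0 by rewrite enormZ // ltW.
have nv : enorm v = (1 + k + l') * enorm e2 by rewrite enormZ // ltW.
have nw : enorm w = (1 + k') * enorm e4 by rewrite enormZ // ltW.
rewrite nu nv -/w nw in tri.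
have w4 : cross u e4 = - (1 + k + l') * cross e2 e4.
  have -> : u = - v - w.
    by apply/eqP; rewrite -subr_eq0 opprD !opprK addrA uvw.
  by rewrite /v /w; vsimp; ring.
(* The area of the triangle is that of the pentagon plus the two corners added by prolonging. *)
have D2 : cross u v = cross e0 e1 + cross (e0 + e1) e2 + cross (e0 + e1 + e2) e3 +
    l * k * cross e0 e2 + l' * k' * cross e2 e4.
  have -> : cross (e0 + e1 + e2) e3 =
      l' * (1 + l) * cross e0 e2 + k' * (cross u e4 + (1 + k) * cross e2 e4).
    by rewrite e3E e1E /u; vsimp; ring.
  by rewrite w4 uv e1E; vsimp; ring.
set P := enorm e0 + _ + _ + _ + _; set A := (_ / 2); set S := (_ + thalf e4 e0).
have S0 : 0 < S by rewrite /S !addr_gt0.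
have h2 : (A + a' ^+ 2 / al') * (S + al') <= (P / 2 + a' + a - a) ^+ 2.
  apply: (@cut_corner _ _ al) => //; first by rewrite addr_ge0 // ltW.
  have -> : A + a' ^+ 2 / al' + a ^+ 2 / al = cross u v / 2.
    by rewrite -aE -aE' D2 /A; field.
  have -> : S + al' + al = thalf e0 e2 + thalf e2 e4 + thalf e4 e0.
    by rewrite tE tE' /S; ring.
  rewrite -(ler_pM2l (_ : 0 < 4)) // mulrA; apply: le_trans tri _.
  rewrite le_eqVlt; apply/orP; left; apply/eqP.
  have -> : (1 + l) * enorm e0 + (1 + k + l') * enorm e2 + (1 + k') * enorm e4 =
      enorm e0 + (l * enorm e0 + k * enorm e2) + enorm e2 +
      (l' * enorm e2 + k' * enorm e4) + enorm e4 by ring.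
  by rewrite nE nE' /P; field.
have h1 := @cut_corner (P / 2 + a') a' al' A S al0' (ltW S0).
by rewrite addrK in h2; have := h1 h2; rewrite addrK.
Qed.

(** The cross product of the outer vectors is, up to positive factors, the sine of the sum of the
    angles, positive below pi. *)
Lemma ang_cross_gt0 u v w : 0 < cross u v -> 0 < cross v w ->
  ang u v + ang v w < pi -> 0 < cross u w.
Proof.
move=> uv vw lt.
have u0 := cross_neq0l (lt0r_neq0 uv).
have v0 := cross_neq0r (lt0r_neq0 uv).
have w0 := cross_neq0r (lt0r_neq0 vw).
have ac := ang_cos u0 v0; have bc := ang_cos v0 w0.
have as' := ang_sin u0 v0; have bs := ang_sin v0 w0.
rewrite !gtr0_norm // in as' bs.
have nu : 0 < enorm u by rewrite enorm_gt0.
have nv : 0 < enorm v by rewrite enorm_gt0.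
have nw : 0 < enorm w by rewrite enorm_gt0.
have /andP[a0 _] := ang_gt0 uv; have /andP[b0 _] := ang_gt0 vw.
have s0 : 0 < sin (ang u v + ang v w) by rewrite sin_gt0_pi // addr_gt0.
rewrite -(pmulr_rgt0 _ (mulr_gt0 nv nv)) enormK.
have -> : dot v v * cross u w = cross u v * dot v w + dot u v * cross v w.
  by vsimp; ring.
rewrite as' bs ac bc.
have -> : enorm u * enorm v * sin (ang u v) * (enorm v * enorm w * cos (ang v w)) +
  enorm u * enorm v * cos (ang u v) * (enorm v * enorm w * sin (ang v w)) =
  enorm u * enorm v * (enorm v * enorm w) * sin (ang u v + ang v w).
  by rewrite sinD; ring.
by rewrite !mulr_gt0.
Qed.

End Lhuilier.

(** * Convexity of the tangent function *)

Section TangentLines.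
Context {R : realType}.

(** The graph lies above its tangent line: the mean value theorem applies with the derivative 1 +
    tan^2, which increases on [0, pi/2[. *)
Lemma tan_tangent (y x : R) : 0 <= y < pi / 2 -> 0 <= x < pi / 2 ->
  tan y + (1 + tan y ^+ 2) * (x - y) <= tan x.
Proof.
move=> yp xp.
have cpos (z : R) : 0 <= z < pi / 2 -> 0 < cos z.
  by move=> zp; apply: cos_gt0_pihalf; have := pi_gt0 R; lra.
have mono (z1 z2 : R) : 0 <= z1 -> z1 <= z2 -> z2 < pi / 2 -> tan z1 ^+ 2 <= tan z2 ^+ 2.
  move=> h1 h2 h3; have pp := pi_gt0 R.
  have i1 : z1 \in `]- (pi / 2), pi / 2[ by rewrite in_itv /=; lra.
  have i2 : z2 \in `]- (pi / 2), pi / 2[ by rewrite in_itv /=; lra.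
  have tn (z : R) : 0 <= z -> z < pi / 2 -> 0 <= tan z.
    move=> z0 zp; apply: divr_ge0; first by apply: sin_ge0_pi; lra.
    by apply/ltW/cpos; lra.
  rewrite lerXn2r ?nnegrE ?tn //; try lra.
  by move: h2; rewrite le_eqVlt => /predU1P[->//|h2]; rewrite ltW // ltr_tan.
have dtan (z : R) : 0 <= z < pi / 2 -> is_derive z 1 (@tan R) (1 + tan z ^+ 2).
  by move=> zp; rewrite -cos2_tan2 ?lt0r_neq0 ?cpos //; apply: is_derive_tan; rewrite lt0r_neq0 ?cpos.
have ctan (a b : R) : 0 <= a -> b < pi / 2 -> {within `[a, b], continuous (@tan R)}.
  move=> a0 bp; apply: continuous_in_subspaceT => z; rewrite inE /= in_itv /= => zp.
  by apply: continuous_tan; rewrite lt0r_neq0 ?cpos //; lra.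
have [xy|yx|->] := ltgtP x y; last by rewrite subrr mulr0 addr0.
- have [z] := @MVT R tan (fun z => 1 + tan z ^+ 2) x y xy
    ltac:(by move=> z; rewrite in_itv /= => zp; apply: dtan; lra) ltac:(by apply: ctan; lra).
  rewrite in_itv /= => /andP[z1 z2] e.
  have m : tan z ^+ 2 <= tan y ^+ 2 by apply: mono; lra.
  have d0 : 0 <= y - x by lra.
  have := ler_wpM2r d0 m; lra.
- have [z] := @MVT R tan (fun z => 1 + tan z ^+ 2) y x yx
    ltac:(by move=> z; rewrite in_itv /= => zp; apply: dtan; lra) ltac:(by apply: ctan; lra).
  rewrite in_itv /= => /andP[z1 z2] e.
  have m : tan y ^+ 2 <= tan z ^+ 2 by apply: mono; lra.
  have d0 : 0 <= x - y by lra.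
  have := ler_wpM2r d0 m; lra.
Qed.

Lemma tan_pi6_gt0 : 0 < tan (pi / 6) :> R.
Proof.
have pp := pi_gt0 R.
by rewrite /tan divr_gt0 ?sin_gt0_pihalf ?cos_gt0_pihalf //; lra.
Qed.

Lemma tan_pi6_sqr : tan (pi / 6) ^+ 2 = 1 / 3 :> R.
Proof.
have pp := pi_gt0 R; have t0 := tan_pi6_gt0.
have c0 : cos (pi / 6) != 0 :> R by rewrite lt0r_neq0 // cos_gt0_pihalf //; lra.
have s0 : sin (pi / 6) != 0 :> R by rewrite lt0r_neq0 // sin_gt0_pihalf //; lra.
have e : sin (pi / 2) = 1 :> R by rewrite sin_pihalf.
have e1 : sin (pi / 6 + pi / 6) = cos (pi / 6) :> R.
  by rewrite -[RHS]opprK -sinBpihalf -sinN; congr sin; lra.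
rewrite sinD in e1.
have : sin (pi / 6) = 1 / 2 :> R by apply: (mulIf c0); lra.
move=> s1; have := cos2Dsin2 (pi / 6 : R); rewrite s1 => c2.
by rewrite /tan s1 expr_div_n (_ : cos (pi / 6) ^+ 2 = 3 / 4 :> R); [field|lra].
Qed.

End TangentLines.

(** * Convex pentagons: exterior angles and perimeter bounds *)

Section ConvexPentagons.
Context {R : realType}.
Implicit Types p : nat -> R * R.

(** All ten triples are positively oriented: the pentagon is strictly convex and listed
    counterclockwise. *)
Definition ccw5 p : Prop :=
  forall i j k, (i < j)%N -> (j < k)%N -> (k < 5)%N -> 0 < orient (p i) (p j) (p k).

Definition cyc5 p (k : nat) : R * R := p (k %% 5)%N.

Definition side p k : R * R := cyc5 p k.+1 - cyc5 p k.

Definition exterior p k : R := ang (side p k) (side p k.+1).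

(* The angle at the vertex of index k + 1. *)
Definition interior_angle p k : R :=
  ang (cyc5 p k.+2 - cyc5 p k.+1) (cyc5 p k - cyc5 p k.+1).

Definition perim5 p : R := \sum_(k < 5) enorm (side p k).

Definition area5 p : R :=
  (orient (p 0%N) (p 1%N) (p 2%N) + orient (p 0%N) (p 2%N) (p 3%N) +
   orient (p 0%N) (p 3%N) (p 4%N)) / 2.

Lemma cyc5_rot p k : cyc5 (fun k => cyc5 p k.+1) k = cyc5 p k.+1.
Proof. by rewrite /cyc5 -addn1 modnDml addn1. Qed.

Lemma side_rot p k : side (fun k => cyc5 p k.+1) k = side p k.+1.
Proof. by rewrite /side !cyc5_rot. Qed.

Lemma ccw5_rot p : ccw5 p -> ccw5 (fun k => cyc5 p k.+1).
Proof.
move=> h i j k; case: k => [|[|[|[|[|k]]]]] //; case: j => [|[|[|[|j]]]] //;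
  case: i => [|[|[|i]]] // _ _ _; rewrite /cyc5 /=; try exact: h;
  by rewrite -orient_rot -orient_rot; exact: h.
Qed.

Lemma ccw5_side p k : ccw5 p -> 0 < cross (side p k) (side p k.+1).
Proof.
have -> : cross (side p k) (side p k.+1) =
  orient (cyc5 p k) (cyc5 p k.+1) (cyc5 p k.+2).
  by rewrite /side; vsimp; ring.
have : (k %% 5 < 5)%N by rewrite ltn_mod.
rewrite /cyc5 -[k.+2]addn2 -[k.+1]addn1 -!(modnDml k).
case: (k %% 5)%N => [|[|[|[|[|//]]]]] _ h /=; try exact: h.
- by rewrite -orient_rot -orient_rot; exact: h.
- by rewrite -orient_rot; exact: h.
Qed.

Lemma sum5 (f : nat -> R) : \sum_(k < 5) f k = f 0%N + f 1%N + f 2%N + f 3%N + f 4%N.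
Proof. by rewrite !big_ord_recr big_ord0 /= add0r. Qed.

(** The diagonals from vertex 0 cut the pentagon into three triangles, and angles add up along
    them. *)
Lemma sum_interior_angles5 p : ccw5 p -> \sum_(k < 5) interior_angle p k = 3 * pi.
Proof.
move=> h; rewrite sum5 /interior_angle /cyc5 /=.
have o012 : 0 < orient (p 0%N) (p 1%N) (p 2%N) by exact: h.
have o023 : 0 < orient (p 0%N) (p 2%N) (p 3%N) by exact: h.
have o034 : 0 < orient (p 0%N) (p 3%N) (p 4%N) by exact: h.
have := triangle_ang o012; have := triangle_ang o023; have := triangle_ang o034.
move: o012 o023 o034 (h 0%N 1%N 3%N isT isT isT) (h 0%N 1%N 4%N isT isT isT)
 (h 1%N 2%N 3%N isT isT isT) (h 0%N 2%N 4%N isT isT isT) (h 2%N 3%N 4%N isT isT isT).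
rewrite /orient; move: (p 0%N) (p 1%N) (p 2%N) (p 3%N) (p 4%N) => a b c d e.
move=> abc acd ade abd abe bcd ace cde.
have A1 : ang (b - a) (e - a) = ang (b - a) (c - a) + ang (c - a) (d - a) + ang (d - a) (e - a).
  by rewrite -angD // -angD.
have C1 : ang (d - c) (b - c) = ang (d - c) (a - c) + ang (a - c) (b - c).
  by apply: angD; move: abc acd bcd; vsimp; lra.
have D1 : ang (e - d) (c - d) = ang (e - d) (a - d) + ang (a - d) (c - d).
  by apply: angD; move: acd ade cde; vsimp; lra.
by rewrite A1 C1 D1; lra.
Qed.

Lemma exteriorE p k : ccw5 p -> exterior p k = pi - interior_angle p k.
Proof.
move=> h; rewrite /exterior /interior_angle.
have c := ccw5_side k h.
have u0 := cross_neq0l (lt0r_neq0 c); have v0 := cross_neq0r (lt0r_neq0 c).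
have -> : cyc5 p k - cyc5 p k.+1 = - side p k by rewrite /side opprB.
by rewrite [in RHS]angC angN //; rewrite -/(side p k.+1); ring.
Qed.

Lemma exterior_itv p k : ccw5 p -> 0 < exterior p k < pi.
Proof. by move=> h; apply: ang_gt0; exact: ccw5_side. Qed.

Lemma sum_exterior5 p : ccw5 p -> \sum_(k < 5) exterior p k = 2 * pi.
Proof.
move=> h; have := sum_interior_angles5 h; rewrite !sum5 !exteriorE //; lra.
Qed.

(** The five exterior angles add up to 2 pi, so four consecutive ones have sum below 2 pi, and
    either the first two or the last two of these have sum below pi. *)
Lemma ccw5_skip p k : ccw5 p ->
  0 < cross (side p k) (side p k.+2) \/ 0 < cross (side p k.+2) (side p k.+4).
Proof.
move=> h; have Se := sum_exterior5 h.
have [lt|ge] := ltP (exterior p k + exterior p k.+1) pi.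
  by left; apply: ang_cross_gt0 lt; exact: ccw5_side.
right; apply: (@ang_cross_gt0 _ _ (side p k.+3)); try exact: ccw5_side.
suff e : exterior p k + exterior p k.+1 + exterior p k.+2 + exterior p k.+3 +
    exterior p k.+4 = 2 * pi.
  have := exterior_itv k.+4 h; rewrite -/(exterior p k.+2) -/(exterior p k.+3); lra.
rewrite -Se sum5.
have E j : exterior p j = exterior p (j %% 5)%N.
  by rewrite /exterior /side /cyc5 -[j.+2]addn2 -[j.+1]addn1 -[(j %% 5).+2%N]addn2
    -[(j %% 5).+1%N]addn1 modn_mod -!(modnDml j).
rewrite (E k) (E k.+1) (E k.+2) (E k.+3) (E k.+4).
rewrite -[k.+4]addn4 -[k.+3]addn3 -[k.+2]addn2 -[k.+1]addn1 -!(modnDml k).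
have : (k %% 5 < 5)%N by rewrite ltn_mod.
by case: (k %% 5)%N => [|[|[|[|[|//]]]]] _ /=; ring.
Qed.

Definition half_tangent p k : R := thalf (side p k) (side p k.+1).

(** [lhuilier_pentagon_cut] requires that two edges, each the middle one of three consecutive edges,
    can be removed. A rotation of the indices brings every pentagon to that case. *)
Lemma lhuilier_pentagon p : ccw5 p ->
  area5 p * \sum_(k < 5) half_tangent p k <= (perim5 p / 2) ^+ 2.
Proof.
have base p' : ccw5 p' -> 0 < cross (side p' 0) (side p' 2) ->
    0 < cross (side p' 2) (side p' 4) ->
    area5 p' * \sum_(k < 5) half_tangent p' k <= (perim5 p' / 2) ^+ 2.
  move=> h c02 c24; rewrite sum5 /half_tangent.
  have := @lhuilier_pentagon_cut R (side p' 0) (side p' 1) (side p' 2) (side p' 3) (side p' 4).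
  rewrite (_ : cross (side p' 0) (side p' 1) + _ + _ = 2 * area5 p'); last first.
    by rewrite /area5 /side /cyc5 /=; vsimp; field.
  rewrite [2 * _]mulrC mulfK // => H.
  have -> : perim5 p' = enorm (side p' 0) + enorm (side p' 1) + enorm (side p' 2) +
    enorm (side p' 3) + enorm (side p' 4) by rewrite /perim5 !big_ord_recr big_ord0 /= add0r.
  apply: H => //; try exact: (ccw5_side _ h).
  by rewrite /side /cyc5 /=; vring.
have shift k p' : ccw5 p' -> 0 < cross (side p' k) (side p' k.+2) ->
    0 < cross (side p' k.+2) (side p' k.+4) ->
    area5 p' * \sum_(k < 5) half_tangent p' k <= (perim5 p' / 2) ^+ 2.
  elim: k p' => [|k IH] p' h; first exact: base.
  have := IH _ (ccw5_rot h); rewrite !side_rot => H /H{}H /H{H}.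
  have -> : area5 (fun k => cyc5 p' k.+1) = area5 p'.
    by rewrite /area5 /cyc5 /=; vsimp; field.
  have -> : \sum_(k < 5) half_tangent (fun k => cyc5 p' k.+1) k =
      \sum_(k < 5) half_tangent p' k.
    by rewrite !sum5 /half_tangent !side_rot /side /cyc5 /=; ring.
  have -> // : perim5 (fun k => cyc5 p' k.+1) = perim5 p'.
  rewrite /perim5 !big_ord_recr !big_ord0 /= !side_rot /side /cyc5 /=; ring.
move=> h.
pose S k := 0 < cross (side p k) (side p k.+2).
have s5 k : side p (k + 5) = side p k.
  by rewrite /side /cyc5 -addSn !modnDr.
have S5 k : S (k + 5)%N = S k by rewrite /S -addSn -addSn !s5.
have skip k : S k || S k.+2 by apply/orP; have [] := ccw5_skip k h; [left|right].
(* Steps of 2 run through the five indices in one cycle, and no two successive indices both fail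
   [S]. The cycle is odd, so success and failure cannot alternate, and two successive indices
   satisfy [S]. *)
have [j /andP[j1 j2]] : exists j, S j && S j.+2.
  have := (skip 0%N, skip 1%N, skip 2%N, skip 3%N, skip 4%N).
  rewrite (S5 0%N) (S5 1%N) => -[[[[]]]].
  case s0 : (S 0%N); case s1 : (S 1%N); case s2 : (S 2%N); case s3 : (S 3%N);
  case s4 : (S 4%N) => // _ _ _ _ _;
  by [exists 0%N; rewrite s0 s2|exists 1%N; rewrite s1 s3|exists 2%N; rewrite s2 s4|
      exists 3%N; rewrite (S5 0%N) s3 s0|exists 4%N; rewrite (S5 1%N) s4 s1].
exact: (shift j).
Qed.

(** Tangent line of tan at pi/6, that is, at an interior angle 2 pi/3. Its slope 1 + 1/3 is halved
    because the argument is half of the exterior angle. *)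
Lemma half_tangent_ge6 p k : ccw5 p ->
  tan (pi / 6) - 2 / 9 * pi + 2 / 3 * exterior p k <= half_tangent p k.
Proof.
move=> h; have pp := pi_gt0 R; have := exterior_itv k h => /andP[x0 x1].
rewrite /half_tangent /thalf -/(exterior p k).
have := @tan_tangent R (pi / 6) (exterior p k / 2); rewrite tan_pi6_sqr => H.
apply: le_trans (H _ _); lra.
Qed.

(** Tangent line of tan at pi/4, that is, at a right interior angle; the slope 2 is halved to 1. *)
Lemma half_tangent_ge4 p k : ccw5 p ->
  1 + (exterior p k - pi / 2) <= half_tangent p k.
Proof.
move=> h; have pp := pi_gt0 R; have := exterior_itv k h => /andP[x0 x1].
rewrite /half_tangent /thalf -/(exterior p k).
have := @tan_tangent R (pi / 4) (exterior p k / 2); rewrite tan_piquarter => H.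
apply: le_trans (H _ _); lra.
Qed.

Lemma sum_half_tangents_ge p : ccw5 p ->
  5 * tan (pi / 6) + 2 / 9 * pi <= \sum_(k < 5) half_tangent p k.
Proof.
move=> h; have e := sum_exterior5 h.
apply: le_trans (ler_sum _ (fun (k : 'I_5) _ => half_tangent_ge6 k h)).
by rewrite big_split /= -mulr_sumr e sumr_const card_ord; lra.
Qed.

(** The line at pi/4 serves for [i] and [j], the line at pi/6 for the three others. The total grows
    by a third of the sum of the two exterior angles, and at pi it takes the value of the Cairo and
    Prismatic pentagons. *)
Lemma sum_half_tangents_pair p (i j : 'I_5) : ccw5 p -> i != j ->
  pi <= exterior p i + exterior p j ->
  2 + 3 * tan (pi / 6) <= \sum_(k < 5) half_tangent p k.
Proof.
move=> h ij le; have := sum_exterior5 h.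
rewrite (bigD1 i) //= (bigD1 j) ?[j == i]eq_sym //= => e.
rewrite (bigD1 i) //= (bigD1 j) ?[j == i]eq_sym //=.
have := half_tangent_ge4 i h; have := half_tangent_ge4 j h.
have : \sum_(k < 5 | (k != i) && (k != j)) (tan (pi / 6) - 2 / 9 * pi + 2 / 3 * exterior p k) <=
  \sum_(k < 5 | (k != i) && (k != j)) half_tangent p k.
  by apply: ler_sum => k _; exact: half_tangent_ge6.
have c3 : #|[pred k : 'I_5 | (k != i) && (k != j)]| = 3%N.
  have := cardC (pred2 i j); rewrite card_ord card2 ij => /(canRL (addKn _)).
  move=> e3; rewrite -[RHS]/(5 - 2)%N -[RHS]e3.
  by apply: eq_card => k; rewrite !inE negb_or.
rewrite big_split /= -mulr_sumr sumr_const c3 => h1 h2 h3; lra.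
Qed.

(** The inequality sin x <= x at x = pi/12 suffices, as the half-angle formula gives the sine from
    cos (pi/6). *)
Lemma pi_ge31 : 31 / 10 <= pi :> R.
Proof.
have pp := pi_gt0 R.
have s6 : sin (pi / 6) = 1 / 2 :> R.
  have e1 : sin (pi / 6 + pi / 6) = cos (pi / 6) :> R.
    by rewrite -[RHS]opprK -sinBpihalf -sinN; congr sin; lra.
  have c0 : cos (pi / 6) != 0 :> R by rewrite lt0r_neq0 // cos_gt0_pihalf //; lra.
  by rewrite sinD in e1; apply: (mulIf c0); lra.
have c6 : cos (pi / 6) ^+ 2 = 3 / 4 :> R.
  by have := cos2Dsin2 (pi / 6 : R); rewrite s6; lra.
have c6g : 0 < cos (pi / 6) :> R by apply: cos_gt0_pihalf; lra.
(* 97/112 is half of 97/56, a convergent of sqrt 3 from above. *)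
have c6u : cos (pi / 6) < 97 / 112 :> R.
  rewrite ltNge; apply/negP => ge.
  have h0 : 0 <= 97 / 112 :> R by lra.
  by have := ler_pM h0 h0 ge ge; rewrite -[cos _ * cos _]expr2 c6; lra.
have e : cos (pi / 6) = 1 - 2 * sin (pi / 12) ^+ 2 :> R.
  have := cos2Dsin2 (pi / 12 : R); rewrite (_ : pi / 6 = pi / 12 + pi / 12); last lra.
  by rewrite cosD; lra.
have sle : sin (pi / 12) <= pi / 12 :> R.
  have p12 : 0 < pi / 12 :> R by lra.
  have [c _] := @MVT R (@sin R) (@cos R) 0 (pi / 12) p12
    ltac:(by move=> x _; exact: is_derive_sin) ltac:(by apply: continuous_subspaceT; exact: continuous_sin).
  by rewrite sin0 !subr0 => ->; rewrite ler_piMl ?(ltW p12) // cos_le1.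
have s0 : 0 <= sin (pi / 12) :> R by apply: sin_ge0_pi; lra.
rewrite leNgt; apply/negP => lt.
have : sin (pi / 12) ^+ 2 <= (31 / 120) ^+ 2 :> R.
  have sl : sin (pi / 12) <= 31 / 120 :> R by lra.
  by rewrite !expr2; apply: ler_pM.
by lra.
Qed.

(** One line at pi/4 and four at pi/6 give 1 + 4 tan (pi/6) + 13 pi/90 when the exterior angle is 3
    pi/5, and more beyond; this exceeds the Cairo value. *)
Lemma sum_half_tangents_sharp p (i : 'I_5) : ccw5 p ->
  3 * pi / 5 <= exterior p i ->
  2 + 3 * tan (pi / 6) < \sum_(k < 5) half_tangent p k.
Proof.
move=> h le; have pi31 := pi_ge31; have := sum_exterior5 h.
rewrite (bigD1 i) //= => e; rewrite (bigD1 i) //=.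
have := half_tangent_ge4 i h.
have : \sum_(k < 5 | k != i) (tan (pi / 6) - 2 / 9 * pi + 2 / 3 * exterior p k) <=
  \sum_(k < 5 | k != i) half_tangent p k.
  by apply: ler_sum => k _; exact: half_tangent_ge6.
have c4 : #|[pred k : 'I_5 | k != i]| = 4%N.
  by have := cardC1 i; rewrite card_ord /= => e4; rewrite -[RHS]e4; exact: eq_card.
rewrite big_split /= -mulr_sumr sumr_const c4 => h1 h2.
have t57 : 57 / 100 < tan (pi / 6) :> R.
  rewrite ltNge; apply/negP => ge; have h0 : 0 <= 57 / 100 :> R by lra.
  have t0 := ltW (@tan_pi6_gt0 R).
  by have := ler_pM t0 t0 ge ge; rewrite -[tan _ * tan _]expr2 tan_pi6_sqr; lra.
lra.
Qed.

(** The hypothesis says that the perimeter is below the Cairo one, since 3 tan (pi/6) = sqrt 3. By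
    L'Huilier the half tangents then have a sum below the Cairo value, which contradicts the two
    preceding bounds if the angle conditions fail. *)
Lemma short_pentagon p : ccw5 p -> 1 <= area5 p ->
  (perim5 p / 2) ^+ 2 < 2 + 3 * tan (pi / 6) ->
  [/\ (189 / 100) ^+ 2 <= (perim5 p / 2) ^+ 2,
    forall i j : 'I_5, i != j -> pi < interior_angle p i + interior_angle p j &
    forall i : 'I_5, 2 * pi / 5 < interior_angle p i].
Proof.
move=> h a1 lt; have l := lhuilier_pentagon h.
have S1 : \sum_(k < 5) half_tangent p k <= (perim5 p / 2) ^+ 2.
  apply: le_trans l; rewrite ler_peMl // sumr_ge0 // => k _.
  by have [/ltW] := thalf_spec (ccw5_side k h).
(* 26/15 is a convergent of sqrt 3 from above. Together with pi >= 31/10 it makes 5 tan (pi/6) + 2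
   pi/9 just larger than (189/100)^2. *)
have t15 : 15 / 26 < tan (pi / 6) :> R.
  rewrite ltNge; apply/negP => ge.
  have t0 := ltW (@tan_pi6_gt0 R).
  by have := ler_pM t0 t0 ge ge; rewrite -[tan _ * tan _]expr2 tan_pi6_sqr; lra.
have p31 := pi_ge31.
split.
- apply: le_trans S1; apply: le_trans (sum_half_tangents_ge h).
  lra.
- move=> i j ij; rewrite ltNge; apply/negP => le.
  have := @sum_half_tangents_pair _ _ _ h ij; rewrite !exteriorE // => H.
  have : 2 + 3 * tan (pi / 6) <= \sum_(k < 5) half_tangent p k by apply: H; lra.
  lra.
- move=> i; rewrite ltNge; apply/negP => le.
  have := @sum_half_tangents_sharp _ i h; rewrite !exteriorE // => H.
  have : 2 + 3 * tan (pi / 6) < \sum_(k < 5) half_tangent p k by apply: H; lra.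
  lra.
Qed.

End ConvexPentagons.

(** * Regions bounded by polygons *)

Section Regions.
Context {R : realType}.
Implicit Types (P : polygon R) (x y z c d : R * R).

Lemma orient_point_at (a b x y : R * R) (t : R) :
  orient a b (point_at x y t) = (1 - t) * orient a b x + t * orient a b y.
Proof. by vsimp; ring. Qed.

Lemma point_at_continuous x y : continuous (point_at x y).
Proof.
by move=> t; rewrite /point_at; apply: cvgD; apply: cvgZr_tmp; [apply: cvgB; [exact: cvg_cst|exact: cvg_id]|exact: cvg_id].
Qed.

Definition polyline P : set (R * R) :=
  \bigcup_(k in [set k | (k < size (verts P))%N]) edge (verts P) k.

Lemma size_verts_gt0 P : (0 < size (verts P))%N.
Proof. by apply: leq_trans (polygon_size P). Qed.

Lemma region_closed P : closed (region P).
Proof. by apply: compact_closed; [exact: norm_hausdorff|exact: region_compact]. Qed.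

Lemma region_measurable P : measurable (region P).
Proof. by apply: closed_measurable2; exact: region_closed. Qed.

Lemma polyline_region P x : polyline P x -> region P x /\ ~ interior (region P) x.
Proof. by rewrite /polyline -region_boundary => -[]. Qed.

Lemma region_interior P x : region P x -> ~ polyline P x -> interior (region P) x.
Proof.
by rewrite /polyline -region_boundary => Px h; apply: contrapT => h'; apply: h.
Qed.

Lemma region_bounded P : exists2 M : R, 0 < M &
  forall x, region P x -> `|x.1| <= M /\ `|x.2| <= M.
Proof.
have [M [_ h]] := @compact_bounded R (R * R)%type _ (@region_compact R P).
pose M' := Num.max 1 (M + 1).
have M'1 : 0 < M' by rewrite lt_max ltr01.
exists M' => // x Px.
have : `|x| <= M' by apply: (h M') => //; rewrite lt_max ltrDl ltr01 orbT.
by rewrite prod_normE ge_max => /andP.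
Qed.

(** If the segment missed the boundary, the parameters of its points in the region would form a
    subset of [0, 1] both open and closed, hence all of [0, 1]. *)
Lemma region_exit P x y : region P x -> ~ region P y ->
  exists2 t : R, 0 <= t <= 1 & polyline P (point_at x y t).
Proof.
move=> Px Py; apply: contrapT => h.
have g0 : point_at x y 0 = x by vring.
have g1 : point_at x y 1 = y by vring.
have int t : 0 <= t <= 1 -> region P (point_at x y t) ->
    interior (region P) (point_at x y t).
  by move=> t01 Pt; apply: region_interior => // Pl; apply: h; exists t.
have cg := @point_at_continuous x y.
have E : `[0, 1]%classic `&` (point_at x y @^-1` region P) = `[0, 1]%classic.
  apply: (@segment_connected R 0 1).
  - by exists 0; split => /=; rewrite ?in_itv /= ?lexx ?ler01 ?g0.
  - exists (point_at x y @^-1` interior (region P)).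
      by apply: open_comp => [t _|]; [exact: cg|exact: open_interior].
    apply/seteqP; split => t [/= t01 Pt]; split => //.
      by apply: int => //; rewrite in_itv in t01.
    exact: interior_subset.
  - exists (point_at x y @^-1` region P) => //.
    by apply: closed_comp => [t _|]; [exact: cg|exact: region_closed].
have : `[0, 1]%classic (1 : R) by rewrite /= in_itv /= ler01 lexx.
by rewrite -E => -[_]; rewrite /= g1.
Qed.

(** The region is bounded, so the ray has a point outside and [region_exit] applies. *)
Lemma region_ray P x d : region P x -> d != 0 ->
  exists2 t : R, 0 <= t & polyline P (x + t *: d).
Proof.
move=> Px d0.
have [M M0 hM] := region_bounded P.
have [T T0 PT] : exists2 T : R, 0 <= T & ~ region P (x + T *: d).
  have [x1 x2] := hM _ Px.
  have big (u e : R) : e != 0 -> `|u| <= M ->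
      M < `|u + (2 * M / `|e| + 1) * e| .
    move=> e0 ub; have e1 : 0 < `|e| by rewrite normr_gt0.
    have : `|(2 * M / `|e| + 1) * e| - `|u| <= `|u + (2 * M / `|e| + 1) * e|.
      have := ler_normB (u + (2 * M / `|e| + 1) * e) u.
      by rewrite addrC addKr; lra.
    have c0 : 0 < 2 * M / `|e| + 1 by rewrite addr_gt0 // divr_gt0 ?mulr_gt0.
    rewrite normrM (gtr0_norm c0) mulrDl divfK ?gt_eqF // mul1r; lra.
  have Tpos e : 0 <= 2 * M / `|e| + 1 :> R.
    by rewrite addr_ge0 // divr_ge0 // mulr_ge0 // ltW.
  have [d1|d1] := eqVneq d.1 0.
    have d2 : d.2 != 0 by apply: contraNneq d0 => d2; apply/eqP/pair_ext.
    exists (2 * M / `|d.2| + 1) => // /hM[_] /=.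
    by rewrite /GRing.scale /= leNgt big.
  exists (2 * M / `|d.1| + 1) => // /hM[] /=.
  by rewrite /GRing.scale /= leNgt big.
have [t /andP[t0 t1] Pt] := region_exit Px PT.
exists (t * T); first exact: mulr_ge0.
by congr (polyline P _): Pt; vring.
Qed.

(** From a point of the region two opposite rays are followed to the boundary; the point lies
    between two points of edges, which belong to [K] by convexity. *)
Lemma region_sub_convex P (K : set (R * R)) :
  (forall x y (t : R), K x -> K y -> 0 <= t <= 1 -> K (point_at x y t)) ->
  (forall k, K (vertex (verts P) k)) -> region P `<=` K.
Proof.
move=> cK vK x Px.
have pK : polyline P `<=` K.
  by move=> y [k _ [t /= t01 <-]]; exact: cK.
have d0 : (1, 0) != 0 :> R * R.
  by apply/eqP => -[] /eqP; rewrite oner_eq0.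
have d0' : - (1, 0) != 0 :> R * R by rewrite oppr_eq0.
have [t t0 /pK Kt] := region_ray Px d0; have [s s0 /pK Ks] := region_ray Px d0'.
have [ts|ts] := eqVneq (t + s) 0.
  have t00 : t = 0 by lra.
  by congr K: Kt; rewrite t00; vring.
have ts0 : 0 < t + s by rewrite lt_neqAle eq_sym ts addr_ge0.
have u01 : 0 <= t / (t + s) <= 1.
  by rewrite divr_ge0 ?(ltW ts0) //= ler_pdivrMr // mul1r lerDl.
by congr K: (cK _ _ _ Kt Ks u01); apply: pair_ext; vsimp; field.
Qed.

Lemma region_orient P (a b : R * R) : (forall k, 0 <= orient a b (vertex (verts P) k)) ->
  forall x, region P x -> 0 <= orient a b x.
Proof.
move=> h; apply: (@region_sub_convex P [set x | 0 <= orient a b x]) => //.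
move=> x y t /= Kx Ky /andP[t0 t1]; rewrite orient_point_at.
by rewrite addr_ge0 // mulr_ge0 // subr_ge0.
Qed.

(** The ray from [x] away from [c] meets some edge, and [x] lies between [c] and that point of the
    edge. The triangles may overlap or leave the region: they only cover it. *)
Lemma region_fan P c x : region P x ->
  exists2 k, (k < size (verts P))%N &
    tri c (vertex (verts P) k) (vertex (verts P) k.+1) x.
Proof.
move=> Px; have [->|xc] := eqVneq x c.
  exists 0%N; first exact: size_verts_gt0.
  exists 1, 0, 0; split => //; first by ring.
  by vring.
have d0 : x - c != 0 by rewrite subr_eq0.
have [t t0 [k kn [s /= /andP[s0 s1] e]]] := region_ray Px d0.
exists k => //.
have t1 : 0 < 1 + t by rewrite ltr_pwDl.
exists (t / (1 + t)), ((1 - s) / (1 + t)), (s / (1 + t)); split.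
- by rewrite divr_ge0 // ltW.
- by rewrite divr_ge0 ?subr_ge0 // ltW.
- by rewrite divr_ge0 // ltW.
- by field; exact: lt0r_neq0.
- have -> : (t / (1 + t)) *: c + ((1 - s) / (1 + t)) *: vertex (verts P) k +
    (s / (1 + t)) *: vertex (verts P) k.+1 =
    (1 + t)^-1 *: (t *: c + point_at (vertex (verts P) k) (vertex (verts P) k.+1) s).
    by vring.
  rewrite e; apply: pair_ext; vsimp; field; exact: lt0r_neq0.
Qed.

(** A segment inside [U] cannot leave the region since [U] misses the boundary. One such segment,
    from [z], shows that the centre belongs to the region; the segments from the centre then reach
    all of [U]. *)
Lemma star_sub_region P (U : set (R * R)) z0 z :
  (forall x (t : R), U x -> 0 <= t <= 1 -> U (point_at z0 x t)) ->
  (forall x, U x -> ~ polyline P x) -> U z -> region P z ->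
  U `<=` interior (region P).
Proof.
move=> sU pU Uz Pz.
have U0 : region P z0.
  apply: contrapT => h; have [t t01 Pt] := region_exit Pz h.
  apply: (pU (point_at z z0 t)) => //.
  have -> : point_at z z0 t = point_at z0 z (1 - t) by vring.
  by apply: sU => //; lra.
move=> x Ux; apply: region_interior (pU _ Ux).
apply: contrapT => h; have [t t01 Pt] := region_exit U0 h.
by apply: (pU (point_at z0 x t)) => //; exact: sU.
Qed.

Lemma vertex_polyline P k : polyline P (vertex (verts P) k).
Proof.
exists (k %% size (verts P))%N; first by rewrite /= ltn_mod size_verts_gt0.
exists 0; rewrite /= ?lexx ?ler01 //.
by rewrite (_ : vertex _ (k %% _) = vertex (verts P) k) ?/vertex ?modn_mod //; vring.
Qed.

Lemma region_interior_nonempty P : exists z, interior (region P) z.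
Proof.
have [Pv _] := polyline_region (vertex_polyline P 0).
have /(_ setT filterT)[z [? _]] : closure (interior (region P)) (vertex (verts P) 0).
  by rewrite region_regular.
by exists z.
Qed.

Lemma area_cover (n : nat) (V : nat -> set (R * R)) (A : set (R * R)) :
  measurable A -> (forall k, measurable (V k)) ->
  (forall x, A x -> exists2 k, (k < n)%N & V k x) ->
  (area A <= \sum_(k < n) area (V k))%E.
Proof.
move=> mA mV cov.
have mU m : measurable (\big[setU/set0]_(k < m) V k) by apply: bigsetU_measurable.
apply: le_trans (_ : area (\big[setU/set0]_(k < n) V k) <= _)%E.
  apply: area_le => // x /cov[k kn Vx].
  by rewrite -bigcup_mkord; exists k.
elim: n {cov} => [|n IH]; first by rewrite !big_ord0 /area measure0.
rewrite !big_ord_recr /=; apply: le_trans (areaU_le (mU n) (mV n)) _.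
exact: leeD2r.
Qed.

Lemma area_region_fan P c : (area (region P) <=
  (\sum_(k < size (verts P)) `|orient c (vertex (verts P) k) (vertex (verts P) k.+1)| / 2)%:E)%E.
Proof.
have /choice[V hV] : forall k, exists V : set (R * R), [/\ measurable V,
    tri c (vertex (verts P) k) (vertex (verts P) k.+1) `<=` V &
    (area V <= (`|orient c (vertex (verts P) k) (vertex (verts P) k.+1)| / 2)%:E)%E].
  by move=> k; exact: tri_area.
apply: le_trans (@area_cover (size (verts P)) V _ _ _ _) _.
- exact: region_measurable.
- by move=> k; case: (hV k).
- move=> x /(region_fan c)[k kn h]; exists k => //.
  by have [_ + _] := hV k; apply.
- by rewrite -sumEFin; apply: lee_sum => k _; have [_ _] := hV k.
Qed.

End Regions.

(** * Four points: Radon's theorem and the bound 16 A <= P^2 *)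

Section FourPoints.
Context {R : realType}.
Implicit Types (a b c d x z : R * R).

Lemma collinear_point a b x : a != b -> orient a b x = 0 ->
  exists s : R, x = point_at a b s.
Proof.
move=> ab o0; have d0 : dot (b - a) (b - a) != 0 by rewrite dot_eq0 subr_eq0 eq_sym.
exists (dot (x - a) (b - a) / dot (b - a) (b - a)).
apply: pair_ext; apply: (mulIf d0).
  apply: (eq_from_multiple (k := - (b.2 - a.2)) o0); rewrite subr0.
  by move: d0; vsimp => d0; field.
apply: (eq_from_multiple (k := (b.1 - a.1)) o0); rewrite subr0.
by move: d0; vsimp => d0; field.
Qed.

(** The segment from [c] to [d] meets the line through [a] and [b] at parameter [s]. The three
    outcomes are [s] in [0, 1], [s] negative and [s] above 1. *)
Lemma separated_segments a b c d : a != b -> orient a b c * orient a b d <= 0 ->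
  [\/ segment a b `&` segment c d !=set0, tri b c d a | tri a c d b].
Proof.
move=> ab sep.
have [t t01 ot] : exists2 t : R, 0 <= t <= 1 & orient a b (point_at c d t) = 0.
  have [e|ne] := eqVneq (orient a b c) (orient a b d).
    exists 0; first by rewrite lexx ler01.
    rewrite orient_point_at; move: sep; rewrite e -expr2 => h.
    by have /eqP := le_anti (introT andP (conj h (sqr_ge0 _))); rewrite sqrf_eq0 => /eqP ->; ring.
  exists (orient a b c / (orient a b c - orient a b d)); last first.
    by rewrite orient_point_at; field; rewrite subr_eq0.
  move: sep ne; move: (orient a b c) (orient a b d) => u v sep ne.
  have [uv|vu] := ltP v u.
    have h : 0 < u - v by rewrite subr_gt0.
    by rewrite ler_pdivlMr // ler_pdivrMr // mul0r mul1r; nra.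
  have h : 0 < v - u by rewrite subr_gt0 lt_neqAle ne.
  rewrite -[u - v]opprB invrN mulrN -mulNr ler_pdivlMr // ler_pdivrMr // mul0r mul1r; nra.
have [s sE] := collinear_point ab ot.
have cd : segment c d (point_at c d t) by exists t.
have [/andP[t0 t1]] := t01.
have [s0|s0] := leP 0 s; last first.
  constructor 2; exists (s / (s - 1)), ((1 - t) / (1 - s)), (t / (1 - s)).
  have s1 : 0 < 1 - s by lra.
  split.
  - by rewrite -[s - 1]opprB invrN mulrN -mulNr; apply: divr_ge0; lra.
  - by apply: divr_ge0; lra.
  - by apply: divr_ge0; lra.
  - by field; lra.
  - apply: (scalerI (lt0r_neq0 s1)); transitivity ((- s) *: b + point_at c d t).
      by rewrite sE; vring.
    by apply: pair_ext; vsimp; field; lra.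
have [s1|s1] := leP s 1.
  by constructor 1; exists (point_at c d t); split => //; exists s; [rewrite /= s0 s1|rewrite sE].
have sp : 0 < s by lra.
constructor 3; exists ((s - 1) / s), ((1 - t) / s), (t / s).
split.
- by apply: divr_ge0; lra.
- by apply: divr_ge0; lra.
- by apply: divr_ge0; lra.
- by field; lra.
- apply: (scalerI (lt0r_neq0 sp)); transitivity ((s - 1) *: a + point_at c d t).
    by rewrite sE; vring.
  by apply: pair_ext; vsimp; field; lra.
Qed.

Definition in_triangle_of_others a b c d : Prop :=
  [\/ tri b c d a, tri a c d b, tri a b d c | tri a b c d].

(** If none of the lines joining [a] to another point separated the two remaining points, the three
    products of orientations would be positive, whereas their product is minus a square. *)
Lemma radon4 a b c d : a != b -> a != c -> a != d ->
  [\/ in_triangle_of_others a b c d, segment a b `&` segment c d !=set0,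
    segment a c `&` segment b d !=set0 | segment a d `&` segment b c !=set0].
Proof.
move=> ab ac ad.
have [h|h1] := leP (orient a b c * orient a b d) 0.
  by have [?|?|?] := separated_segments ab h; [constructor 2|constructor 1; constructor 1|
    constructor 1; constructor 2].
have [h|h2] := leP (orient a c b * orient a c d) 0.
  by have [?|?|?] := separated_segments ac h; [constructor 3|
    constructor 1; constructor 1; apply: tri_swap12|constructor 1; constructor 3].
have [h|h3] := leP (orient a d b * orient a d c) 0.
  have [?|?|?] := separated_segments ad h; [by constructor 4|
    |by constructor 1; constructor 4].
  by constructor 1; constructor 1; apply: tri_swap23; apply: tri_swap12.
exfalso; move: h1 h2 h3.
rewrite (orient_swap a b c) (orient_swap a b d) (orient_swap a c d).
move: (orient a b c) (orient a b d) (orient a c d) => x y z; nra.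
Qed.

Definition hull4 a b c d : set (R * R) :=
  [set z | exists al be ga de : R, [/\ 0 <= al, 0 <= be, 0 <= ga, 0 <= de &
    al + be + ga + de = 1 /\ z = al *: a + be *: b + ga *: c + de *: d]].

Lemma hull4_tri a b c d : tri a b c d -> hull4 a b c d `<=` tri a b c.
Proof.
move=> [u [v [w [u0 v0 w0 e dE]]]] z [al [be [ga [de [h1 h2 h3 h4 [f ->]]]]]].
exists (al + de * u), (be + de * v), (ga + de * w); split;
  rewrite ?addr_ge0 ?mulr_ge0 //.
  rewrite -f -[in RHS](mulr1 de) -e; ring.
by rewrite dE; vring.
Qed.

Lemma hull4_swap12 a b c d : hull4 a b c d `<=` hull4 b a c d.
Proof.
move=> z [al [be [ga [de [h1 h2 h3 h4 [f ->]]]]]]; exists be, al, ga, de.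
by split => //; split; [rewrite -f; ring|vring].
Qed.

Lemma hull4_swap23 a b c d : hull4 a b c d `<=` hull4 a c b d.
Proof.
move=> z [al [be [ga [de [h1 h2 h3 h4 [f ->]]]]]]; exists al, ga, be, de.
by split => //; split; [rewrite -f; ring|vring].
Qed.

Lemma hull4_swap34 a b c d : hull4 a b c d `<=` hull4 a b d c.
Proof.
move=> z [al [be [ga [de [h1 h2 h3 h4 [f ->]]]]]]; exists al, be, de, ga.
by split => //; split; [rewrite -f; ring|vring].
Qed.

(** The crossing point is a combination of [a], [b] and also of [c], [d]. Exchanging one expression
    for the other eliminates [c] or [d], according to the comparison of their weights. *)
Lemma hull4_cross a b c d : segment a b `&` segment c d !=set0 ->
  hull4 a b c d `<=` tri a b c `|` tri a b d.
Proof.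
move=> [_ [[s /= /andP[s0 s1] <-] [t /= /andP[t0 t1] e]]].
move=> z [al [be [ga [de [h1 h2 h3 h4 [f zE]]]]]].
have cd1 : (1 - t) *: c = point_at a b s - t *: d by rewrite -e; vring.
have cd2 : t *: d = point_at a b s - (1 - t) *: c by rewrite -e; vring.
have [le|gt] := leP (ga * t) (de * (1 - t)).
  have [t1'|t1'] := eqVneq t 1.
    have g0 : ga = 0 by apply/le_anti; rewrite h3 andbT; move: le; rewrite t1' mulr1 subrr mulr0.
    right; exists al, be, de; split => //; first by rewrite -f g0; ring.
    by rewrite zE g0; vring.
  have u0 : 0 < 1 - t by lra.
  right; exists (al + ga / (1 - t) * (1 - s)), (be + ga / (1 - t) * s), (de - ga / (1 - t) * t).
  have k0 : 0 <= ga / (1 - t) by rewrite divr_ge0 // ltW.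
  split.
  - by rewrite addr_ge0 // mulr_ge0 // subr_ge0.
  - by rewrite addr_ge0 // mulr_ge0.
  - by rewrite subr_ge0 mulrAC ler_pdivrMr.
  - by rewrite -f; field; lra.
  - have -> : z = al *: a + be *: b + (ga / (1 - t)) *: ((1 - t) *: c) + de *: d.
      by rewrite zE; apply: pair_ext; vsimp; field; lra.
    by rewrite cd1; vring.
have tp : 0 < t.
  rewrite lt_neqAle t0 andbT eq_sym; apply: contraTneq gt => ->.
  by rewrite mulr0 subr0 mulr1 -leNgt.
left; exists (al + de / t * (1 - s)), (be + de / t * s), (ga - de / t * (1 - t)).
have k0 : 0 <= de / t by rewrite divr_ge0.
split.
- by rewrite addr_ge0 // mulr_ge0 // subr_ge0.
- by rewrite addr_ge0 // mulr_ge0.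
- by rewrite subr_ge0 mulrAC ler_pdivrMr // ltW.
- by rewrite -f; field; lra.
- have -> : z = al *: a + be *: b + ga *: c + (de / t) *: (t *: d).
    by rewrite zE; apply: pair_ext; vsimp; field; lra.
  by rewrite cd2; vring.
Qed.

Lemma orient_le a b c : `|orient a b c| <= edist a b * edist b c.
Proof.
have -> : orient a b c = cross (b - a) (c - b) by vsimp; ring.
exact: cross_le.
Qed.

Lemma orient_norm_rot a b c : `|orient b c a| = `|orient a b c|.
Proof. by rewrite orient_rot. Qed.

Lemma orient_norm_swap a b c : `|orient a c b| = `|orient a b c|.
Proof. by rewrite orient_swap normrN. Qed.

(* Heron's formula and the inequality between the geometric and the arithmetic
   mean. *)
Lemma triangle_isoperimetric a b c :
  108 * orient a b c ^+ 2 <= (edist a b + edist b c + edist c a) ^+ 4.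
Proof.
have := edist_triangle a b c; have := edist_triangle b c a; have := edist_triangle c a b.
rewrite (edistC a c) (edistC b a) (edistC c b).
have : orient a b c ^+ 2 = (edist a b + edist b c + edist c a) *
  (edist a b + edist b c - edist c a) * (edist a b + edist c a - edist b c) *
  (edist b c + edist c a - edist a b) / 4.
  have -> : orient a b c = cross (b - a) (c - b) by vsimp; ring.
  have := lagrange (b - a) (c - b); rewrite -!enormK -/(edist a b) -/(edist b c).
  have e : edist c a * edist c a = edist a b * edist a b + edist b c * edist b c + 2 * dot (b - a) (c - b).
    by rewrite /edist !enormK; vsimp; ring.
  have -> : dot (b - a) (c - b) = (edist c a ^+ 2 - edist a b ^+ 2 - edist b c ^+ 2) / 2.
    by rewrite !expr2 e; field.
  by move=> h; apply: (@addrI _ (((edist c a ^+ 2 - edist a b ^+ 2 - edist b c ^+ 2) / 2) ^+ 2)); rewrite h; field.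
move=> ->; move: (edist a b) (edist b c) (edist c a) => u v w h1 h2 h3.
have x0 : 0 <= u + v - w by lra.
have y0 : 0 <= u + w - v by lra.
have z0 : 0 <= v + w - u by lra.
have amgm (x y z : R) : 0 <= x -> 0 <= y -> 0 <= z -> 27 * (x * y * z) <= (x + y + z) ^+ 3.
  move=> x1 y1 z1.
  have : 0 <= (x + y + z) * ((x - y) ^+ 2 + (y - z) ^+ 2 + (z - x) ^+ 2) / 2.
    by rewrite divr_ge0 // mulr_ge0 ?addr_ge0 ?sqr_ge0.
  have : 0 <= x * (y - z) ^+ 2 + y * (z - x) ^+ 2 + z * (x - y) ^+ 2.
    have q1 := mulr_ge0 x1 (sqr_ge0 (y - z)); have q2 := mulr_ge0 y1 (sqr_ge0 (z - x)).
    by have q3 := mulr_ge0 z1 (sqr_ge0 (x - y)); rewrite !addr_ge0.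
  lra.
have s0 : 0 <= u + v + w by lra.
have := ler_wpM2l s0 (amgm _ _ _ x0 y0 z0).
rewrite (_ : u + v - w + (u + w - v) + (v + w - u) = u + v + w); last by ring.
by rewrite -exprS; lra.
Qed.

Lemma triangle_isoperimetric_weak a b c :
  `|orient a b c| / 2 <= (edist a b + edist b c + edist c a) ^+ 2 / 16.
Proof.
have P0 : 0 <= edist a b + edist b c + edist c a by rewrite !addr_ge0 // enorm_ge0.
have := triangle_isoperimetric a b c; rewrite -[orient a b c ^+ 2]real_normK ?num_real //.
move: (edist a b + _ + _) P0 => P P0.
have := normr_ge0 (orient a b c); move: `|_| => D D0 h.
suff : 8 * D <= P ^+ 2 by lra.
rewrite -(@ler_pXn2r _ 2) ?nnegrE ?mulr_ge0 ?exprn_ge0 //.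
rewrite -exprM exprMn; apply: le_trans h; have := sqr_ge0 D; lra.
Qed.

(** The closed path [a b c d] may cross itself or have a vertex inside the triangle of the others.
    In the latter case the hull is that triangle, whose perimeter is no larger; otherwise Radon
    gives two crossing segments that cut the hull into triangles in two ways. *)
Lemma hull4_isoperimetric a b c d (A : set (R * R)) : a != b -> a != c -> a != d ->
  measurable A -> A `<=` hull4 a b c d ->
  (area A <= ((edist a b + edist b c + edist c d + edist d a) ^+ 2 / 16)%:E)%E.
Proof.
move=> ab ac ad mA sA.
have e0 x y : 0 <= edist x y :> R by exact: enorm_ge0.
have tri1 (x y z : R * R) : A `<=` tri x y z -> (area A <= (`|orient x y z| / 2)%:E)%E.
  move=> sT; have [V [mV sV aV]] := tri_area x y z.
  by apply: le_trans aV; apply: area_le => //; exact: subset_trans sV.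
have tri2 (x y z t : R * R) : A `<=` tri x y z `|` tri x y t ->
    (area A <= ((`|orient x y z| + `|orient x y t|) / 2)%:E)%E.
  move=> sT; have [V [mV sV aV]] := tri_area x y z; have [W [mW sW aW]] := tri_area x y t.
  rewrite mulrDl EFinD; apply: le_trans (leeD aV aW).
  apply: le_trans (areaU_le mV mW); apply: area_le => //; first exact: measurableU.
  by apply: subset_trans sT _; exact: setUSS.
have mono (P L : R) : 0 <= P -> P <= L -> P ^+ 2 / 16 <= L ^+ 2 / 16.
  by move=> P0 PL; rewrite ler_pM2r // lerXn2r ?nnegrE // (le_trans P0).
have tri3 (x y z : R * R) : A `<=` tri x y z ->
    edist x y + edist y z + edist z x <= edist a b + edist b c + edist c d + edist d a ->
    (area A <= ((edist a b + edist b c + edist c d + edist d a) ^+ 2 / 16)%:E)%E.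
  move=> /tri1 h le; apply: le_trans h _; rewrite lee_fin.
  by apply: le_trans (triangle_isoperimetric_weak _ _ _) (mono _ _ _ le); rewrite !addr_ge0.
(* [A1] and [A2] bound twice the area through the two triangulations. Together they use all four
   triangles, each at most a product of two consecutive sides, so their sum is at most (ab + cd)(bc
   + da), hence a quarter of the squared perimeter, and the smaller is at most half of that. *)
have ABCD (A1 A2 : R) : (area A <= (A1 / 2)%:E)%E -> (area A <= (A2 / 2)%:E)%E ->
    A1 + A2 <= (edist a b + edist c d) * (edist b c + edist d a) ->
    (area A <= ((edist a b + edist b c + edist c d + edist d a) ^+ 2 / 16)%:E)%E.
  move=> h1 h2 le.
  have : Num.min A1 A2 / 2 <= (edist a b + edist b c + edist c d + edist d a) ^+ 2 / 16.
    have : Num.min A1 A2 + Num.min A1 A2 <= A1 + A2 by rewrite lerD // ge_min lexx ?orbT.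
    have := sqr_ge0 ((edist a b + edist c d) - (edist b c + edist d a)); lra.
  rewrite -lee_fin; apply: le_trans.
  by case: (leP A1 A2).
have [[h|h|h|h]|h|h|h] := radon4 ab ac ad.
- apply: (tri3 b c d).
    apply: subset_trans (hull4_tri h); apply: subset_trans sA _ => z.
    by move=> /hull4_swap12 /hull4_swap23 /hull4_swap34.
  have := edist_triangle d a b; lra.
- apply: (tri3 a c d).
    apply: subset_trans (hull4_tri h); apply: subset_trans sA _ => z.
    by move=> /hull4_swap23 /hull4_swap34.
  have := edist_triangle a b c; lra.
- apply: (tri3 a b d).
    apply: subset_trans (hull4_tri h); apply: subset_trans sA _ => z.
    by move=> /hull4_swap34.
  have := edist_triangle b c d; lra.
- apply: (tri3 a b c).
    by apply: subset_trans (hull4_tri h); exact: sA.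
  have := edist_triangle c d a; lra.
- have h' : segment c d `&` segment a b !=set0 by rewrite setIC.
  have s1 : A `<=` tri a b c `|` tri a b d by apply: subset_trans sA _; exact: hull4_cross.
  have s2 : A `<=` tri c d a `|` tri c d b.
    apply: subset_trans (hull4_cross h'); apply: subset_trans sA _ => z.
    by move=> /hull4_swap23 /hull4_swap12 /hull4_swap34 /hull4_swap23.
  apply: ABCD (tri2 _ _ _ _ s1) (tri2 _ _ _ _ s2) _.
  have := orient_le a b c; have := orient_le d a b; have := orient_le c d a; have := orient_le b c d.
  rewrite (orient_norm_rot b c d) -(orient_norm_rot d a b) -(orient_norm_rot a b d); lra.
- have h' : segment b d `&` segment a c !=set0 by rewrite setIC.
  have s1 : A `<=` tri a c b `|` tri a c d.
    by apply: subset_trans (hull4_cross h); apply: subset_trans sA _; exact: hull4_swap23.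
  have s2 : A `<=` tri b d a `|` tri b d c.
    apply: subset_trans (hull4_cross h'); apply: subset_trans sA _ => z.
    by move=> /hull4_swap12 /hull4_swap34 /hull4_swap23.
  apply: ABCD (tri2 _ _ _ _ s1) (tri2 _ _ _ _ s2) _.
  have := orient_le a b c; have := orient_le d a b; have := orient_le c d a; have := orient_le b c d.
  rewrite (orient_norm_swap a b c) -(orient_norm_rot d a b) (orient_norm_rot a b d).
  rewrite (orient_norm_swap b c d) (orient_norm_rot a c d); lra.
- have h' : segment b c `&` segment a d !=set0 by rewrite setIC.
  have s1 : A `<=` tri a d b `|` tri a d c.
    apply: subset_trans (hull4_cross h); apply: subset_trans sA _ => z.
    by move=> /hull4_swap34 /hull4_swap23.
  have s2 : A `<=` tri b c a `|` tri b c d.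
    apply: subset_trans (hull4_cross h'); apply: subset_trans sA _ => z.
    by move=> /hull4_swap12 /hull4_swap23.
  apply: ABCD (tri2 _ _ _ _ s1) (tri2 _ _ _ _ s2) _.
  have := orient_le a b c; have := orient_le d a b; have := orient_le c d a; have := orient_le b c d.
  rewrite (orient_norm_swap a b d) -(orient_norm_rot d a b) (orient_norm_swap a c d).
  rewrite (orient_norm_rot a c d) (orient_norm_rot a b c); lra.
Qed.

End FourPoints.

(** * Pentagons and quadrilaterals *)

Section PolygonIndices.
Context {R : realType}.
Implicit Types (P : polygon R).

Lemma vertex_mod (v : seq (R * R)) k : vertex v (k %% size v) = vertex v k.
Proof. by rewrite /vertex modn_mod. Qed.

Lemma vertexD (v : seq (R * R)) k : vertex v (k + size v) = vertex v k.
Proof. by rewrite /vertex modnDr. Qed.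

Lemma edge_mod (v : seq (R * R)) k : edge v (k %% size v) = edge v k.
Proof.
rewrite /edge vertex_mod; congr segment.
by rewrite /vertex -[(k %% _).+1]addn1 modnDml addn1.
Qed.

Lemma point_at0 (x y : R * R) : point_at x y 0 = x.
Proof. by vring. Qed.

Lemma point_at1 (x y : R * R) : point_at x y 1 = y.
Proof. by vring. Qed.

Lemma vertex_inj P k l : (k < size (verts P))%N -> (l < size (verts P))%N ->
  vertex (verts P) k = vertex (verts P) l -> k = l.
Proof.
move=> kn ln e; have [] // := @polygon_simple _ P k l 0 0 kn ln.
- by rewrite lexx ltr01.
- by rewrite lexx ltr01.
- by rewrite !point_at0.
Qed.

Lemma vertex_eq P k l : vertex (verts P) k = vertex (verts P) l ->
  (k = l %[mod size (verts P)])%N.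
Proof.
rewrite -(vertex_mod _ k) -(vertex_mod _ l); apply: vertex_inj;
  by rewrite ltn_mod size_verts_gt0.
Qed.

(** Simplicity concerns half-open edges, so the far end of a closed edge is first rewritten ([half])
    as the origin of the next edge. *)
Lemma edges_disjoint P k l :
  (k %% size (verts P) != l %% size (verts P))%N ->
  (k.+1 %% size (verts P) != l %% size (verts P))%N ->
  (l.+1 %% size (verts P) != k %% size (verts P))%N ->
  ~ (edge (verts P) k `&` edge (verts P) l !=set0).
Proof.
set n := size (verts P) => kl k1l l1k [x []].
have n0 : (0 < n)%N by exact: size_verts_gt0.
have half m : edge (verts P) m x -> exists (m' : nat) (s : R),
    [/\ (m' < n)%N, 0 <= s < 1, x = point_at (vertex (verts P) m') (vertex (verts P) m'.+1) s &
      m' = (m %% n)%N \/ m' = (m.+1 %% n)%N /\ s = 0].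
  move=> [s /= /andP[s0 s1] <-].
  have E j : vertex (verts P) (j %% n).+1 = vertex (verts P) j.+1.
    by rewrite /vertex -[(j %% n).+1]addn1 modnDml addn1.
  move: s1; rewrite le_eqVlt => /predU1P[->|s1].
    exists (m.+1 %% n)%N, 0; split; rewrite ?ltn_mod ?lexx ?ltr01 //.
      by rewrite point_at0 point_at1 vertex_mod.
    by right.
  exists (m %% n)%N, s; split; rewrite ?ltn_mod ?s0 //.
    by rewrite E vertex_mod.
  by left.
move=> /half[k' [s [k'n s01 xs ks]]] /half[l' [t [l'n t01 xt lt]]].
have [k'l' st] := polygon_simple k'n l'n s01 t01 (etrans (esym xs) xt).
case: ks lt => [kE|[kE s0]] [lE|[lE t0]].
- by move: kl; rewrite -kE -lE k'l' eqxx.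
- by move: l1k; rewrite -kE -lE k'l' eqxx.
- by move: k1l; rewrite -kE -lE k'l' eqxx.
- move: kl; rewrite -[(k %% n)%N](modn_mod) => /eqP; apply.
  have e : (k.+1 = l.+1 %[mod n])%N by rewrite -kE -lE k'l'.
  by rewrite modn_mod; apply/eqP; rewrite -(eqn_modDr 1) !addn1; apply/eqP.
Qed.

Lemma index_shift n i m : (0 < n)%N -> exists2 r, (r < n)%N & (i + r = m %[mod n])%N.
Proof.
move=> n0; exists ((m + (n - i %% n)) %% n)%N; first by rewrite ltn_mod.
rewrite modnDmr.
have -> : (i + (m + (n - i %% n)) = (i %/ n).+1 * n + m)%N.
  have := ltn_pmod i n0; have := divn_eq i n.
  move: (i %/ n)%N (i %% n)%N => q r -> rn.
  by rewrite mulSn; lia.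
by rewrite modnMDl.
Qed.

Lemma sum_shift (n i : nat) (f : nat -> R) : (forall k, f (k + n)%N = f k) ->
  \sum_(k < n) f (i + k)%N = \sum_(k < n) f k.
Proof.
move=> fn; elim: i => [|i IH]; first by [].
case: n fn IH => [|n] fn IH; first by rewrite !big_ord0.
rewrite -IH big_ord_recr [RHS]big_ord_recl /= addrC; congr (_ + _).
  by rewrite addn0 -(fn i); congr f; lia.
by apply: eq_bigr => k _; congr f; rewrite /bump /=; lia.
Qed.

Lemma perimeter_shift P i :
  perimeter P = \sum_(k < nsides P) side_length P (i + k).
Proof.
rewrite sum_shift // => k.
by rewrite /side_length /nsides -addSn !vertexD.
Qed.

Lemma vertex_neqS P k : vertex (verts P) k != vertex (verts P) k.+1.
Proof.
apply/eqP => /vertex_eq e; have := polygon_size P.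
have : (k + 0 == k + 1 %[mod size (verts P)])%N by rewrite addn0 addn1 e.
by rewrite eqn_modDl mod0n; case: (size _) => [|[|n]] // _; rewrite modn_small.
Qed.

End PolygonIndices.

(** * Regions cut out by half-planes *)

Section HalfPlanes.
Context {R : realType}.
Implicit Types (P : polygon R) (x y z : R * R).

Lemma interior_perturb (A : set (R * R)) x d : interior A x ->
  exists2 e : R, 0 < e & A (x + e *: d).
Proof.
move=> /nbhs_boxP[e e0 h].
pose m := Num.max `|d.1| `|d.2|.
have m0 : 0 <= m by rewrite le_max normr_ge0.
have m1 : 0 < m + 1 by rewrite ltr_wpDl.
exists (e / (m + 1)); first by rewrite divr_gt0.
have bd (u : R) : `|u| <= m -> `|e / (m + 1) * u| < e.
  move=> um; rewrite normrM gtr0_norm ?divr_gt0 //.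
  rewrite -[ltRHS](divfK (lt0r_neq0 m1)) ltr_pM2l ?divr_gt0 //; lra.
apply: h; rewrite addrC addKr /=; apply: bd; rewrite le_max lexx ?orbT //.
Qed.

Lemma point_at_mem (A : set (R * R)) z x : closed A ->
  (forall t : R, 0 <= t < 1 -> A (point_at z x t)) -> A x.
Proof.
move=> cA h; apply: cA => B /nbhs_boxP[e e0 hB].
pose m := Num.max `|z.1 - x.1| `|z.2 - x.2|.
have m0 : 0 <= m by rewrite le_max normr_ge0.
have m1 : 0 < m + 1 by rewrite ltr_wpDl.
pose s := Num.min 1 (e / (m + 1)).
have s0 : 0 < s by rewrite lt_min ltr01 divr_gt0.
have s1 : s <= 1 by rewrite ge_min lexx.
have se : s * (m + 1) <= e by rewrite -ler_pdivlMr // ge_min lexx orbT.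
exists (point_at z x (1 - s)); split; first by apply: h; lra.
have bd (u : R) : `|u| <= m -> `|s * u| < e.
  move=> um; rewrite normrM gtr0_norm //; apply: lt_le_trans se.
  by rewrite ltr_pM2l //; lra.
apply: hB.
  have -> : (point_at z x (1 - s)).1 - x.1 = s * (z.1 - x.1) by vsimp; ring.
  by apply: bd; rewrite le_max lexx.
have -> : (point_at z x (1 - s)).2 - x.2 = s * (z.2 - x.2) by vsimp; ring.
by apply: bd; rewrite le_max lexx orbT.
Qed.

(** The open intersection of the half-planes is convex and misses the boundary, which lies on the
    lines; it contains an interior point of the region, so [star_sub_region] applies. The closed
    statement follows by approaching along segments. *)
Lemma halfplanes_region P (n : nat) (a b : nat -> R * R) :
  (forall k, (k < n)%N -> a k != b k) ->
  (forall k j, (k < n)%N -> 0 <= orient (a k) (b k) (vertex (verts P) j)) ->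
  (forall x, polyline P x -> exists2 k, (k < n)%N & orient (a k) (b k) x = 0) ->
  [/\ forall x k, region P x -> (k < n)%N -> 0 <= orient (a k) (b k) x,
    forall x, (forall k, (k < n)%N -> 0 < orient (a k) (b k) x) -> interior (region P) x &
    forall x, (forall k, (k < n)%N -> 0 <= orient (a k) (b k) x) -> region P x].
Proof.
move=> ab hv hp.
have R1 x k : region P x -> (k < n)%N -> 0 <= orient (a k) (b k) x.
  by move=> Px kn; apply: region_orient Px => j; exact: hv.
pose U := [set x | forall k, (k < n)%N -> 0 < orient (a k) (b k) x].
have [z iz] := region_interior_nonempty P.
have Uz : U z.
  move=> k kn; rewrite lt_neqAle R1 ?andbT; last 2 first.
  - exact: interior_subset.
  - by [].
  apply/eqP => o0.
  (* Normal pointing to the negative side: an interior point on the line could be pushed across it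
     inside the region. *)
  pose d := ((b k - a k).2, - (b k - a k).1).
  have [e e0 Pe] := interior_perturb d iz.
  have := R1 _ k Pe kn; rewrite leNgt => /negP; apply.
  have -> : orient (a k) (b k) (z + e *: d) =
      orient (a k) (b k) z - e * dot (b k - a k) (b k - a k).
    by rewrite /d; vsimp; ring.
  rewrite -o0 sub0r oppr_lt0 mulr_gt0 // lt_neqAle dot_ge0 andbT eq_sym dot_eq0.
  by rewrite subr_eq0 eq_sym ab.
have R2 : U `<=` interior (region P).
  apply: (@star_sub_region _ P U z z) => //; last exact: interior_subset.
  - move=> x t Ux /andP[t0 t1] k kn; rewrite orient_point_at.
    have := Ux k kn; have := Uz k kn.
    move: t1; rewrite le_eqVlt => /predU1P[->|t1] uz ux.
      by rewrite subrr mul0r mul1r add0r.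
    have t1' : 0 < 1 - t by rewrite subr_gt0.
    exact: ltr_pwDl (mulr_gt0 t1' uz) (mulr_ge0 t0 (ltW ux)).
  - by move=> x Ux /hp[k kn o0]; have := Ux k kn; rewrite o0 ltxx.
split=> // x hx; apply: (@point_at_mem _ z); first exact: region_closed.
move=> t /andP[t0 t1]; apply: interior_subset; apply: R2 => k kn.
have t1' : 0 < 1 - t by rewrite subr_gt0.
rewrite orient_point_at; exact: ltr_pwDl (mulr_gt0 t1' (Uz k kn)) (mulr_ge0 t0 (hx k kn)).
Qed.

End HalfPlanes.

(** * Pentagons in convex position *)

Section Pentagons.
Context {R : realType}.
Implicit Types (P : polygon R).

Lemma convex_tri (K : set (R * R)) (a b c : R * R) :
  (forall x y (t : R), K x -> K y -> 0 <= t <= 1 -> K (point_at x y t)) ->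
  K a -> K b -> K c -> tri a b c `<=` K.
Proof.
move=> cK ha hb hc x [al [be [ga [al0 be0 ga0 e xE]]]].
have [g1|g1] := eqVneq ga 1.
  have al1 : al = 0 by lra.
  have be1 : be = 0 by lra.
  by rewrite xE g1 al1 be1 !scale0r !add0r scale1r.
have g2 : 0 < 1 - ga by lra.
have -> : x = point_at (point_at a b (be / (1 - ga))) c ga.
  have alE : al = 1 - ga - be by rewrite -e; ring.
  by rewrite xE alE; apply: pair_ext; vsimp; field; lra.
apply: (cK) => //; last by lra.
by apply: cK => //; rewrite divr_ge0 ?(ltW g2) //= ler_pdivrMr // mul1r; lra.
Qed.

Lemma hull4_convex (a b c d x y : R * R) (t : R) : hull4 a b c d x ->
  hull4 a b c d y -> 0 <= t <= 1 -> hull4 a b c d (point_at x y t).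
Proof.
move=> [a1 [a2 [a3 [a4 [? ? ? ? [ea ->]]]]]] [b1 [b2 [b3 [b4 [? ? ? ? [eb ->]]]]]].
move=> /andP[t0 t1]; have t1' : 0 <= 1 - t by lra.
exists ((1 - t) * a1 + t * b1), ((1 - t) * a2 + t * b2), ((1 - t) * a3 + t * b3),
  ((1 - t) * a4 + t * b4); split; rewrite ?addr_ge0 ?mulr_ge0 //; split; last by vring.
transitivity ((1 - t) * (a1 + a2 + a3 + a4) + t * (b1 + b2 + b3 + b4)); first by ring.
by rewrite ea eb; ring.
Qed.

(** The negation of this condition plays the role of convex position for the list of vertices. *)
Definition reducible P : Prop := exists i j k l : nat,
  let n := size (verts P) in
  [/\ (i != j %[mod n])%N, (i != k %[mod n])%N, (i != l %[mod n])%N &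
    tri (vertex (verts P) j) (vertex (verts P) k) (vertex (verts P) l) (vertex (verts P) i)].

(** Otherwise [separated_segments] applies to the edges at [k] and [k + c]: either these
    non-adjacent edges meet, against simplicity, or an end of the edge at [k] lies in the triangle
    of three other vertices. *)
Lemma same_side P (k c d : nat) : ~ reducible P -> d = c.+1 ->
  (1 < c)%N -> (d < size (verts P))%N ->
  0 < orient (vertex (verts P) k) (vertex (verts P) k.+1) (vertex (verts P) (k + c)) *
      orient (vertex (verts P) k) (vertex (verts P) k.+1) (vertex (verts P) (k + d)).
Proof.
move=> nr dE c1 dn; rewrite ltNge; apply/negP => h; rewrite dE in h dn.
have M (i j : nat) : (i < size (verts P))%N -> (j < size (verts P))%N -> i != j ->
    (k + i != k + j %[mod size (verts P)])%N.
  by move=> hi hj ij; rewrite eqn_modDl !modn_small.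
have cn : (c < size (verts P))%N by apply: ltnW.
have n1 : (1 < size (verts P))%N by apply: ltn_trans cn.
have n0 : (0 < size (verts P))%N by exact: size_verts_gt0.
have M0 j : (0 < j < size (verts P))%N -> (k != k + j %[mod size (verts P)])%N.
  by move=> /andP[j0 jn]; have := M 0%N j n0 jn; rewrite addn0; apply; rewrite neq_ltn j0.
have M1 j : (j < size (verts P))%N -> (j != 1)%N -> (k.+1 != k + j %[mod size (verts P)])%N.
  by move=> jn j1; have := M 1%N j n1 jn; rewrite addn1; apply; rewrite eq_sym.
have [h1|h1|h1] := separated_segments (vertex_neqS P k) h.
- rewrite addnS in h1; apply: (@edges_disjoint _ P k (k + c) _ _ _ h1).
  + by apply: M0; rewrite cn andbT ltnW.
  + by apply: M1 => //; rewrite neq_ltn c1 orbT.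
  + by rewrite eq_sym -addnS; apply: M0; rewrite dn.
- apply: nr; exists k, k.+1, (k + c)%N, (k + c.+1)%N; split => //.
  + by rewrite -addn1; apply: M0.
  + by apply: M0; rewrite cn andbT ltnW.
  + by apply: M0; rewrite dn.
- apply: nr; exists k.+1, k, (k + c)%N, (k + c.+1)%N; split => //.
  + by have := M1 0%N n0 isT; rewrite addn0.
  + by apply: M1 => //; rewrite neq_ltn c1 orbT.
  + by apply: M1 => //; rewrite eqSS -lt0n ltnW.
Qed.

(** The region lies in the hull of the four vertices other than [i]. Their closed path is no longer
    than the pentagon, as skipping [i] replaces two sides by one, so 16 <= P^2. *)
Lemma reducible_pentagon P : pentagon P -> unit_area P -> reducible P ->
  4 <= perimeter P.
Proof.
rewrite /pentagon => n5 aP [i [j [k [l [ij ik il h]]]]].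
have s5 : size (verts P) = 5%N by []. clear n5.
pose v m := vertex (verts P) (i + m).
have cover m : exists2 r, (r < 5)%N & vertex (verts P) m = v r.
  have [r rn e] := @index_shift (size (verts P)) i m ltac:(by rewrite s5).
  exists r; first by rewrite -s5.
  by rewrite /v -vertex_mod -e vertex_mod.
have H4 r : (0 < r < 5)%N -> hull4 (v 1%N) (v 2%N) (v 3%N) (v 4%N) (v r).
  case: r => [|[|[|[|[|r]]]]] // _; [exists 1, 0, 0, 0|exists 0, 1, 0, 0|exists 0, 0, 1, 0|exists 0, 0, 0, 1];
  by split => //; split; [ring|vring].
have other m : (i != m %[mod size (verts P)])%N ->
    hull4 (v 1%N) (v 2%N) (v 3%N) (v 4%N) (vertex (verts P) m).
  move=> im; have [r rn e] := @index_shift (size (verts P)) i m ltac:(by rewrite s5).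
  rewrite -vertex_mod -e vertex_mod; apply: H4; rewrite -s5 rn andbT.
  by case: r rn e => // _ e; move: im; rewrite -e addn0 eqxx.
have sH : region P `<=` hull4 (v 1%N) (v 2%N) (v 3%N) (v 4%N).
  apply: region_sub_convex; first exact: hull4_convex.
  move=> m.
  have [e|ne] := eqVneq (i %% size (verts P))%N (m %% size (verts P))%N; last exact: other.
  rewrite -vertex_mod -e vertex_mod.
  apply: (@convex_tri (hull4 _ _ _ _) _ _ _ _ _ _ _ _ h); try exact: other.
  exact: hull4_convex.
have dv r s : (r < 5)%N -> (s < 5)%N -> r != s -> v r != v s.
  move=> r5 s5' rs; apply/eqP => /vertex_eq/eqP.
  by rewrite eqn_modDl !modn_small ?s5 // (negPf rs).
have A := hull4_isoperimetric (dv 1%N 2%N isT isT isT) (dv 1%N 3%N isT isT isT)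
  (dv 1%N 4%N isT isT isT) (region_measurable P) sH.
rewrite /area aP lee_fin in A.
have L : edist (v 1%N) (v 2%N) + edist (v 2%N) (v 3%N) + edist (v 3%N) (v 4%N) +
    edist (v 4%N) (v 1%N) <= perimeter P.
  rewrite (perimeter_shift P i) /nsides s5 !big_ord_recr big_ord0 /= add0r /side_length -!addnS.
  rewrite -/(v 0%N) -/(v 1%N) -/(v 2%N) -/(v 3%N) -/(v 4%N).
  have -> : vertex (verts P) (i + 5) = v 0%N by rewrite -s5 vertexD /v addn0.
  by have := edist_triangle (v 4%N) (v 0%N) (v 1%N); clear; lra.
have e0 x y : 0 <= edist x y :> R by exact: enorm_ge0.
move: A L; set L := (X in X ^+ 2) => A L4.
have L0 : 0 <= L by rewrite /L !addr_ge0.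
apply: le_trans L4; rewrite leNgt; apply/negP => lt.
have := ler_pM L0 L0 (ltW lt) (ltW lt); have : L * L < 4 * 4 by apply: ltr_pM.
by rewrite -expr2; move: A; clear; lra.
Qed.

(** The conditions of [same_side] for the five edges link the ten orientations into a single class,
    so all have the sign of the first; a negative sign is repaired by reading the list backwards. *)
Lemma convex_pentagon P : pentagon P -> ~ reducible P ->
  exists2 e : nat, e = 1%N \/ e = 4%N & ccw5 (fun k => vertex (verts P) (e * k)).
Proof.
move=> n5 nr; have s5 : size (verts P) = 5%N by [].
have S k c := @same_side P k c c.+1 nr erefl.
have V m : vertex (verts P) m = nth (0, 0) (verts P) (m %% 5)%N by rewrite /vertex s5.
have := (S 0%N 2%N isT, S 0%N 3%N isT, S 1%N 2%N isT, S 1%N 3%N isT, S 2%N 2%N isT,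
  S 2%N 3%N isT, S 3%N 2%N isT, S 3%N 3%N isT, S 4%N 2%N isT, S 4%N 3%N isT).
rewrite s5 !V /= => H; clear S n5 s5.
set q0 := nth _ _ 0 in H V *; set q1 := nth _ _ 1 in H V *; set q2 := nth _ _ 2 in H V *.
set q3 := nth _ _ 3 in H V *; set q4 := nth _ _ 4 in H V *.
move: H; rewrite (orient_rot q0 q1 q2).
rewrite (orient_rot q0 q2 q3) (orient_rot q1 q2 q3) (orient_rot q0 q3 q4) (orient_rot q1 q3 q4).
rewrite (orient_rot q2 q3 q4) -(orient_rot q4 q0 q1) -(orient_rot q4 q0 q2) -(orient_rot q4 q0 q3).
move=> -[[[[[[[[[/(_ isT) h1 /(_ isT) h2] /(_ isT) h3] /(_ isT) h4] /(_ isT) h5] /(_ isT) h6]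
  /(_ isT) h7] /(_ isT) h8] /(_ isT) h9] /(_ isT) h10].
have [c0|c0|c0] := ltgtP (orient q0 q1 q2) 0; last by rewrite c0 mul0r ltxx in h1.
  exists 4%N; first by right.
  have c1 : orient q0 q1 q3 < 0 by rewrite nmulr_rgt0 in h1.
  have c2 : orient q0 q1 q4 < 0 by rewrite nmulr_rgt0 in h2.
  have c3 : orient q0 q2 q4 < 0 by rewrite nmulr_rgt0 in h9.
  have c4 : orient q0 q3 q4 < 0 by rewrite nmulr_rgt0 in h10.
  have c5 : orient q1 q3 q4 < 0 by rewrite nmulr_rgt0 in h7.
  have c6 : orient q2 q3 q4 < 0 by rewrite nmulr_rgt0 in h8.
  have c7 : orient q0 q2 q3 < 0 by rewrite nmulr_rgt0 in h5.
  have c8 : orient q1 q2 q3 < 0 by rewrite nmulr_rgt0 in h6.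
  have c9 : orient q1 q2 q4 < 0 by rewrite nmulr_rgt0 in h3.
  move=> i j k; case: k => [|[|[|[|[|k]]]]] //; case: j => [|[|[|[|j]]]] //;
    case: i => [|[|[|i]]] // _ _ _; rewrite !V /= -/q0 -/q1 -/q2 -/q3 -/q4 orient_swap oppr_gt0 //;
    by [rewrite orient_rot|rewrite -orient_rot].
exists 1%N; first by left.
have c1 : 0 < orient q0 q1 q3 by rewrite pmulr_rgt0 in h1.
have c2 : 0 < orient q0 q1 q4 by rewrite pmulr_rgt0 in h2.
have c3 : 0 < orient q0 q2 q4 by rewrite pmulr_rgt0 in h9.
have c4 : 0 < orient q0 q3 q4 by rewrite pmulr_rgt0 in h10.
have c5 : 0 < orient q1 q3 q4 by rewrite pmulr_rgt0 in h7.
have c6 : 0 < orient q2 q3 q4 by rewrite pmulr_rgt0 in h8.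
have c7 : 0 < orient q0 q2 q3 by rewrite pmulr_rgt0 in h5.
have c8 : 0 < orient q1 q2 q3 by rewrite pmulr_rgt0 in h6.
have c9 : 0 < orient q1 q2 q4 by rewrite pmulr_rgt0 in h3.
move=> i j k; case: k => [|[|[|[|[|k]]]]] //; case: j => [|[|[|[|j]]]] //;
  by case: i => [|[|[|i]]] // _ _ _; rewrite !V.
Qed.

(* With e = 4 the vertices are listed backwards, -1 being 4 modulo 5. *)
Definition pentagon_vertices P (e k : nat) : R * R := vertex (verts P) (e * k).

Lemma orient_xx (a b : R * R) : orient a a b = 0.
Proof. by rewrite /orient subrr /cross /= !mul0r subrr. Qed.

Lemma orient_xyx (a b : R * R) : orient a b a = 0.
Proof. by rewrite orient_swap orient_xx oppr0. Qed.

Lemma orient_xyy (a b : R * R) : orient a b b = 0.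
Proof. by rewrite orient_rot orient_xyx. Qed.

Lemma ccw5_support p k m : ccw5 p -> 0 <= orient (cyc5 p k) (cyc5 p k.+1) (cyc5 p m) :> R.
Proof.
elim: k p m => [|k IH] p m h.
  rewrite /cyc5; have : (m %% 5 < 5)%N by rewrite ltn_mod.
  case: (m %% 5)%N => [|[|[|[|[|//]]]]] _; rewrite ?orient_xyx //.
  - by rewrite orient_xyy.
  - by rewrite ltW //; exact: h.
  - by rewrite ltW //; exact: h.
  - by rewrite ltW //; exact: h.
have := IH _ (m + 4)%N (ccw5_rot h); rewrite !cyc5_rot.
by rewrite -addnS /cyc5 modnDr.
Qed.

Section Oriented.
Context (P : polygon R) (e : nat) (P5 : pentagon P) (e14 : e = 1%N \/ e = 4%N).
Let p := pentagon_vertices P e.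
Context (ccw_p : ccw5 p).

Let s5 : size (verts P) = 5%N. Proof. exact: P5. Qed.

Lemma cyc5_pentagon_vertices k : cyc5 p k = p k.
Proof.
by rewrite /cyc5 /p /pentagon_vertices -!(vertex_mod _ (e * _)) s5 modnMmr.
Qed.

Lemma perim5_pentagon_vertices : perim5 p = perimeter P.
Proof.
have V m : vertex (verts P) m = nth (0, 0) (verts P) (m %% 5)%N by rewrite /vertex s5.
rewrite /perim5 /perimeter /nsides s5 !big_ord_recr !big_ord0 /= /side /side_length.
rewrite /cyc5 /p /pentagon_vertices !V -!/(edist _ _) !add0r.
pose q i := nth (0, 0) (verts P) i.
transitivity (edist (q 0%N) (q 1%N) + edist (q 1%N) (q 2%N) + edist (q 2%N) (q 3%N) +
  edist (q 3%N) (q 4%N) + edist (q 4%N) (q 0%N)); last by [].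
case: e14 => -> //.
transitivity (edist (q 0%N) (q 4%N) + edist (q 4%N) (q 3%N) + edist (q 3%N) (q 2%N) +
  edist (q 2%N) (q 1%N) + edist (q 1%N) (q 0%N)); first by [].
rewrite (edistC (q 0%N) (q 4%N)) (edistC (q 4%N) (q 3%N)) (edistC (q 3%N) (q 2%N)).
by rewrite (edistC (q 2%N) (q 1%N)) (edistC (q 1%N) (q 0%N)); move: q => q; ring.
Qed.

(** The fan from vertex 0 covers the region, which has area 1; in convex position the three
    triangles of the fan have total area [area5]. *)
Lemma area5_pentagon_vertices : unit_area P -> 1 <= area5 p.
Proof.
move=> aP; have := area_region_fan P (vertex (verts P) 0).
rewrite /area aP lee_fin s5 !big_ord_recr !big_ord0 /=.
have V m : vertex (verts P) m = nth (0, 0) (verts P) (m %% 5)%N by rewrite /vertex s5.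
have [c1 c2 c3] : [/\ 0 < orient (p 0) (p 1%N) (p 2%N), 0 < orient (p 0) (p 2%N) (p 3%N) &
  0 < orient (p 0) (p 3%N) (p 4%N)] by split; exact: ccw_p.
rewrite /area5; move: c1 c2 c3; rewrite /p /pentagon_vertices !V.
have nn (a b c : R * R) : 0 < orient a c b -> `|orient a b c| = orient a c b.
  by move=> h; rewrite orient_swap normrN gtr0_norm.
pose q i := nth (0, 0) (verts P) i.
rewrite -[nth _ _ (0 %% 5)%N]/(q 0%N) -[nth _ _ (1 %% 5)%N]/(q 1%N) -[nth _ _ (2 %% 5)%N]/(q 2%N).
rewrite -[nth _ _ (3 %% 5)%N]/(q 3%N) -[nth _ _ (4 %% 5)%N]/(q 4%N).
rewrite orient_xx (orient_xyx (q 0%N)) normr0 mul0r.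
case: e14 => -> c1 c2 c3 A.
  move: A; rewrite -[X in _ -> _ <= X]/((orient (q 0%N) (q 1%N) (q 2%N) + orient (q 0%N) (q 2%N) (q 3%N) +
    orient (q 0%N) (q 3%N) (q 4%N)) / 2).
  by rewrite (gtr0_norm c1) (gtr0_norm c2) (gtr0_norm c3) !add0r addr0 !mulrDl.
move: A; rewrite -[X in _ -> _ <= X]/((orient (q 0%N) (q 4%N) (q 3%N) + orient (q 0%N) (q 3%N) (q 2%N) +
  orient (q 0%N) (q 2%N) (q 1%N)) / 2).
have {}c1 : 0 < orient (q 0%N) (q 4%N) (q 3%N) := c1.
have {}c2 : 0 < orient (q 0%N) (q 3%N) (q 2%N) := c2.
have {}c3 : 0 < orient (q 0%N) (q 2%N) (q 1%N) := c3.
by rewrite (nn _ _ _ c1) (nn _ _ _ c2) (nn _ _ _ c3) !add0r addr0 !mulrDl => A; apply: le_trans A _; rewrite le_eqVlt; apply/orP; left; apply/eqP; ring.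
Qed.

(** [halfplanes_region] for the five side lines. The vertices of [P] are found again among the [p k]
    because [e * e] is 1 modulo 5. *)
Lemma region_pentagon :
  (forall x k, region P x -> 0 <= orient (p k) (p k.+1) x) /\
  (forall x, (forall k, (k < 5)%N -> 0 < orient (p k) (p k.+1) x) -> interior (region P) x).
Proof.
have pc k : p k = p (k %% 5)%N by rewrite -[LHS]cyc5_pentagon_vertices.
have pS k : p k.+1 = p (k %% 5).+1.
  by rewrite pc [RHS]pc -[(k %% 5).+1]addn1 modnDml addn1.
have ne k : p k != p k.+1.
  apply/eqP => E; have := ccw5_side k ccw_p.
  by rewrite /side !cyc5_pentagon_vertices -E subrr; vsimp; rewrite !mul0r subrr ltxx.
have V m : vertex (verts P) m = vertex (verts P) (m %% 5) by rewrite -s5 vertex_mod.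
have vp j : vertex (verts P) j = p (e * j)%N.
  rewrite /p /pentagon_vertices [LHS]V [RHS]V; congr vertex.
  by case: e14 => ->; rewrite ?mul1n // (_ : 4 * (4 * j) = 3 * j * 5 + j)%N ?modnMDl //; lia.
have hv k j : (k < 5)%N -> 0 <= orient (p k) (p k.+1) (vertex (verts P) j).
  by move=> _; rewrite vp -!cyc5_pentagon_vertices; exact: ccw5_support.
have hp x : polyline P x -> exists2 k, (k < 5)%N & orient (p k) (p k.+1) x = 0.
  move=> [j _ [t _ <-]].
  suff [k [[kE kE']|[kE kE']]] : exists k,
      (p k = vertex (verts P) j /\ p k.+1 = vertex (verts P) j.+1) \/
      (p k = vertex (verts P) j.+1 /\ p k.+1 = vertex (verts P) j).
  - exists (k %% 5)%N; first by rewrite ltn_mod.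
    by rewrite -pc -pS orient_point_at kE kE' orient_xyx orient_xyy !mulr0 addr0.
  - exists (k %% 5)%N; first by rewrite ltn_mod.
    by rewrite -pc -pS orient_point_at kE kE' orient_xyx orient_xyy !mulr0 addr0.
  case: e14 => eE.
    by exists j; left; rewrite !vp eE !mul1n.
  exists (4 * j.+1)%N; right; rewrite !vp eE; split => //.
  by rewrite pc [RHS]pc; congr p; rewrite mulnS -addn1 addnAC modnDl.
have [R1 R2 _] := halfplanes_region (fun k _ => ne k) hv hp.
split=> // x k Px; rewrite pc pS; apply: R1 => //.
by rewrite ltn_mod.
Qed.

End Oriented.

End Pentagons.

(** * Congruent pentagons have the same angles *)

Section Congruence.
Context {R : realType}.
Implicit Types (p : nat -> R * R) (P T : polygon R).

Lemma dot_edist (a b c : R * R) :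
  dot (b - a) (c - a) = (edist a b ^+ 2 + edist a c ^+ 2 - edist b c ^+ 2) / 2.
Proof. by rewrite !expr2 /edist !enormK; vsimp; field. Qed.

Lemma ang_edist (a b c a' b' c' : R * R) : edist a b = edist a' b' ->
  edist a c = edist a' c' -> edist b c = edist b' c' ->
  ang (b - a) (c - a) = ang (b' - a') (c' - a').
Proof.
move=> h1 h2 h3; rewrite /ang !dot_edist h1 h2 h3.
by rewrite -!/(edist _ _) h1 h2.
Qed.

(** The squared distance from a point to a barycentric combination depends only on mutual distances.
    Hence the combination with the same coefficients is at distance 0 from [a']. *)
Lemma tri_edist (a b c d a' b' c' d' : R * R) :
  edist a b = edist a' b' -> edist a c = edist a' c' -> edist a d = edist a' d' ->
  edist b c = edist b' c' -> edist c d = edist c' d' -> edist b d = edist b' d' ->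
  tri b c d a -> tri b' c' d' a'.
Proof.
move=> ab ac ad bc cd bd [al [be [ga [al0 be0 ga0 e aE]]]].
exists al, be, ga; split => //.
have S (x y z w : R * R) : edist x (al *: y + be *: z + ga *: w) ^+ 2 =
    al * edist x y ^+ 2 + be * edist x z ^+ 2 + ga * edist x w ^+ 2 -
    al * be * edist y z ^+ 2 - be * ga * edist z w ^+ 2 - al * ga * edist y w ^+ 2.
  rewrite !expr2 /edist !enormK.
  have -> : al = 1 - be - ga by rewrite -e; ring.
  by vsimp; ring.
have E : edist a' (al *: b' + be *: c' + ga *: d') ^+ 2 = 0.
  rewrite S -ab -ac -ad -bc -cd -bd -S -aE /edist subrr expr2 enormK.
  by vsimp; rewrite mulr0 addr0.
move/eqP: E; rewrite sqrf_eq0 /edist enorm_eq0 subr_eq0 => /eqP ->.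
by [].
Qed.

(* The angle at the vertex of index m, m - 1 being m + 4 modulo 5. *)
Definition vertex_angle p m : R :=
  ang (cyc5 p (m + 1) - cyc5 p m) (cyc5 p (m + 4) - cyc5 p m).

Lemma interior_vertex_angle p k : interior_angle p k = vertex_angle p k.+1.
Proof.
rewrite /interior_angle /vertex_angle addn1; congr (ang _ (_ - _)).
by rewrite addSnnS /cyc5 modnDr.
Qed.

Lemma vertex_angle_rot p m : vertex_angle (fun k => cyc5 p k.+1) m = vertex_angle p m.+1.
Proof. by rewrite /vertex_angle !cyc5_rot !addSn. Qed.

(** Characterises the angle at a vertex of a convex pentagon by distances alone: it is the largest
    angle under which two other vertices are seen. No cyclic order of the vertices enters, as an
    isometry is only known to permute the set of vertices. *)
Lemma vertex_angle_max p m r s : ccw5 p -> (0 < r < 5)%N -> (0 < s < 5)%N ->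
  ang (cyc5 p (m + r) - cyc5 p m) (cyc5 p (m + s) - cyc5 p m) <= vertex_angle p m.
Proof.
elim: m p => [|m IH] p h hr hs; last first.
  by have := IH _ (ccw5_rot h) hr hs; rewrite vertex_angle_rot !cyc5_rot -!addSn.
rewrite /vertex_angle !add0n.
have E k : (k < 5)%N -> cyc5 p k = p k by move=> k5; rewrite /cyc5 modn_small.
have c12 := h 0%N 1%N 2%N isT isT isT; have c13 := h 0%N 1%N 3%N isT isT isT.
have c14 := h 0%N 1%N 4%N isT isT isT; have c23 := h 0%N 2%N 3%N isT isT isT.
have c24 := h 0%N 2%N 4%N isT isT isT; have c34 := h 0%N 3%N 4%N isT isT isT.
rewrite /orient in c12 c13 c14 c23 c24 c34.
have nz1 := cross_neq0l (lt0r_neq0 c12); have nz2 := cross_neq0r (lt0r_neq0 c12).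
have nz3 := cross_neq0r (lt0r_neq0 c13); have nz4 := cross_neq0r (lt0r_neq0 c14).
have ang0 (u : R * R) : u != 0 -> ang u u = 0.
  by move=> u0; rewrite /ang enormK divff ?acos1 // dot_eq0.
have /andP[g12 _] := ang_gt0 c12; have /andP[g13 _] := ang_gt0 c13.
have /andP[g14 _] := ang_gt0 c14; have /andP[g23 _] := ang_gt0 c23.
have /andP[g24 _] := ang_gt0 c24; have /andP[g34 _] := ang_gt0 c34.
have a1 := angD c12 c24 c14; have a2 := angD c13 c34 c14; have a3 := angD c12 c23 c13.
have a4 := angD c23 c34 c24.
move: hr hs; rewrite (E 0%N) // (E 1%N) // (E 4%N) //.
case: r => [|[|[|[|[|r]]]]] // _; case: s => [|[|[|[|[|s]]]]] // _;
  rewrite !E // ?ang0 ?(ltW g14) //; (lra || (rewrite angC; lra)).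
Qed.

Lemma vertex_angle_le p p' (sg : nat -> nat) m : ccw5 p -> ccw5 p' ->
  (forall i, (i < 5)%N -> (sg i < 5)%N) ->
  (forall i j, (i < 5)%N -> (j < 5)%N -> sg i = sg j -> i = j) ->
  (forall i j, (i < 5)%N -> (j < 5)%N -> edist (p' i) (p' j) = edist (p (sg i)) (p (sg j))) ->
  (m < 5)%N -> vertex_angle p' m <= vertex_angle p (sg m).
Proof.
move=> h h' sg5 sgi de m5; rewrite /vertex_angle.
have E k : (k < 5)%N -> cyc5 p k = p k by move=> k5; rewrite /cyc5 modn_small.
have l5 k : (k %% 5 < 5)%N by rewrite ltn_mod.
have sh k : (k %% 5)%N != m -> exists2 r, (0 < r < 5)%N & p (sg (k %% 5)%N) = cyc5 p (sg m + r).
  move=> km; have [r r5 e] := @index_shift 5 (sg m) (sg (k %% 5)%N) isT.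
  exists r; last by rewrite /cyc5 e (modn_small (sg5 _ (l5 k))).
  rewrite r5 andbT; case: r r5 e => // _ e.
  move: e; rewrite addn0 (modn_small (sg5 _ m5)) (modn_small (sg5 _ (l5 k))) => e'; have e := sgi _ _ m5 (l5 k) e'.
  by move: km; rewrite -e eqxx.
have [n1 n4] : ((m + 1) %% 5)%N != m /\ ((m + 4) %% 5)%N != m.
  by clear -m5; move: m5; case: m => [|[|[|[|[|m]]]]].
have [r r5 rE] := sh _ n1.
have [s s5 sE] := sh _ n4.
apply: le_trans (vertex_angle_max (sg m) h r5 s5).
rewrite le_eqVlt; apply/orP; left; apply/eqP.
rewrite -rE -sE (E (sg m)) ?sg5 // (_ : cyc5 p' m = p' m); last by rewrite /cyc5 modn_small.
by rewrite /cyc5; apply: ang_edist; rewrite de // ?l5.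
Qed.

(** [S], the sum of the two affine forms of the sides at vertex [i], vanishes at that vertex and is
    positive at the four others, so the vertex is no convex combination of them. *)
Lemma ccw5_not_tri p i j k l : ccw5 p -> (i < 5)%N -> (j < 5)%N -> (k < 5)%N -> (l < 5)%N ->
  i != j -> i != k -> i != l -> ~ tri (p j) (p k) (p l) (p i).
Proof.
move=> h i5 j5 k5 l5 ij ik il [al [be [ga [al0 be0 ga0 e xE]]]].
pose S x := orient (cyc5 p i) (cyc5 p (i + 1)) x + orient (cyc5 p (i + 4)) (cyc5 p i) x.
have Spos p' m r : ccw5 p' -> (0 < r < 5)%N ->
    0 < orient (cyc5 p' m) (cyc5 p' (m + 1)) (cyc5 p' (m + r)) +
        orient (cyc5 p' (m + 4)) (cyc5 p' m) (cyc5 p' (m + r)).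
  move=> h'; elim: m p' h' => [|m IH] p' h' r5; last first.
    by have := IH _ (ccw5_rot h') r5; rewrite !cyc5_rot -!addSn.
  rewrite !add0n /cyc5 !(modn_small (_ : 0 < 5)%N) // !(modn_small (_ : 1 < 5)%N) //.
  rewrite !(modn_small (_ : 4 < 5)%N) // modn_small; last by case/andP: r5.
  case: r r5 => [|[|[|[|[|r]]]]] // _; rewrite ?orient_xyy ?add0r ?orient_xyx ?addr0.
  - by rewrite -orient_rot -orient_rot orient_rot orient_rot -orient_rot; exact: h'.
  - by rewrite addr_gt0 //; [exact: h'|rewrite -orient_rot; exact: h'].
  - by rewrite addr_gt0 //; [exact: h'|rewrite -orient_rot; exact: h'].
  - exact: h'.
have E m : (m < 5)%N -> p m = cyc5 p m by move=> m5; rewrite /cyc5 modn_small.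
have Sj m : (m < 5)%N -> i != m -> 0 < S (p m).
  move=> m5 im; have [r r5 re] := @index_shift 5 i m isT.
  have -> : p m = cyc5 p (i + r) by rewrite /cyc5 re modn_small.
  apply: Spos => //; rewrite r5 andbT; case: r r5 re => // _ re.
  by move: im; rewrite addn0 !modn_small // in re; rewrite re eqxx.
have : S (p i) = 0 by rewrite /S (E i) // orient_xyx orient_xyy addr0.
rewrite {1}xE /S !orient_tri //.
have -> : forall x1 x2 x3 y1 y2 y3 : R, al * x1 + be * x2 + ga * x3 + (al * y1 + be * y2 + ga * y3) =
  al * (x1 + y1) + be * (x2 + y2) + ga * (x3 + y3) by move=> *; ring.
rewrite -!/(S _); have s1 := Sj j j5 ij; have s2 := Sj k k5 ik; have s3 := Sj l l5 il.
move=> S0; have p1 := mulr_ge0 al0 (ltW s1); have p2 := mulr_ge0 be0 (ltW s2).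
have p3 := mulr_ge0 ga0 (ltW s3).
have z1 : al * S (p j) = 0 by lra.
have z2 : be * S (p k) = 0 by lra.
have z3 : ga * S (p l) = 0 by lra.
move/eqP: z1; rewrite mulf_eq0 (gt_eqF s1) orbF => /eqP z1.
move/eqP: z2; rewrite mulf_eq0 (gt_eqF s2) orbF => /eqP z2.
move/eqP: z3; rewrite mulf_eq0 (gt_eqF s3) orbF => /eqP z3.
by move: e; rewrite z1 z2 z3 !addr0 => /eqP; rewrite eq_sym oner_eq0.
Qed.

Lemma verts_uniq P : uniq (verts P).
Proof.
apply/(uniqP (0, 0)) => i j; rewrite !inE => hi hj e; apply: (vertex_inj hi hj).
by rewrite /vertex !modn_small.
Qed.

Lemma congruent_vertices P T : congruent P T ->
  size (verts T) = size (verts P) /\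
  exists s : 'I_(size (verts P)) -> 'I_(size (verts P)), injective s /\
    forall i j, edist (vertex (verts T) (s i)) (vertex (verts T) (s j)) =
      edist (vertex (verts P) i) (vertex (verts P) j).
Proof.
move=> [f [fi _ fv]].
have finj : injective f.
  move=> x y e; apply/eqP; have := fi x y; rewrite e /edist subrr.
  rewrite (_ : enorm 0 = 0); last by apply/eqP; rewrite enorm_eq0.
  by move/esym/eqP; rewrite enorm_eq0 subr_eq0 eq_sym.
have fP x : (x \in map f (verts P)) = (x \in verts T).
  apply/mapP/idP => [[y yP ->]|xT].
    by have : [set` verts T] (f y) by rewrite -fv; exists y.
  by have : [set` verts T] x by []; rewrite -fv => -[y yP <-]; exists y.
have pe : perm_eq (map f (verts P)) (verts T).
  by apply: uniq_perm => //; rewrite ?map_inj_uniq ?verts_uniq.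
have sz : size (verts T) = size (verts P) by rewrite -(perm_size pe) size_map.
have V (i : 'I_(size (verts P))) : vertex (verts P) i \in verts P.
  by rewrite /vertex mem_nth // ltn_mod size_verts_gt0.
have L (i : 'I_(size (verts P))) : (index (f (vertex (verts P) i)) (verts T) < size (verts P))%N.
  by rewrite -[X in (_ < X)%N]sz index_mem -fP map_f.
have W (i : 'I_(size (verts P))) : vertex (verts T) (index (f (vertex (verts P) i)) (verts T)) = f (vertex (verts P) i).
  have xT : f (vertex (verts P) i) \in verts T by rewrite -fP map_f.
  by rewrite -[RHS](nth_index (0, 0) xT) /vertex modn_small // index_mem.
split=> //; exists (fun i => Ordinal (L i)); split => [i j [e]|i j]; last by rewrite /= !W fi.
by apply: val_inj; apply: (vertex_inj (ltn_ord i) (ltn_ord j)); apply: finj; by rewrite -[LHS]W -[RHS]W e.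
Qed.

(** Multiplication by [e] is an involution modulo 5, as [e * e] is 1 modulo 5; it translates between
    both numberings. *)
Lemma pentagon_vertices_turn T e (i : 'I_5) : pentagon T -> e = 1%N \/ e = 4%N ->
  let turn (i : 'I_5) : 'I_5 := inord (e * i %% 5) in
  [/\ pentagon_vertices T e (turn i) = vertex (verts T) i,
    vertex (verts T) (turn i) = pentagon_vertices T e i & turn (turn i) = i].
Proof.
move=> T5 he turn; have s5 : size (verts T) = 5%N by [].
have vt j : turn j = (e * j %% 5)%N :> nat by rewrite /turn inordK // ltn_mod.
have ee : (e * e = 1 %[mod 5])%N by case: he => ->.
split.
- rewrite /pentagon_vertices vt -[LHS]vertex_mod -[RHS]vertex_mod s5.
  by rewrite modnMmr mulnA -modnMml ee modnMml mul1n.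
- by rewrite vt /pentagon_vertices -[RHS]vertex_mod s5.
- by apply: val_inj; rewrite /= !vt modnMmr mulnA -modnMml ee modnMml mul1n modn_small.
Qed.

(** The vertices of [T1] and [T0] correspond through those of [P] with equal mutual distances. By
    [tri_edist] the convex position of [T0] passes to [T1]; the angles agree by two applications of
    [vertex_angle_le], to the correspondence and to its inverse. *)
Lemma congruent_pentagons P T0 T1 e0 : pentagon P -> congruent P T0 -> congruent P T1 ->
  e0 = 1%N \/ e0 = 4%N -> ccw5 (pentagon_vertices T0 e0) ->
  pentagon T1 /\ exists e1 : nat, [/\ e1 = 1%N \/ e1 = 4%N, ccw5 (pentagon_vertices T1 e1) &
    exists2 s : 'I_5 -> 'I_5, injective s & forall m : 'I_5,
      vertex_angle (pentagon_vertices T1 e1) m = vertex_angle (pentagon_vertices T0 e0) (s m)].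
Proof.
move=> P5 c0 c1 he0 h0; have s5 : size (verts P) = 5%N by [].
have [z0 [s0 [i0 d0]]] := congruent_vertices c0.
have [z1 [s1 [i1 d1]]] := congruent_vertices c1.
move: s0 i0 d0 s1 i1 d1; rewrite s5 => s0 i0 d0 s1 i1 d1.
have T05 : pentagon T0 by rewrite /pentagon /nsides z0.
have T15 : pentagon T1 by rewrite /pentagon /nsides z1.
pose w (i : 'I_5) := s0 (invF i1 i).
have wi : injective w by apply: inj_comp => //; exact: (can_inj (f_invF i1)).
have dw i j : edist (vertex (verts T1) (i : 'I_5)) (vertex (verts T1) (j : 'I_5)) =
    edist (vertex (verts T0) (w i)) (vertex (verts T0) (w j)).
  by rewrite d0 -d1 !f_invF.
split=> //.
pose t (i : 'I_5) : 'I_5 := inord (e0 * i %% 5).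
have tt i : t (t i) = i by have [] := pentagon_vertices_turn i T05 he0.
have tE i : pentagon_vertices T0 e0 (t i) = vertex (verts T0) i.
  by have [] := pentagon_vertices_turn i T05 he0.
have nr : ~ reducible T1.
  move=> [i [j [k [l]]]]; rewrite z1 s5 /= => -[ij ik il].
  have V m : vertex (verts T1) m = vertex (verts T1) (inord (m %% 5) : 'I_5).
    by rewrite inordK ?ltn_mod // -vertex_mod z1 s5.
  rewrite (V i) (V j) (V k) (V l).
  pose t' (m : nat) : 'I_5 := t (w (inord (m %% 5))).
  move/tri_edist => /(_ _ _ _ _ (dw _ _) (dw _ _) (dw _ _) (dw _ _) (dw _ _) (dw _ _)).
  have tI m m' : (t' m : nat) = t' m' -> m = m' %[mod 5].
    move=> /val_inj /(can_inj tt) /wi /(congr1 val); rewrite /= !inordK ?ltn_mod //.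
  rewrite -!tE; apply: (ccw5_not_tri h0) => //.
  - by apply: contra ij => /eqP/tI ->.
  - by apply: contra ik => /eqP/tI ->.
  - by apply: contra il => /eqP/tI ->.
have [e1 he1 h1] := convex_pentagon T15 nr.
exists e1; split => //.
pose u (i : 'I_5) : 'I_5 := inord (e1 * i %% 5).
have uu i : u (u i) = i by have [] := pentagon_vertices_turn i T15 he1.
have uE i : vertex (verts T1) (u i) = pentagon_vertices T1 e1 i.
  by have [] := pentagon_vertices_turn i T15 he1.
pose s i := t (w (u i)).
have si : injective s.
  by move=> i j /(can_inj tt) /wi /(can_inj uu).
have ds (i j : 'I_5) : edist (pentagon_vertices T1 e1 i) (pentagon_vertices T1 e1 j) =
    edist (pentagon_vertices T0 e0 (s i)) (pentagon_vertices T0 e0 (s j)).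
  by rewrite /s !tE -dw !uE.
exists s => // m.
pose n (f : 'I_5 -> 'I_5) (k : nat) : nat := f (inord k).
have nE f (k : 'I_5) : n f k = f k by rewrite /n inord_val.
apply/eqP; rewrite eq_le; apply/andP; split.
  rewrite -nE; apply: vertex_angle_le => //; first by move=> *; exact: ltn_ord.
  - by move=> i j hi hj /val_inj /si /(congr1 val); rewrite /= !inordK.
  - move=> i j hi hj; rewrite /n -ds !inordK //.
have := @vertex_angle_le (pentagon_vertices T1 e1) (pentagon_vertices T0 e0) (n (invF si)) (s m) h1 h0.
rewrite nE invF_f; apply => //; first by move=> *; exact: ltn_ord.
- by move=> i j hi hj /val_inj /(can_inj (f_invF si)) /(congr1 val); rewrite /= !inordK.
- by move=> i j hi hj; rewrite ds !f_invF !inordK.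
Qed.

End Congruence.

(** * Non-convex quadrilaterals *)

Section Quadrilaterals.
Context {R : realType}.
Implicit Types (p : nat -> R * R) (P : polygon R).

Lemma edge_vertex P k i : edge (verts P) k (vertex (verts P) i) ->
  (i = k %[mod size (verts P)])%N \/ (i = k.+1 %[mod size (verts P)])%N.
Proof.
move=> [t /= /andP[t0 t1] e]; have [t1'|t1'] := ltP t 1; last first.
  by right; apply: vertex_eq; rewrite -e (_ : t = 1) ?point_at1 //; apply/eqP; rewrite eq_le t1 t1'.
left; have n0 := size_verts_gt0 P.
have /= := @polygon_simple R P (k %% size (verts P))%N (i %% size (verts P))%N t 0.
rewrite !ltn_mod n0 t0 t1' lexx ltr01 point_at0 !vertex_mod => /(_ isT isT isT isT).
have -> : vertex (verts P) (k %% size (verts P)).+1 = vertex (verts P) k.+1.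
  by rewrite -[LHS]vertex_mod -[RHS]vertex_mod -addn1 modnDml addn1.
by move=> /(_ e) [].
Qed.

Lemma orient_addZ (a b x u w : R * R) (t : R) :
  orient a b (x + t *: (u - w)) = orient a b x + t * (orient a b u - orient a b w).
Proof. by vsimp; ring. Qed.

Lemma interior_orient_gt0 (A : set (R * R)) a b c x :
  (forall y, A y -> 0 <= orient a b y) -> 0 < orient a b c -> interior A x -> 0 < orient a b x.
Proof.
move=> h c0 /(interior_perturb (a - c))[e e0 /h]; rewrite orient_addZ orient_xyx => le.
by apply: lt_le_trans (_ : e * orient a b c <= _); [exact: mulr_gt0|lra].
Qed.

Lemma mulr_gt0_trans (x y z : R) : 0 < x * y -> 0 < y * z -> 0 < x * z.
Proof.
move=> xy yz; have := mulr_gt0 xy yz.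
rewrite (_ : x * y * (y * z) = y ^+ 2 * (x * z)); last by ring.
by rewrite pmulr_rgt0 // exprn_even_gt0 //=; apply: contraTneq xy => ->; rewrite mulr0 ltxx.
Qed.

(** By contraposition: in an irreducible quadrilateral every edge line leaves the other vertices on
    one side, so the region is an intersection of half-planes. *)
Lemma nonconvex_reducible P : quadrilateral P -> nonconvex P -> reducible P.
Proof.
move=> P4 nc; apply: contrapT => nr; apply: nc; have s4 : size (verts P) = 4%N by [].
have V m : vertex (verts P) m = nth (0, 0) (verts P) (m %% 4)%N by rewrite /vertex s4.
set q := nth (0, 0) (verts P) in V.
have S k := @same_side _ P k 2 3 nr erefl isT.
have S0 : 0 < orient (q 0%N) (q 1%N) (q 2%N) * orient (q 0%N) (q 1%N) (q 3%N).
  by have := S 0%N; rewrite s4 !V; exact.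
have S1 : 0 < orient (q 1%N) (q 2%N) (q 3%N) * orient (q 1%N) (q 2%N) (q 0%N).
  by have := S 1%N; rewrite s4 !V; exact.
have S2 : 0 < orient (q 2%N) (q 3%N) (q 0%N) * orient (q 2%N) (q 3%N) (q 1%N).
  by have := S 2%N; rewrite s4 !V; exact.
have S3 : 0 < orient (q 3%N) (q 0%N) (q 1%N) * orient (q 3%N) (q 0%N) (q 2%N).
  by have := S 3%N; rewrite s4 !V; exact.
have e1 : orient (q 3%N) (q 0%N) (q 1%N) = orient (q 0%N) (q 1%N) (q 3%N) by rewrite -orient_rot.
have e2 : orient (q 2%N) (q 3%N) (q 0%N) = orient (q 0%N) (q 2%N) (q 3%N) by rewrite orient_rot.
have e3 : orient (q 2%N) (q 3%N) (q 1%N) = orient (q 1%N) (q 2%N) (q 3%N) by rewrite orient_rot.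
have e4 : orient (q 3%N) (q 0%N) (q 2%N) = orient (q 0%N) (q 2%N) (q 3%N) by rewrite -orient_rot.
have e5 : orient (q 1%N) (q 2%N) (q 0%N) = orient (q 0%N) (q 1%N) (q 2%N) by rewrite orient_rot.
rewrite e2 e3 in S2; rewrite e5 in S1; rewrite e1 e4 in S3.
(* Multiplying by [orient (q 0) (q 1) (q 2)] treats both directions of listing the vertices
   together. *)
have T k j : (k < 4)%N -> 0 <= orient (vertex (verts P) k) (vertex (verts P) k.+1)
    (vertex (verts P) j) * orient (q 0%N) (q 1%N) (q 2%N).
  move=> k4; rewrite (V j); have : (j %% 4 < 4)%N by rewrite ltn_mod.
  move: (j %% 4)%N => {}j j4; rewrite !V.
  have S4 : 0 < orient (q 0%N) (q 2%N) (q 3%N) * orient (q 0%N) (q 1%N) (q 2%N).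
    by rewrite mulrC; exact: mulr_gt0_trans S0 S3.
  have z0 : 0 <= 0 * orient (q 0%N) (q 1%N) (q 2%N) by rewrite mul0r.
  rewrite mulrC in S0.
  case: k k4 => [|[|[|[|k]]]] // _; case: j j4 => [|[|[|[|j]]]] // _;
    rewrite -?[(0 %% 4)%N]/0%N -?[(1 %% 4)%N]/1%N -?[(2 %% 4)%N]/2%N -?[(3 %% 4)%N]/3%N
      -?[(4 %% 4)%N]/0%N ?orient_xyx ?orient_xyy ?e1 ?e2 ?e3 ?e4 ?e5 -?expr2 ?sqr_ge0 //;
    exact: ltW.
have ne : orient (q 0%N) (q 1%N) (q 2%N) != 0.
  by apply: contraTneq S0 => ->; rewrite mul0r ltxx.
have [a [b [nab hv hp]]] : exists a b : nat -> R * R, [/\ forall k, (k < 4)%N -> a k != b k,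
    forall k j, (k < 4)%N -> 0 <= orient (a k) (b k) (vertex (verts P) j) &
    forall x, polyline P x -> exists2 k, (k < 4)%N & orient (a k) (b k) x = 0].
  have pl (x : R * R) : polyline P x -> exists2 k, (k < 4)%N &
      orient (vertex (verts P) k) (vertex (verts P) k.+1) x = 0.
    move=> [k /= kn [t _ <-]]; exists k; first by rewrite -s4.
    by rewrite orient_point_at orient_xyx orient_xyy !mulr0 addr0.
  have sw (a b c : R * R) : orient b a c = - orient a b c by vsimp; ring.
  have [neg|pos] := ltP (orient (q 0%N) (q 1%N) (q 2%N)) 0.
    exists (fun k => vertex (verts P) k.+1), (vertex (verts P)); split.
    - by move=> k _; rewrite eq_sym; exact: vertex_neqS.
    - by move=> k j k4; rewrite sw oppr_ge0 -(nmulr_lge0 _ neg); exact: T.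
    - by move=> x /pl[k k4 h]; exists k; rewrite // sw h oppr0.
  have {}pos : 0 < orient (q 0%N) (q 1%N) (q 2%N) by rewrite lt_neqAle eq_sym ne.
  exists (vertex (verts P)), (fun k => vertex (verts P) k.+1); split => //.
  - by move=> k _; exact: vertex_neqS.
  - by move=> k j k4; rewrite -(pmulr_lge0 _ pos); exact: T.
have [R1 _ R3] := halfplanes_region nab hv hp.
apply/convex_setW => x y; rewrite !inE => Px Py t t0 t1; rewrite inE; apply: R3 => k k4.
rewrite (_ : conv t x y = point_at y x t%:num); last by rewrite /point_at addrC.
by rewrite orient_point_at addr_ge0 // mulr_ge0 ?R1 ?subr_ge0 // ltW.
Qed.

(** Vertex 0 is strictly inside the counterclockwise triangle of the others: it is the reflex
    vertex. *)
Definition dart p : Prop := [/\ 0 < orient (p 1%N) (p 2%N) (p 0%N),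
  0 < orient (p 2%N) (p 3%N) (p 0%N) & 0 < orient (p 3%N) (p 1%N) (p 0%N)].

(** Numbering that starts at vertex [i], backwards when [e] is 3, which is -1 modulo 4. *)
Definition quad_vertices P (i e k : nat) : R * R := vertex (verts P) (i + e * k).

Lemma tri_side a b c x : tri a b c x -> orient a b x = 0 -> orient a b c != 0 ->
  exists2 t : R, 0 <= t <= 1 & point_at a b t = x.
Proof.
move=> [al [be [ga [al0 be0 ga0 e ->]]]]; rewrite orient_tri // orient_xyx orient_xyy !mulr0 !add0r.
move=> /eqP; rewrite mulf_eq0 => /orP[/eqP g0|/eqP->]; last by rewrite eqxx.
move=> _; exists be; first by rewrite be0 -e g0; lra.
by rewrite /point_at g0 scale0r addr0 -e g0; congr (_ *: _ + _); ring.
Qed.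

Lemma tri_convex a b c x y (t : R) : tri a b c x -> tri a b c y -> 0 <= t <= 1 ->
  tri a b c (point_at x y t).
Proof.
move=> [u [v [w [u0 v0 w0 e ->]]]] [u' [v' [w' [u0' v0' w0' e' ->]]]] /andP[t0 t1].
have t2 : 0 <= 1 - t by rewrite subr_ge0.
exists ((1 - t) * u + t * u'), ((1 - t) * v + t * v'), ((1 - t) * w + t * w'); split.
- by apply: addr_ge0; exact: mulr_ge0.
- by apply: addr_ge0; exact: mulr_ge0.
- by apply: addr_ge0; exact: mulr_ge0.
- rewrite (_ : _ + _ + _ = (1 - t) * (u + v + w) + t * (u' + v' + w')); last by ring.
  by rewrite e e'; ring.
- by vring.
Qed.

Lemma orient_gt0_tri a b c (x : R * R) : 0 < orient a b x -> 0 < orient b c x -> 0 < orient c a x ->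
  tri a b c x.
Proof.
move=> ab bc ca; set o := orient b c x + orient c a x + orient a b x.
have o0 : 0 < o by apply: addr_gt0 => //; exact: addr_gt0.
have o1 : o != 0 by rewrite gt_eqF.
exists (orient b c x / o), (orient c a x / o), (orient a b x / o).
split; rewrite ?divr_ge0 ?(ltW o0) ?(ltW ab) ?(ltW bc) ?(ltW ca) //.
  by rewrite -!mulrDl divff.
have e1 : x.1 * o = orient b c x * a.1 + orient c a x * b.1 + orient a b x * c.1.
  by rewrite /o; vsimp; ring.
have e2 : x.2 * o = orient b c x * a.2 + orient c a x * b.2 + orient a b x * c.2.
  by rewrite /o; vsimp; ring.
apply: pair_ext => /=; rewrite /GRing.scale /=.
  by rewrite -(mulfK o1 x.1) e1; ring.
by rewrite -(mulfK o1 x.2) e2; ring.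
Qed.

(** Reducibility puts one vertex in the closed triangle of the others. Strictness on the three sides
    has three different sources, given below, and a clockwise triangle is repaired by the choice
    [e = 3]. *)
Lemma nonconvex_dart P : quadrilateral P -> nonconvex P -> unit_area P ->
  exists i e : nat, (e = 1%N \/ e = 3%N) /\ dart (quad_vertices P i e).
Proof.
move=> P4 nc aP; have s4 : size (verts P) = 4%N by [].
have [i [j [k [l [/= ij ik il T]]]]] := nonconvex_reducible P4 nc.
move: ij ik il; rewrite s4 => ij ik il.
pose w m := vertex (verts P) (i + m).
have cT := @tri_convex (w 1%N) (w 2%N) (w 3%N).
have tw m : (i != m %[mod 4])%N -> tri (w 1%N) (w 2%N) (w 3%N) (vertex (verts P) m).
  have [r r4 e] := @index_shift 4 i m isT; rewrite -e => im.
  have -> : vertex (verts P) m = w r by rewrite /w -[LHS]vertex_mod -[RHS]vertex_mod s4 e.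
  case: r r4 e im => [|[|[|[|r]]]] // _ _.
  - by rewrite addn0 eqxx.
  - by exists 1, 0, 0; split => //; rewrite ?ler01 ?addr0 // scale1r !scale0r !addr0.
  - by exists 0, 1, 0; split => //; rewrite ?ler01 ?addr0 ?add0r // scale1r !scale0r addr0 add0r.
  - by exists 0, 0, 1; split => //; rewrite ?ler01 ?addr0 ?add0r // scale1r !scale0r !add0r.
have {}T : tri (w 1%N) (w 2%N) (w 3%N) (w 0%N).
  rewrite (_ : w 0%N = vertex (verts P) i); last by rewrite /w addn0.
  apply: (convex_tri cT (tw _ ij) (tw _ ik) (tw _ il)) => //.
have rT : region P `<=` tri (w 1%N) (w 2%N) (w 3%N).
  apply: (region_sub_convex cT) => m; have [im|] := eqVneq (i %% 4)%N (m %% 4)%N; last exact: tw.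
  by rewrite -vertex_mod s4 -im -s4 vertex_mod (_ : vertex _ i = w 0%N) // /w addn0.
(* A flat triangle has area 0, but this one contains a region of area 1. *)
have ne : orient (w 1%N) (w 2%N) (w 3%N) != 0.
  apply/negP => /eqP o; have [V [mV sV]] := tri_area (w 1%N) (w 2%N) (w 3%N).
  rewrite o normr0 mul0r => aV.
  have := area_le (region_measurable P) mV (subset_trans rT sV).
  rewrite /area aP => /le_trans/(_ aV); rewrite lee_fin ler10.
  by [].
have W m n : (i + m = i + n %[mod 4])%N -> (m < 4)%N -> (n < 4)%N -> m = n.
  by move=> /eqP h hm hn; move: h; rewrite eqn_modDl !modn_small // => /eqP.
(* This side of the triangle is an edge of the polygon, so [w 0] on it would contradict simplicity;
   likewise for the next side. *)
have n12 : orient (w 1%N) (w 2%N) (w 0%N) != 0.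
  apply/eqP => o; have [t t01 e] := tri_side T o ne.
  have : edge (verts P) (i + 1) (vertex (verts P) (i + 0)) by exists t; rewrite // -addnS.
  by case/edge_vertex; rewrite -?addnS s4 => h; have := W _ _ h isT isT.
have n23 : orient (w 2%N) (w 3%N) (w 0%N) != 0.
  apply/eqP => o; have T' := tri_swap23 (tri_swap12 T).
  have ne' : orient (w 2%N) (w 3%N) (w 1%N) != 0 by rewrite orient_rot.
  have [t t01 e] := tri_side T' o ne'.
  have : edge (verts P) (i + 2) (vertex (verts P) (i + 0)) by exists t; rewrite // -addnS.
  by case/edge_vertex; rewrite -?addnS s4 => h; have := W _ _ h isT isT.
(* The third side joins the neighbours of [w 0]; the vertex on it would be a straight corner. *)
have n31 : orient (w 3%N) (w 1%N) (w 0%N) != 0.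
  have := polygon_corners P (i + 3).
  rewrite -!addnS.
  have -> : vertex (verts P) (i + 4) = w 0%N by rewrite -s4 vertexD /w addn0.
  have -> : vertex (verts P) (i + 5) = w 1%N.
    by rewrite (_ : (i + 5 = i + 1 + 4)%N); [rewrite -[X in (_ + X)%N]s4 vertexD|lia].
  by apply: contra => /eqP o; apply/eqP; rewrite -[RHS]oppr0 -o -/(w 3%N); vsimp; ring.
case: T => [al [be [ga [al0 be0 ga0 e wE]]]].
have o12 : orient (w 1%N) (w 2%N) (w 0%N) = ga * orient (w 1%N) (w 2%N) (w 3%N).
  by rewrite wE orient_tri // orient_xyx orient_xyy !mulr0 !add0r.
have o23 : orient (w 2%N) (w 3%N) (w 0%N) = al * orient (w 1%N) (w 2%N) (w 3%N).
  by rewrite wE orient_tri // orient_xyx orient_xyy !mulr0 !addr0 orient_rot.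
have o31 : orient (w 3%N) (w 1%N) (w 0%N) = be * orient (w 1%N) (w 2%N) (w 3%N).
  by rewrite wE orient_tri // orient_xyx orient_xyy !mulr0 !addr0 add0r -orient_rot.
have pos (x y : R) : 0 <= x -> x * y != 0 -> 0 < x.
  by rewrite le_eqVlt => /predU1P[<-|//]; rewrite mul0r eqxx.
rewrite o12 in n12; rewrite o23 in n23; rewrite o31 in n31.
have {}al0 := pos _ _ al0 n23; have {}be0 := pos _ _ be0 n31; have {}ga0 := pos _ _ ga0 n12.
have [neg|] := ltP (orient (w 1%N) (w 2%N) (w 3%N)) 0; last first.
  rewrite le_eqVlt eq_sym (negPf ne) /= => p; exists i, 1%N; split; first by left.
  by rewrite /dart /quad_vertices !mul1n -!/(w _) o12 o23 o31; split; exact: mulr_gt0.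
exists i, 3%N; split; first by right.
rewrite /dart /quad_vertices !muln0 -!/(w _).
have w4 m : w (m + 4)%N = w m by rewrite /w addnA -s4 vertexD.
have [w6 w9] : w (3 * 2)%N = w 2%N /\ w (3 * 3)%N = w 1%N.
  by split; [exact: (w4 2%N)|rewrite -(w4 1%N) -(w4 (1 + 4)%N)].
rewrite muln1 w6 w9.
have sw (a b c : R * R) : orient b a c = - orient a b c by vsimp; ring.
rewrite !(sw (w 2%N) (w 3%N)) !(sw (w 1%N)) (sw (w 3%N) (w 1%N)).
by rewrite o12 o23 o31 !oppr_gt0; split; rewrite pmulr_rlt0.
Qed.

Section Dart.
Context (P : polygon R) (i e : nat) (P4 : quadrilateral P) (e13 : e = 1%N \/ e = 3%N).
Let p := quad_vertices P i e.
Context (dart_p : dart p).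

Let s4 : size (verts P) = 4%N. Proof. exact: P4. Qed.

Let V m : vertex (verts P) m = vertex (verts P) (m %% 4).
Proof. by rewrite -s4 vertex_mod. Qed.

Lemma quad_vertices_mod k : p (k %% 4)%N = p k.
Proof. by rewrite /p /quad_vertices V [RHS]V -modnDmr modnMmr modnDmr. Qed.

Lemma quad_index j : exists2 k, (k < 4)%N & (i + e * k = j %[mod 4])%N.
Proof.
have [r r4 rE] := @index_shift 4 i j isT; exists ((e * r) %% 4)%N; first by rewrite ltn_mod.
rewrite -modnDmr modnMmr modnDmr -rE mulnA -(modnDmr i (e * e * r)).
rewrite -(modnMml (e * e)) (_ : (e * e) %% 4 = 1)%N ?mul1n ?modnDmr //.
by case: e13 => ->.
Qed.

Lemma quad_vertices_onto j : exists2 k, (k < 4)%N & vertex (verts P) j = p k.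
Proof.
by have [k k4 kE] := quad_index j; exists k; rewrite // /p /quad_vertices [RHS]V kE -V.
Qed.

Lemma polyline_quad x : polyline P x -> exists k (t : R),
  [/\ (k < 4)%N, 0 <= t <= 1 & x = point_at (p k) (p k.+1) t].
Proof.
move=> [j /= jn [t t01 <-]].
have vE k l : (i + e * k = l %[mod 4])%N -> vertex (verts P) l = p k.
  by move=> h; rewrite /p /quad_vertices [RHS]V h -V.
case: e13 => eE.
  have [k k4 kE] := quad_index j; exists k, t; split => //.
  rewrite (vE k j) // (vE k.+1 j.+1) //.
  by move: kE; rewrite eE; clear; lia.
have [k k4 kE] := quad_index j.+1; exists k, (1 - t).
have /andP[t0 t1] := t01; split; [by []|by rewrite subr_ge0 t1 gerBl|].
rewrite (vE k j.+1) // (vE k.+1 j); first by rewrite /point_at subKr addrC.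
by move: kE; rewrite eE; clear; lia.
Qed.

(** The triangle of the three other vertices contains the region, and its perimeter is no larger, as
    one of its sides replaces the two sides at the reflex vertex. With twice its area at least 2,
    the bound is 108 * 2^2. *)
Lemma dart_perimeter : unit_area P -> 432 <= perimeter P ^+ 4.
Proof.
move=> aP.
have pE : perimeter P = edist (p 0) (p 1%N) + edist (p 1%N) (p 2%N) + edist (p 2%N) (p 3%N) + edist (p 3%N) (p 0).
  rewrite (perimeter_shift P i) /nsides s4 !big_ord_recr big_ord0 /= add0r /side_length -!addnS.
  have -> : vertex (verts P) (i + 4) = vertex (verts P) (i + 0) by rewrite addn0 -[in LHS]s4 vertexD.
  rewrite /p /quad_vertices; case: e13 => ->; first by rewrite !mul1n.
  rewrite muln0 muln1 (_ : vertex _ (i + 3 * 2) = vertex (verts P) (i + 2)); last first.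
    by rewrite V [RHS]V -modnDmr -[in RHS]modnDmr.
  rewrite (_ : vertex _ (i + 3 * 3) = vertex (verts P) (i + 1)); last first.
    by rewrite V [RHS]V -modnDmr -[in RHS]modnDmr.
  rewrite (edistC (vertex (verts P) (i + 1)) (vertex (verts P) (i + 0))).
  rewrite (edistC (vertex (verts P) (i + 0)) (vertex (verts P) (i + 3))).
  rewrite (edistC (vertex (verts P) (i + 3)) (vertex (verts P) (i + 2))).
  rewrite (edistC (vertex (verts P) (i + 2)) (vertex (verts P) (i + 1))).
  by ring.
case: dart_p => o120 o230 o310.
set o := orient (p 1%N) (p 2%N) (p 3%N).
have oE : o = orient (p 1%N) (p 2%N) (p 0%N) +
    orient (p 2%N) (p 3%N) (p 0%N) + orient (p 3%N) (p 1%N) (p 0%N) by rewrite /o; vsimp; ring.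
have o0 : 0 < o by rewrite oE; apply: addr_gt0 => //; exact: addr_gt0.
have t0 : tri (p 1%N) (p 2%N) (p 3%N) (p 0) by exact: orient_gt0_tri.
have rT : region P `<=` tri (p 1%N) (p 2%N) (p 3%N).
  apply: (region_sub_convex (@tri_convex _ _ _)) => j; have [k k4 ->] := quad_vertices_onto j.
  case: k k4 => [|[|[|[|k]]]] // _.
  - by exists 1, 0, 0; split => //; rewrite ?ler01 ?addr0 // scale1r !scale0r !addr0.
  - by exists 0, 1, 0; split => //; rewrite ?ler01 ?addr0 ?add0r // scale1r !scale0r addr0 add0r.
  - by exists 0, 0, 1; split => //; rewrite ?ler01 ?addr0 ?add0r // scale1r !scale0r !add0r.
have [W [mW sW aW]] := tri_area (p 1%N) (p 2%N) (p 3%N).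
have := area_le (region_measurable P) mW (subset_trans rT sW).
rewrite /area aP => /le_trans/(_ aW); rewrite lee_fin (gtr0_norm o0) ler_pdivlMr // mul1r => o2.
have h := triangle_isoperimetric (p 1%N) (p 2%N) (p 3%N).
apply: le_trans (le_trans _ h) _.
  rewrite (_ : 432 = 108 * 2 ^+ 2); last by rewrite expr2; ring.
  by rewrite ler_pM2l // ler_sqr // nnegrE ltW.
rewrite ler_pXn2r // ?nnegrE.
- rewrite pE; have := edist_triangle (p 3%N) (p 0) (p 1%N); lra.
- by rewrite !addr_ge0 // enorm_ge0.
- by rewrite pE !addr_ge0 // enorm_ge0.
Qed.

(** A dart is the intersection of two half-planes with the union of the two half-planes at the
    reflex vertex; the second statement uses that this set is star-shaped. *)
Lemma region_dart :
  (forall x, region P x -> [/\ 0 <= orient (p 1%N) (p 2%N) x, 0 <= orient (p 2%N) (p 3%N) x &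
     0 <= orient (p 3%N) (p 0%N) x \/ 0 <= orient (p 0%N) (p 1%N) x]) /\
  (forall x, 0 < orient (p 1%N) (p 2%N) x -> 0 < orient (p 2%N) (p 3%N) x ->
     0 < orient (p 3%N) (p 0%N) x \/ 0 < orient (p 0%N) (p 1%N) x -> interior (region P) x).
Proof.
case: dart_p => o120 o230 o310.
have o123 : 0 < orient (p 1%N) (p 2%N) (p 3%N).
  have -> : orient (p 1%N) (p 2%N) (p 3%N) = orient (p 1%N) (p 2%N) (p 0%N) +
      orient (p 2%N) (p 3%N) (p 0%N) + orient (p 3%N) (p 1%N) (p 0%N) by vsimp; ring.
  by apply: addr_gt0 => //; exact: addr_gt0.
have o301 : orient (p 3%N) (p 0%N) (p 1%N) = - orient (p 3%N) (p 1%N) (p 0%N) by exact: orient_swap.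
have o013 : orient (p 0%N) (p 1%N) (p 3%N) = - orient (p 3%N) (p 1%N) (p 0%N).
  by rewrite -o301 orient_rot.
have o302 : orient (p 3%N) (p 0%N) (p 2%N) = orient (p 2%N) (p 3%N) (p 0%N) by rewrite orient_rot.
have o012 : orient (p 0%N) (p 1%N) (p 2%N) = orient (p 1%N) (p 2%N) (p 0%N) by rewrite -orient_rot.
have zero k (t : R) : orient (p k) (p k.+1) (point_at (p k) (p k.+1) t) = 0.
  by rewrite orient_point_at orient_xyx orient_xyy !mulr0 addr0.
have F1 x : region P x -> 0 <= orient (p 1%N) (p 2%N) x.
  apply: region_orient => j; have [k k4 ->] := quad_vertices_onto j.
  by case: k k4 => [|[|[|[|k]]]] // _; rewrite ?orient_xyx ?orient_xyy // ltW.
have F2 x : region P x -> 0 <= orient (p 2%N) (p 3%N) x.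
  apply: region_orient => j; have [k k4 ->] := quad_vertices_onto j.
  by case: k k4 => [|[|[|[|k]]]] // _; rewrite ?orient_xyx ?orient_xyy ?(orient_rot (p 1%N)) // ltW.
have p40 : p 4%N = p 0%N by rewrite -[RHS]quad_vertices_mod -quad_vertices_mod.
(* Suppose that [x] is strictly outside both sides at [p 0]. The ray from [x] away from [p 0] stays
   outside both, but every point of the boundary is on the inner side of one of them. *)
have F3 x : region P x -> 0 <= orient (p 3%N) (p 0%N) x \/ 0 <= orient (p 0%N) (p 1%N) x.
  move=> Px; have [|l3] := leP 0 (orient (p 3%N) (p 0%N) x); first by left.
  have [|l0] := leP 0 (orient (p 0%N) (p 1%N) x); first by right.
  have xD : x - p 0%N != 0.
    by apply/eqP => h; move: l0; rewrite (_ : x = p 0%N) ?orient_xyx ?ltxx //; apply/eqP; rewrite -subr_eq0 h.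
  have [s s0 /polyline_quad[k [t [k4 /andP[t0 t1] E]]]] := region_ray Px xD.
  have s1 : 0 < 1 + s by lra.
  have n3 : orient (p 3%N) (p 0%N) (x + s *: (x - p 0%N)) < 0.
    rewrite orient_addZ orient_xyy subr0 (_ : _ + _ = (1 + s) * orient (p 3%N) (p 0%N) x); last by ring.
    by rewrite pmulr_rlt0.
  have n0 : orient (p 0%N) (p 1%N) (x + s *: (x - p 0%N)) < 0.
    rewrite orient_addZ orient_xyx subr0 (_ : _ + _ = (1 + s) * orient (p 0%N) (p 1%N) x); last by ring.
    by rewrite pmulr_rlt0.
  exfalso; move: n3 n0; rewrite E; case: k k4 {E} => [|[|[|[|k]]]] // _.
  - by rewrite (zero 0%N) ltxx.
  - by move=> _; rewrite orient_point_at orient_xyy mulr0 add0r o012 ltNge mulr_ge0 // ltW.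
  - have t2 : 0 <= 1 - t by rewrite subr_ge0.
    by rewrite orient_point_at orient_xyx mulr0 addr0 o302 ltNge mulr_ge0 // ltW.
  - by rewrite -p40 (zero 3%N) ltxx.
split; first by move=> x Px; split; [exact: F1|exact: F2|exact: F3].
pose U := [set x | [/\ 0 < orient (p 1%N) (p 2%N) x, 0 < orient (p 2%N) (p 3%N) x &
  0 < orient (p 3%N) (p 0%N) x \/ 0 < orient (p 0%N) (p 1%N) x]].
have [z zP] := region_interior_nonempty P.
have Uz : U z.
  split; first exact: interior_orient_gt0 F1 o123 zP.
    exact: interior_orient_gt0 F2 o230 zP.
  have [|l3] := ltP 0 (orient (p 3%N) (p 0%N) z); first by left.
  have [|l0] := ltP 0 (orient (p 0%N) (p 1%N) z); first by right.
  (* The direction from [p 2] to [p 0] decreases both forms at the reflex vertex, so an interior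
     point where both are at most 0 could be moved against [F3]. *)
  have [t t0 /F3] := interior_perturb (p 0%N - p 2%N) zP.
  rewrite !orient_addZ orient_xyy orient_xyx o302 o012.
  have := mulr_gt0 t0 o230; have := mulr_gt0 t0 o120; move=> h1 h2 [?|?]; exfalso; lra.
(* Centre of the star: the midpoint of the inner diagonal, where all four forms are positive. *)
pose M := point_at (p 2%N) (p 0%N) (1 / 2).
have M1 : 0 < orient (p 1%N) (p 2%N) M by rewrite orient_point_at orient_xyy; lra.
have M2 : 0 < orient (p 2%N) (p 3%N) M by rewrite orient_point_at orient_xyx; lra.
have M3 : 0 < orient (p 3%N) (p 0%N) M by rewrite orient_point_at orient_xyy o302; lra.
have M0 : 0 < orient (p 0%N) (p 1%N) M by rewrite orient_point_at orient_xyx o012; lra.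
move: M M1 M2 M3 M0 => M M1 M2 M3 M0.
have cvx (a b : R) (t : R) : 0 < a -> 0 < b -> 0 <= t <= 1 -> 0 < (1 - t) * a + t * b.
  move=> a0 b0 /andP[t0 t1]; have [t0'|t0'] := ltP 0 t.
    by apply: ltr_wpDl; [rewrite mulr_ge0 ?subr_ge0 // ltW|exact: mulr_gt0].
  by rewrite (_ : t = 0) ?subr0 ?mul1r ?mul0r ?addr0 //; apply/eqP; rewrite eq_le t0 t0'.
have sub : U `<=` interior (region P).
  apply: (@star_sub_region _ P U M z) => //; last by apply: interior_subset.
    move=> x t [x1 x2 x3] t01; split; rewrite !orient_point_at; try exact: cvx.
    by case: x3 => h; [left|right]; exact: cvx.
  move=> x [x1 x2 x3] /polyline_quad[k [t [k4 /andP[t0 t1] E]]].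
  move: x1 x2 x3; rewrite E; case: k k4 {E} => [|[|[|[|k]]]] // _.
  - move=> _ _; rewrite (zero 0%N) ltxx orient_point_at orient_xyy mulr0 add0r o301 => -[|//].
    by rewrite mulrN oppr_gt0 ltNge mulr_ge0 // ltW.
  - by rewrite (zero 1%N) ltxx.
  - by rewrite (zero 2%N) ltxx.
  - move=> _ _; rewrite -{1}p40 (zero 3%N) ltxx => -[//|].
    rewrite p40 orient_point_at orient_xyx mulr0 addr0 o013 mulrN oppr_gt0 ltNge.
    have t2 : 0 <= 1 - t by rewrite subr_ge0.
    by rewrite mulr_ge0 // ltW.
by move=> x x1 x2 x3; apply: sub.
Qed.

End Dart.

End Quadrilaterals.

(** * Angles around a vertex of the tiling *)

Section Directions.
Context {R : realType}.
Implicit Types (u v w : R * R) (A : set (R * R)) (psi phi t : R).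

Definition dir psi : R * R := (cos psi, sin psi).

Definition circle : set R := [set psi | 0 <= psi < 2 * pi].

Lemma polar u : u != 0 -> exists2 phi, circle phi & u = enorm u *: dir phi.
Proof.
move=> u0; have e0 : enorm u != 0 by rewrite enorm_eq0.
have eu : 0 < enorm u by rewrite enorm_gt0.
have S : (u.1 / enorm u) ^+ 2 + (u.2 / enorm u) ^+ 2 = 1.
  rewrite !expr_div_n -mulrDl !expr2 -/(dot u u) -enormK divff //.
  by rewrite mulf_neq0.
have c1 : -1 <= u.1 / enorm u <= 1.
  have := sqr_ge0 (u.2 / enorm u); move: S; set c := u.1 / _; set s := _ ^+ 2 => S s0.
  by rewrite -ler_norml -(@ler_pXn2r _ 2) ?nnegrE // expr1n real_normK ?num_real // -S lerDl.
pose phi := acos (u.1 / enorm u).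
have cphi : cos phi = u.1 / enorm u by rewrite acosK // in_itv.
have sphi : sin phi ^+ 2 = (u.2 / enorm u) ^+ 2 by rewrite sin2cos2 cphi -S addrC addKr.
have phi0 : 0 <= phi by exact: acos_ge0.
have phip : phi <= pi by exact: acos_lepi.
have sphi0 : 0 <= sin phi by apply: sin_ge0_pi; rewrite phi0.
have pp := pi_gt0 R.
have [u2|u2] := leP 0 u.2.
  exists phi; first by rewrite /circle /= phi0; lra.
  have sE : sin phi = u.2 / enorm u.
    by apply/eqP; rewrite -(eqrXn2 (n := 2)) ?divr_ge0 ?(ltW eu) //; apply/eqP.
  by apply: pair_ext; rewrite /= /GRing.scale /= ?cphi ?sE mulrC divfK.
have phi1 : 0 < phi.
  rewrite lt_neqAle phi0 andbT; apply/eqP => h; move: sphi; rewrite -h sin0 expr0n /=.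
  move/esym/eqP; rewrite sqrf_eq0 mulf_eq0 invr_eq0 (negPf e0) orbF => /eqP h2.
  by rewrite h2 ltxx in u2.
exists (2 * pi - phi); first by rewrite /circle /=; lra.
have sE : sin phi = - (u.2 / enorm u).
  apply/eqP; rewrite -(eqrXn2 (n := 2)) //; first by rewrite sqrrN; apply/eqP.
  by rewrite oppr_ge0 ltW // nmulr_rlt0 // invr_gt0.
have c2 : cos (2 * pi - phi) = cos phi.
  by rewrite cosB mulr_natl cos2pi sin2pi mul1r mul0r addr0.
have s2 : sin (2 * pi - phi) = - sin phi.
  by rewrite sinB mulr_natl cos2pi sin2pi mul1r mul0r sub0r.
by apply: pair_ext; rewrite /= /GRing.scale /= ?c2 ?s2 ?cphi ?sE ?opprK mulrC divfK.
Qed.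

Lemma cross_dir u phi psi : u = enorm u *: dir phi ->
  cross u (dir psi) = enorm u * sin (psi - phi).
Proof. by move=> {1}->; rewrite sinB; vsimp; ring. Qed.

Lemma dir_cross u w phi psi : u != 0 -> u = enorm u *: dir phi -> 0 < cross u w ->
  cross (dir psi) w = enorm w * sin (ang u w - (psi - phi)).
Proof.
move=> u0 uE c; have w0 := cross_neq0r (lt0r_neq0 c).
have e0 : enorm u != 0 by rewrite enorm_eq0.
have dE := ang_cos u0 w0; have sE := ang_sin u0 w0; rewrite gtr0_norm // in sE.
apply: (mulfI (mulf_neq0 e0 e0)); rewrite [in LHS]enormK.
have -> : dot u u * cross (dir psi) w =
    dot u w * cross (dir psi) u + cross u w * dot (dir psi) u by vsimp; ring.
rewrite dE sE (crossC (dir psi)) (cross_dir psi uE).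
have -> : dot (dir psi) u = enorm u * cos (psi - phi).
  by rewrite {1}uE cosB; vsimp; ring.
by rewrite (sinB (ang u w)); ring.
Qed.

Lemma sin_lt0_pi (x : R) : pi < x < 2 * pi -> sin x < 0.
Proof.
move=> h; rewrite -(subrK pi x) sinDpi oppr_lt0; apply: sin_gt0_pi; lra.
Qed.

Lemma sin_per (x : R) : sin (x + 2 * pi) = sin x.
Proof. by rewrite mulr_natl sinD2pi. Qed.

Lemma sin_eq0_circle (x : R) : - (2 * pi) < x < 2 * pi -> sin x = 0 ->
  x = - pi \/ x = 0 \/ x = pi.
Proof.
have pp := pi_gt0 R.
move=> /andP[x1 x2] s.
have [h|h|->] := ltgtP x 0; last by right; left.
  have [h'|h'|->] := ltgtP x (- pi); last by left.
    have : 0 < sin (x + 2 * pi) by apply: sin_gt0_pi; lra.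
    by rewrite sin_per s ltxx.
  have : sin (x + 2 * pi) < 0 by apply: sin_lt0_pi; lra.
  by rewrite sin_per s ltxx.
have [h'|h'|->] := ltgtP x pi; last by right; right.
  have : 0 < sin x by apply: sin_gt0_pi; lra.
  by rewrite s ltxx.
have : sin x < 0 by apply: sin_lt0_pi; lra.
by rewrite s ltxx.
Qed.

Lemma cross_dir_finite u : u != 0 ->
  finite_set [set psi | circle psi /\ cross u (dir psi) = 0].
Proof.
move=> u0; have [phi /andP[p0 p1] uE] := polar u0.
apply: (@sub_finite_set _ _ [set` [:: phi - pi; phi; phi + pi]]); last exact: finite_seq.
move=> psi /= [/andP[q0 q1]]; rewrite (cross_dir psi uE) => /eqP.
rewrite mulf_eq0 enorm_eq0 (negPf u0) /= => /eqP s.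
have [|h|h] := sin_eq0_circle _ s; first lra.
- by rewrite !inE (_ : psi = phi - pi) ?eqxx //; lra.
- case: h => h; first by rewrite !inE (_ : psi = phi) ?eqxx ?orbT //; lra.
  by rewrite !inE (_ : psi = phi + pi) ?eqxx ?orbT //; lra.
Qed.

Definition sector u w : set R :=
  [set psi | [/\ circle psi, 0 < cross u (dir psi) & 0 < cross (dir psi) w]].

Lemma sin_gt0_circle (x : R) : - (2 * pi) < x < 2 * pi -> 0 < sin x ->
  0 < x < pi \/ 0 < x + 2 * pi < pi.
Proof.
have pp := pi_gt0 R.
move=> /andP[x1 x2] s.
have [h|h] := leP x 0.
  right; apply/andP; split; first lra.
  rewrite ltNge; apply/negP => h'.
  have [h2|h2] := leP pi (- x).
    have E : x = - pi by lra.
    by move: s; rewrite E sinN sinpi oppr0 ltxx.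
  have : 0 <= sin (- x) by apply: sin_ge0_pi; lra.
  by rewrite sinN oppr_ge0 leNgt s.
left; apply/andP; split=> //; rewrite ltNge; apply/negP; rewrite le_eqVlt => /predU1P[E|h'].
  by move: s; rewrite -E sinpi ltxx.
have : sin x < 0 by apply: sin_lt0_pi; lra.
by rewrite ltNge (ltW s).
Qed.

(** In polar coordinates both cross products are sines, and their positivity says that [psi] lies in
    an arc of length [ang u w] that starts at the direction of [u]. *)
Lemma sector_measure u w : 0 < cross u w ->
  measurable (sector u w) /\ lebesgue_measure (sector u w) = (ang u w)%:E.
Proof.
move=> c; have u0 := cross_neq0l (lt0r_neq0 c); have w0 := cross_neq0r (lt0r_neq0 c).
have [phi /andP[p0 p1] uE] := polar u0.
have /andP[t0 t1] := ang_gt0 c; have pp := pi_gt0 R.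
set th := ang u w in t0 t1 *.
have eu : 0 < enorm u by rewrite enorm_gt0.
have ew : 0 < enorm w by rewrite enorm_gt0.
have S psi : circle psi -> sector u w psi <-> 0 < psi - phi < th \/ 0 < psi - phi + 2 * pi < th.
  move=> /andP[q0 q1]; rewrite /sector /= (cross_dir psi uE) (dir_cross psi u0 uE c).
  rewrite !pmulr_rgt0 // -/th; split.
    move=> [_ s1 s2]; have [|h|h] := sin_gt0_circle _ s1; first lra.
      have [|h'|h'] := sin_gt0_circle _ s2; first lra.
        by left; lra.
      by exfalso; lra.
    have {}s2 : 0 < sin (th - (psi - phi + 2 * pi)).
      by rewrite -sin_per (_ : _ + 2 * pi = th - (psi - phi)) //; ring.
    have [|h'|h'] := sin_gt0_circle _ s2; first lra.
      by right; lra.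
    by exfalso; lra.
  move=> [h|h]; split; rewrite /circle /=; try lra; try by apply: sin_gt0_pi; lra.
    by rewrite -sin_per; apply: sin_gt0_pi; lra.
  rewrite (_ : th - _ = th - (psi - phi + 2 * pi) + 2 * pi); last by ring.
  by rewrite sin_per; apply: sin_gt0_pi; lra.
have [le|gt] := leP (phi + th) (2 * pi).
  have -> : sector u w = `]phi, phi + th[%classic.
    rewrite eqEsubset; split=> psi /=; rewrite in_itv /=.
      by move=> h; have [/[dup] q /andP[q0 q1] _ _] := h; move/(S _ q): h; lra.
    by move=> h; apply/S; rewrite /circle /=; lra.
  split; first exact: measurable_itv.
  rewrite lebesgue_measure_itv /= lte_fin ltrDl t0 -EFinB; congr _%:E; ring.
(* Here the arc passes 2 pi and continues from 0. *)
have -> : sector u w = `]phi, 2 * pi[%classic `|` `[0, phi + th - 2 * pi[%classic.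
  rewrite eqEsubset; split=> psi /=; rewrite !in_itv /=.
    by move=> h; have [/[dup] q /andP[q0 q1] _ _] := h; move/(S _ q): h => [h|h]; [left|right]; lra.
  by move=> h; apply/S; rewrite /circle /=; case: h => h; try lra; by [left; lra|right; lra].
split; first by apply: measurableU; exact: measurable_itv.
rewrite measureU //=; last first.
  by rewrite eqEsubset; split=> psi //=; rewrite !in_itv /=; lra.
rewrite !lebesgue_measure_itv /= !lte_fin p1 (_ : 0 < phi + th - 2 * pi); last by lra.
by rewrite -!EFinB -EFinD; congr _%:E; ring.
Qed.

End Directions.

(** * Directions entering a tile at its corners *)

Section Corners.
Context {R : realType}.
Implicit Types (u v w d : R * R) (A Q : set (R * R)) (p : nat -> R * R) (P : polygon R).

(** [Q] holds along the germ at [v] of the ray in the direction [d], the point [v] itself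
    excluded. *)
Definition ahead v d Q : Prop := \forall t \near (0 : R)^'+, Q (v + t *: d).

Lemma ahead_sub v d Q1 Q2 : (forall x, Q1 x -> Q2 x) -> ahead v d Q1 -> ahead v d Q2.
Proof. by move=> h; apply: filterS => t; exact: h. Qed.

Lemma ahead_orient a b v d : 0 < orient a b v -> ahead v d [set x | 0 < orient a b x].
Proof.
move=> o0; set c := cross (b - a) d.
have c0 : 0 < `|c| + 1 by rewrite ltr_wpDl.
rewrite /ahead; near=> t => /=.
have t0 : 0 < t by near: t; exact: nbhs_right_gt.
have : t < orient a b v / (`|c| + 1) by near: t; apply: nbhs_right_lt; exact: divr_gt0.
rewrite ltr_pdivlMr // => lt.
have -> : orient a b (v + t *: d) = orient a b v + t * c by rewrite /c; vsimp; ring.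
have : - (t * c) <= t * `|c| by rewrite -mulrN ler_pM2l // -normrN ler_norm.
lra.
Unshelve. all: by end_near. Qed.

Lemma ahead_orientl a b d : 0 < cross (b - a) d -> ahead a d [set x | 0 < orient a b x].
Proof.
move=> c0; rewrite /ahead; near=> t => /=.
have t0 : 0 < t by near: t; exact: nbhs_right_gt.
by rewrite (_ : orient _ _ _ = t * cross (b - a) d); [exact: mulr_gt0|vsimp; ring].
Unshelve. all: by end_near. Qed.

Lemma ahead_orientr a b d : 0 < cross (b - a) d -> ahead b d [set x | 0 < orient a b x].
Proof.
move=> c0; rewrite /ahead; near=> t => /=.
have t0 : 0 < t by near: t; exact: nbhs_right_gt.
by rewrite (_ : orient _ _ _ = t * cross (b - a) d); [exact: mulr_gt0|vsimp; ring].
Unshelve. all: by end_near. Qed.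

Lemma orient_swap12 a b x : orient b a x = - orient a b x :> R.
Proof. by vsimp; ring. Qed.

Lemma ahead_orient_lt a b v d : orient a b v < 0 -> ahead v d [set x | orient a b x < 0].
Proof.
move=> c0; apply: (@ahead_sub _ _ [set x | 0 < orient b a x]).
  by move=> x /=; rewrite orient_swap12 oppr_gt0.
by apply: ahead_orient; rewrite orient_swap12 oppr_gt0.
Qed.

Lemma ahead_orientl_lt a b d : cross (b - a) d < 0 -> ahead a d [set x | orient a b x < 0].
Proof.
move=> c0; apply: (@ahead_sub _ _ [set x | 0 < orient b a x]).
  by move=> x /=; rewrite orient_swap12 oppr_gt0.
apply: ahead_orientr; rewrite -oppr_lt0; apply: le_lt_trans c0.
by rewrite le_eqVlt; apply/orP; left; apply/eqP; vsimp; ring.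
Qed.

Lemma ahead_orientr_lt a b d : cross (b - a) d < 0 -> ahead b d [set x | orient a b x < 0].
Proof.
move=> c0; apply: (@ahead_sub _ _ [set x | 0 < orient b a x]).
  by move=> x /=; rewrite orient_swap12 oppr_gt0.
apply: ahead_orientl; rewrite -oppr_lt0; apply: le_lt_trans c0.
by rewrite le_eqVlt; apply/orP; left; apply/eqP; vsimp; ring.
Qed.

Lemma crossBN u w d : cross d (u - w) = cross (w - u) d :> R.
Proof. by vsimp; ring. Qed.

(* Up to the finite set E, the directions pointing from v into A form the set K, of measure th. *)
Definition has_angle A v (th : R) : Prop := exists K E : set R,
  [/\ measurable K /\ lebesgue_measure K = th%:E, finite_set E, K `<=` circle,
    forall psi, K psi -> ahead v (dir psi) (interior A) &
    forall psi, circle psi -> ~ K psi -> ~ E psi -> ahead v (dir psi) (~` A)].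

Lemma convex_corner A v u w : 0 < cross u w ->
  (forall d, 0 < cross u d -> 0 < cross d w -> ahead v d (interior A)) ->
  (forall d, cross u d < 0 \/ cross d w < 0 -> ahead v d (~` A)) ->
  has_angle A v (ang u w).
Proof.
move=> c h1 h2; have [mK lK] := sector_measure c.
have u0 := cross_neq0l (lt0r_neq0 c); have w0 := cross_neq0r (lt0r_neq0 c).
exists (sector u w), ([set psi | circle psi /\ cross u (dir psi) = 0] `|`
  [set psi | circle psi /\ cross w (dir psi) = 0]); split => //.
- by rewrite finite_setU; split; exact: cross_dir_finite.
- by move=> psi [].
- by move=> psi [_ p1 p2]; exact: h1.
- move=> psi q nK nE; apply: h2.
  have [|c1] := ltP (cross u (dir psi)) 0; first by left.
  have [|c2] := ltP (cross (dir psi) w) 0; first by right.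
  exfalso; move: c1; rewrite le_eqVlt => /predU1P[c1|c1]; first by apply: nE; left.
  move: c2; rewrite le_eqVlt => /predU1P[c2|c2]; last by apply: nK.
  by apply: nE; right; split => //; rewrite crossC -c2 oppr0.
Qed.

(** The directions inside are the complement in the circle of the sector from [w] to [u] and of the
    exceptional directions, which are null. *)
Lemma reflex_corner A v u w : 0 < cross w u ->
  (forall d, 0 < cross u d \/ 0 < cross d w -> ahead v d (interior A)) ->
  (forall d, cross u d < 0 -> cross d w < 0 -> ahead v d (~` A)) ->
  has_angle A v (2 * pi - ang w u).
Proof.
move=> c h1 h2; have [mK lK] := sector_measure c.
have u0 := cross_neq0r (lt0r_neq0 c); have w0 := cross_neq0l (lt0r_neq0 c).
set E := [set psi | circle psi /\ cross u (dir psi) = 0] `|`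
  [set psi | circle psi /\ cross w (dir psi) = 0].
have fE : finite_set E by rewrite finite_setU; split; exact: cross_dir_finite.
have mE : measurable E by apply: countable_measurable => //; exact: finite_set_countable.
have E0 : lebesgue_measure E = 0%E by apply: countable_lebesgue_measure0; exact: finite_set_countable.
have pp := pi_gt0 R.
have cE : circle = `[0, 2 * pi[%classic :> set R.
  by rewrite eqEsubset; split=> psi; rewrite /circle /= in_itv.
have lc : lebesgue_measure (circle : set R) = (2 * pi)%:E.
  rewrite cE lebesgue_measure_itv /= lte_fin (_ : 0 < 2 * pi :> R); last by lra.
  by rewrite -EFinB subr0.
have mc : measurable (circle : set R) by rewrite cE; exact: measurable_itv.
have sc : sector w u `|` E `<=` circle by move=> psi [[]|[[]|[]]].
exists (circle `\` (sector w u `|` E)), E; split => //.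
- have mU : measurable (sector w u `|` E) by exact: measurableU.
  split; first exact: measurableD.
  have fc : (lebesgue_measure (circle : set R) < +oo)%E by rewrite lc ltry.
  have lU : lebesgue_measure (sector w u `|` E) = (ang w u)%:E.
    exact: etrans (@measureU0 _ _ _ lebesgue_measure _ _ mK mE E0) lK.
  apply: etrans (@measureD _ _ _ lebesgue_measure _ _ mc mU fc) _.
  by rewrite (setIidr sc) EFinB; congr (_ - _)%E.
- move=> psi [q nK]; apply: h1.
  have [|c1] := ltP 0 (cross u (dir psi)); first by left.
  have [|c2] := ltP 0 (cross (dir psi) w); first by right.
  exfalso; apply: nK.
  move: c1; rewrite le_eqVlt => /predU1P[c1|c1]; first by right; left.
  move: c2; rewrite le_eqVlt => /predU1P[c2|c2].
    by right; right; split => //; rewrite crossC c2 oppr0.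
  by left; split => //; rewrite crossC oppr_gt0.
- move=> psi q nK nE; have [q1 c1 c2] : sector w u psi.
    by apply: contrapT => h; apply: nK; split => // -[|].
  by apply: h2; rewrite crossC oppr_lt0.
Qed.

Lemma ccw5_support_lt p k m : ccw5 p -> (k != m %[mod 5])%N -> (k.+1 != m %[mod 5])%N ->
  0 < orient (cyc5 p k) (cyc5 p k.+1) (cyc5 p m).
Proof.
elim: k p m => [|k IH] p m h.
  rewrite /cyc5; have : (m %% 5 < 5)%N by rewrite ltn_mod.
  by case: (m %% 5)%N => [|[|[|[|[|//]]]]] _ // _ _; exact: h.
move=> h1 h2; have := IH _ (m + 4)%N (ccw5_rot h); rewrite !cyc5_rot.
rewrite -addnS /cyc5 modnDr; apply; last by rewrite -[(_ + 4)%N]addnC; clear -h2; lia.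
by clear -h1; lia.
Qed.

Section PentagonCorners.
Context (P : polygon R) (e : nat) (P5 : pentagon P) (e14 : e = 1%N \/ e = 4%N).
Let p := pentagon_vertices P e.
Context (ccw_p : ccw5 p).

(** Near a vertex only the lines of its two sides matter: the vertex is strictly on the inner side
    of the three others. *)
Lemma pentagon_corner m : has_angle (region P) (p m) (vertex_angle p m).
Proof.
have [R1 R2] := region_pentagon P5 e14 ccw_p.
have C k : cyc5 p k = p k by exact: cyc5_pentagon_vertices.
have pm k l : (k = l %[mod 5])%N -> p k = p l by move=> kl; rewrite -C /cyc5 kl -/(cyc5 p l) C.
have p5 : p (m + 4).+1 = p m by apply: pm; rewrite -addnS modnDr.
have lt k : (k != m %[mod 5])%N -> (k.+1 != m %[mod 5])%N -> 0 < orient (p k) (p k.+1) (p m).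
  by move=> h1 h2; rewrite -!C; exact: ccw5_support_lt.
rewrite /vertex_angle !C; apply: convex_corner.
- have := @ccw5_support_lt p m (m + 4)%N ccw_p; rewrite !C addn1; apply; lia.
- move=> d c1 c2.
  have H (k : 'I_5) : \forall t \near 0^'+, 0 < orient (p k) (p k.+1) (p m + t *: d).
    have [km|km] := eqVneq (k %% 5)%N (m %% 5)%N.
      rewrite (pm _ _ km) (pm k.+1 m.+1); last by clear -km; lia.
      by rewrite -addn1; exact: ahead_orientl.
    have [k1m|k1m] := eqVneq (k.+1 %% 5)%N (m %% 5)%N; last by apply: ahead_orient; exact: lt.
    rewrite (pm _ _ k1m) (pm k (m + 4)%N); last by clear -k1m; lia.
    by apply: ahead_orientr; rewrite -crossBN.
  have G := filter_forall (at_right_proper_filter 0) H.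
  have F (t : R) : (forall k : 'I_5, 0 < orient (p k) (p k.+1) (p m + t *: d)) ->
      interior (region P) (p m + t *: d).
    by move=> h; apply: R2 => k k5; exact: (h (Ordinal k5)).
  exact: filterS F G.
- move=> d [c|c].
    apply: (@ahead_sub _ _ [set x | orient (p m) (p (m + 1)%N) x < 0]).
      by move=> x; rewrite /= ltNge => /negP h /R1 h'; apply: h; rewrite addn1; exact: h'.
    exact: ahead_orientl_lt.
  apply: (@ahead_sub _ _ [set x | orient (p (m + 4)%N) (p m) x < 0]).
    by move=> x; rewrite /= ltNge => /negP h /R1 h'; apply: h; rewrite -p5; exact: h'.
  by apply: ahead_orientr_lt; rewrite -crossBN.
Qed.

Lemma pentagon_tile : exists2 s : 'I_5 -> 'I_5, injective s &
  forall k : 'I_5, has_angle (region P) (vertex (verts P) k) (vertex_angle p (s k)).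
Proof.
have T := fun k => pentagon_vertices_turn k P5 e14.
exists (fun k => inord (e * k %% 5)); last first.
  by move=> k; have [<- _ _] := T k; exact: pentagon_corner.
by move=> i j h; have [_ _ <-] := T i; have [_ _ <-] := T j; rewrite h.
Qed.

End PentagonCorners.

Section DartCorners.
Context (P : polygon R) (i e : nat) (P4 : quadrilateral P) (e13 : e = 1%N \/ e = 3%N).
Let p := quad_vertices P i e.
Context (dart_p : dart p).

Definition dart_angle (p : nat -> R * R) (k : nat) : R :=
  if k == 0%N then 2 * pi - ang (p 3%N - p 0%N) (p 1%N - p 0%N)
  else ang (p (k.+1 %% 4)%N - p k) (p k.-1 - p k).

Lemma dart_corner (k : 'I_4) : has_angle (region P) (p k) (dart_angle p k).
Proof.
have [R1 R2] := region_dart P4 e13 dart_p.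
case: dart_p => a120 a230 a310.
have a123 : 0 < orient (p 1%N) (p 2%N) (p 3%N).
  have -> : orient (p 1%N) (p 2%N) (p 3%N) = orient (p 1%N) (p 2%N) (p 0%N) +
      orient (p 2%N) (p 3%N) (p 0%N) + orient (p 3%N) (p 1%N) (p 0%N) by vsimp; ring.
  by apply: addr_gt0 => //; exact: addr_gt0.
have a301 : orient (p 3%N) (p 0%N) (p 1%N) < 0 by rewrite orient_swap oppr_lt0.
have a013 : orient (p 0%N) (p 1%N) (p 3%N) < 0 by rewrite orient_rot.
have a302 : 0 < orient (p 3%N) (p 0%N) (p 2%N) by rewrite orient_rot.
have a012 : 0 < orient (p 0%N) (p 1%N) (p 2%N) by rewrite -orient_rot.
have a231 : 0 < orient (p 2%N) (p 3%N) (p 1%N) by rewrite orient_rot.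
have in1 v d : ahead v d [set x | 0 < orient (p 1%N) (p 2%N) x] ->
    ahead v d [set x | 0 < orient (p 2%N) (p 3%N) x] ->
    ahead v d [set x | 0 < orient (p 3%N) (p 0%N) x] \/ ahead v d [set x | 0 < orient (p 0%N) (p 1%N) x] ->
    ahead v d (interior (region P)).
  move=> h1 h2 [h3|h3].
    by apply: filterS3 h1 h2 h3 => t h1 h2 h3; apply: R2 => //; left.
  by apply: filterS3 h1 h2 h3 => t h1 h2 h3; apply: R2 => //; right.
have out1 v d : ahead v d [set x | orient (p 1%N) (p 2%N) x < 0] -> ahead v d (~` region P).
  by apply: ahead_sub => x /= h /R1[h' _ _]; move: h; rewrite ltNge h'.
have out2 v d : ahead v d [set x | orient (p 2%N) (p 3%N) x < 0] -> ahead v d (~` region P).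
  by apply: ahead_sub => x /= h /R1[_ h' _]; move: h; rewrite ltNge h'.
have out3 v d : ahead v d [set x | orient (p 3%N) (p 0%N) x < 0] ->
    ahead v d [set x | orient (p 0%N) (p 1%N) x < 0] -> ahead v d (~` region P).
  by apply: filterS2 => t /= h1 h2 /R1[_ _ [h'|h']]; [move: h1|move: h2]; rewrite ltNge h'.
case: k => [[|[|[|[|k]]]] k4] //=; rewrite /dart_angle /=.
- apply: reflex_corner; first by rewrite (_ : cross _ _ = orient (p 3%N) (p 1%N) (p 0%N)) //; vsimp; ring.
    move=> d h; apply: in1; [exact: ahead_orient|exact: ahead_orient|].
    case: h => h; first by right; exact: ahead_orientl.
    by left; apply: ahead_orientr; rewrite -crossBN.
  by move=> d h1 h2; apply: out3; [apply: ahead_orientr_lt; rewrite -crossBN|exact: ahead_orientl_lt].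
- apply: convex_corner => //.
    move=> d h1 h2; apply: in1; [exact: ahead_orientl|exact: ahead_orient|].
    by right; apply: ahead_orientr; rewrite -crossBN.
  move=> d [h|h]; first by apply: out1; exact: ahead_orientl_lt.
  by apply: out3; [exact: ahead_orient_lt|apply: ahead_orientr_lt; rewrite -crossBN].
- apply: convex_corner => //.
    move=> d h1 h2; apply: in1; [apply: ahead_orientr; rewrite -crossBN|exact: ahead_orientl|] => //.
    by left; exact: ahead_orient.
  move=> d [h|h]; first by apply: out2; exact: ahead_orientl_lt.
  by apply: out1; apply: ahead_orientr_lt; rewrite -crossBN.
- apply: convex_corner => //.
    move=> d h1 h2; apply: in1; [exact: ahead_orient|apply: ahead_orientr; rewrite -crossBN|] => //.
    by left; exact: ahead_orientl.
  move=> d [h|h]; first by apply: out3; [exact: ahead_orientl_lt|exact: ahead_orient_lt].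
  by apply: out2; apply: ahead_orientr_lt; rewrite -crossBN.
Qed.

Lemma dart_tile : exists2 s : 'I_4 -> 'I_4, injective s &
  forall k : 'I_4, has_angle (region P) (vertex (verts P) k) (dart_angle p (s k)).
Proof.
have s4 : size (verts P) = 4%N by exact: P4.
have /choice[s hs] : forall k : 'I_4, exists s : 'I_4, (i + e * s = k %[mod 4])%N.
  move=> k.
  by have [r r4 rE] := @quad_index i e e13 k; exists (Ordinal r4).
exists s.
  move=> j k h; apply: val_inj; rewrite /= -[LHS](modn_small (ltn_ord j)) -hs h hs.
  by rewrite modn_small.
move=> k; rewrite (_ : vertex _ _ = p (s k)); first exact: dart_corner.
by rewrite /p /quad_vertices -[LHS]vertex_mod -[RHS]vertex_mod s4 hs.
Qed.

(** The segments from [p 0] split the angles of the triangle [p 1], [p 2], [p 3]; adding up the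
    angles of the small triangles gives the sum. The angle facing the third side at [p 0] is below
    pi, so the one of the dart is above. *)
Lemma dart_angles : [/\ forall k : 'I_4, 0 <= dart_angle p k, pi < dart_angle p 0 &
  \sum_(k < 4) dart_angle p k = 2 * pi].
Proof.
case: dart_p => a120 a230 a310; have pp := pi_gt0 R.
have a123 : 0 < orient (p 1%N) (p 2%N) (p 3%N).
  have -> : orient (p 1%N) (p 2%N) (p 3%N) = orient (p 1%N) (p 2%N) (p 0%N) +
      orient (p 2%N) (p 3%N) (p 0%N) + orient (p 3%N) (p 1%N) (p 0%N) by vsimp; ring.
  by apply: addr_gt0 => //; exact: addr_gt0.
have a301 : orient (p 3%N) (p 0%N) (p 1%N) < 0 by rewrite orient_swap oppr_lt0.
have a302 : 0 < orient (p 3%N) (p 0%N) (p 2%N) by rewrite orient_rot.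
have a012 : 0 < orient (p 0%N) (p 1%N) (p 2%N) by rewrite -orient_rot.
have a231 : 0 < orient (p 2%N) (p 3%N) (p 1%N) by rewrite orient_rot.
have a312 : 0 < orient (p 3%N) (p 1%N) (p 2%N) by rewrite -orient_rot.
have a031 : 0 < orient (p 0%N) (p 3%N) (p 1%N) by rewrite -orient_rot.
have a130 : 0 < orient (p 1%N) (p 0%N) (p 3%N) by rewrite orient_rot.
have t1 := triangle_ang a120; have t2 := triangle_ang a230; have t3 := triangle_ang a310.
have t4 := triangle_ang a123.
have d1 : ang (p 2%N - p 1%N) (p 3%N - p 1%N) =
    ang (p 2%N - p 1%N) (p 0%N - p 1%N) + ang (p 0%N - p 1%N) (p 3%N - p 1%N) by exact: angD.
have a203 : 0 < orient (p 2%N) (p 0%N) (p 1%N) by rewrite orient_rot.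
have d2 : ang (p 3%N - p 2%N) (p 1%N - p 2%N) =
    ang (p 3%N - p 2%N) (p 0%N - p 2%N) + ang (p 0%N - p 2%N) (p 1%N - p 2%N) by exact: angD.
have d3 : ang (p 1%N - p 3%N) (p 2%N - p 3%N) =
    ang (p 1%N - p 3%N) (p 0%N - p 3%N) + ang (p 0%N - p 3%N) (p 2%N - p 3%N) by exact: angD.
have c31 : 0 < cross (p 3%N - p 0%N) (p 1%N - p 0%N) by exact: a031.
have /andP[g0 g1] := ang_gt0 c31.
have /andP[g2 _] := ang_gt0 (a120 : 0 < cross _ _).
have /andP[g3 _] := ang_gt0 (a231 : 0 < cross _ _).
have /andP[g4 _] := ang_gt0 (a302 : 0 < cross _ _).
have D0 : dart_angle p 0 = 2 * pi - ang (p 3%N - p 0%N) (p 1%N - p 0%N) by [].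
have D1 : dart_angle p 1 = ang (p 2%N - p 1%N) (p 0%N - p 1%N) by [].
have D2 : dart_angle p 2 = ang (p 3%N - p 2%N) (p 1%N - p 2%N) by [].
have D3 : dart_angle p 3 = ang (p 0%N - p 3%N) (p 2%N - p 3%N) by [].
split.
- move=> [[|[|[|[|k]]]] k4] //=; rewrite ?D0 ?D1 ?D2 ?D3 ?(ltW g2) ?(ltW g3) ?(ltW g4) //; lra.
- rewrite D0; lra.
rewrite !big_ord_recr big_ord0 /= add0r D0 D1 D2 D3.
lra.
Qed.

End DartCorners.

End Corners.

(** * Vertices of the tiling and the angle sum 2 pi *)

Section TorusVertices.
Context {R : realType}.
Implicit Types (x y u p q : R * R) (A : set (R * R)).

Lemma shiftP u A x : shift u A x <-> A (x - u).
Proof.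
split=> [[y Ay <-]|h]; first by rewrite addrC addKr.
by exists (x - u) => //; rewrite addrC subrK.
Qed.

Lemma shift_interior u A : shift u (interior A) `<=` interior (shift u A).
Proof.
move=> _ [x /nbhs_boxP[e e0 h] <-]; apply/nbhs_boxP; exists e => // y h1 h2.
apply/shiftP; apply: h => /=.
  by move: h1; rewrite /= (_ : y.1 - (u + x).1 = y.1 - u.1 - x.1) //=; ring.
by move: h2; rewrite /= (_ : y.2 - (u + x).2 = y.2 - u.2 - x.2) //=; ring.
Qed.

(** Each segment is expressed in the parameters of the other; the two scale factors have product 1
    and absolute value at most 1, so ends go to ends. *)
Lemma shift_segment_ends u p q p' q' : shift u (segment p q) = segment p' q' -> p' != q' ->
  (p' = u + p /\ q' = u + q) \/ (p' = u + q /\ q' = u + p).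
Proof.
move=> e pq'.
have in01 : 0 <= (0 : R) <= 1 by rewrite lexx ler01.
have in11 : 0 <= (1 : R) <= 1 by rewrite lexx ler01.
have [s /andP[s0 s1] sE] : exists2 s : R, 0 <= s <= 1 & u + point_at p q s = p'.
  have : shift u (segment p q) p' by rewrite e; exists 0; rewrite ?point_at0.
  by move=> [_ [s s01 <-] <-]; exists s.
have [t /andP[t0 t1] tE] : exists2 t : R, 0 <= t <= 1 & u + point_at p q t = q'.
  have : shift u (segment p q) q' by rewrite e; exists 1; rewrite ?point_at1.
  by move=> [_ [t t01 <-] <-]; exists t.
have [s' /andP[s0' s1'] sE'] : exists2 s : R, 0 <= s <= 1 & point_at p' q' s = u + p.
  have : segment p' q' (u + p) by rewrite -e; exists p => //; exists 0; rewrite ?point_at0.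
  by move=> [s' s01' <-]; exists s'.
have [t' /andP[t0' t1'] tE'] : exists2 t : R, 0 <= t <= 1 & point_at p' q' t = u + q.
  have : segment p' q' (u + q) by rewrite -e; exists q => //; exists 1; rewrite ?point_at1.
  by move=> [t' t01' <-]; exists t'.
have d1 : q' - p' = (t - s) *: (q - p) by rewrite -sE -tE; vring.
have d2 : q - p = (t' - s') *: (q' - p').
  by rewrite (_ : q - p = (u + q) - (u + p)); [rewrite -sE' -tE'; vring|vring].
have k1 : (t - s) * (t' - s') = 1.
  have : (1 - (t - s) * (t' - s')) *: (q' - p') = 0.
    by rewrite scalerBl scale1r -scalerA -d2 -d1 subrr.
  move/eqP; rewrite scaler_eq0 subr_eq0 [q' - p' == 0]subr_eq0 [q' == p']eq_sym (negPf pq') orbF.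
  by move/eqP.
have [ts|ts] := leP 0 (t - s).
  have [? ?] : s = 0 /\ t = 1.
    have h1 : (t - s) * (t' - s') <= (t - s) * 1 by apply: ler_wpM2l => //; lra.
    by split; lra.
  by left; rewrite -sE -tE; subst; rewrite point_at0 point_at1.
have [? ?] : s = 1 /\ t = 0.
  have h1 : (s - t) * (s' - t') <= (s - t) * 1 by apply: ler_wpM2l; lra.
  have h2 : (s - t) * (s' - t') = (t - s) * (t' - s') by ring.
  by split; lra.
by right; rewrite -sE -tE; subst; rewrite point_at0 point_at1.
Qed.

Lemma ahead_nbhs x (d : R * R) A : nbhs x A -> ahead x d A.
Proof.
move=> /nbhs_boxP[e e0 h]; rewrite /ahead; near=> t.
have t0 : 0 < t by near: t; exact: nbhs_right_gt.
have c0 : 0 < `|d.1| + `|d.2| + 1 by have := normr_ge0 d.1; have := normr_ge0 d.2; lra.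
have : t < e / (`|d.1| + `|d.2| + 1) by near: t; apply: nbhs_right_lt; exact: divr_gt0.
rewrite ltr_pdivlMr // => lt.
have h1 := mulr_ge0 (ltW t0) (normr_ge0 d.1); have h2 := mulr_ge0 (ltW t0) (normr_ge0 d.2).
by apply: h; rewrite /= addrC addKr normrM (gtr0_norm t0); lra.
Unshelve. all: by end_near. Qed.

Section Tiling.
Context (a b : R * R) (N : nat) (T : 'I_N -> polygon R) (tilingT : torus_tiling a b T).

Lemma lattice0 : lattice a b 0.
Proof. by exists 0, 0; rewrite !mulr0z addr0. Qed.

Lemma latticeN u : lattice a b u -> lattice a b (- u).
Proof. by move=> [m [n ->]]; exists (- m), (- n); rewrite !mulrNz opprD. Qed.

Lemma latticeD u v : lattice a b u -> lattice a b v -> lattice a b (u + v).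
Proof. by move=> [m [n ->]] [m' [n' ->]]; exists (m + m'), (n + n'); rewrite !mulrzDr addrACA. Qed.

(** The coefficients of a lattice vector are its cross products with [b] and [a] divided by
    [cross a b], so they are bounded with the vector. *)
Lemma lattice_bounded (M : R) : exists B : nat, forall m n : int,
  `|(a *~ m + b *~ n).1| <= M -> `|(a *~ m + b *~ n).2| <= M -> (`|m| <= B)%N /\ (`|n| <= B)%N.
Proof.
have c0 := tiling_lattice tilingT.
have co m n : cross (a *~ m + b *~ n) b = m%:~R * cross a b /\
    cross a (a *~ m + b *~ n) = n%:~R * cross a b.
  have E (x : R * R) (k : int) : (x *~ k).1 = k%:~R * x.1 /\ (x *~ k).2 = k%:~R * x.2.
    by rewrite -scaler_int.
  have [a1 a2] := E a m; have [b1 b2] := E b n.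
  by split; rewrite /cross /= a1 a2 b1 b2; ring.
pose L := (`|a.1| + `|a.2| + `|b.1| + `|b.2|) * M / `|cross a b|.
exists (Num.truncn L).+1 => m n h1 h2.
have bd (z : int) : `|z%:~R * cross a b| <= (`|a.1| + `|a.2| + `|b.1| + `|b.2|) * M ->
    (`|z| <= (Num.truncn L).+1)%N.
  rewrite normrM -ler_pdivlMr ?normr_gt0 // => h; rewrite ltnW // -(ltr_nat R).
  by apply: le_lt_trans (truncnS_gt L); rewrite natr_absz intr_norm.
have [e1 e2] := co m n; move: h1 h2 e1 e2; set u := a *~ m + b *~ n => h1 h2 e1 e2.
have pr (x : R * R) (k : R) : `|k| <= M -> `|k| * `|x.1| <= M * `|x.1| /\ `|k| * `|x.2| <= M * `|x.2|.
  by move=> h; split; apply: ler_wpM2r.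
have [a11 a12] := pr a _ h1; have [a21 a22] := pr a _ h2.
have [b11 b12] := pr b _ h1; have [b21 b22] := pr b _ h2.
have M0 : 0 <= M by apply: le_trans h1.
have na := mulr_ge0 M0 (normr_ge0 a.1); have nb := mulr_ge0 M0 (normr_ge0 a.2).
have nc := mulr_ge0 M0 (normr_ge0 b.1); have nd := mulr_ge0 M0 (normr_ge0 b.2).
split; apply: bd.
  rewrite -e1 /cross; apply: le_trans (ler_normB _ _) _; rewrite !normrM; lra.
rewrite -e2 /cross; apply: le_trans (ler_normB _ _) _; rewrite !normrM.
rewrite [`|a.1| * _]mulrC [`|a.2| * _]mulrC; lra.
Qed.

(** Only finitely many translates come near [x]. If each were avoided by the ray for small
    parameters, one small parameter would avoid all of them, against the covering. *)
Lemma tiling_ahead x d : exists i u, lattice a b u /\ ~ ahead x d (~` shift u (region (T i))).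
Proof.
apply: contrapT => h.
have H i u : lattice a b u -> ahead x d (~` shift u (region (T i))).
  by move=> Lu; apply: contrapT => h'; apply: h; exists i, u.
have /choice[M hM] : forall i, exists M : R, forall y, region (T i) y -> `|y.1| <= M /\ `|y.2| <= M.
  by move=> i; have [M _ hM] := region_bounded (T i); exists M.
have M0 i : 0 <= M i.
  have [y /interior_subset/hM[h1 _]] := region_interior_nonempty (T i).
  exact: le_trans (normr_ge0 _) h1.
(* For parameters below 1, a translate that contains the point of the ray has its translation vector
   within [M']. *)
pose M' := `|x.1| + `|x.2| + `|d.1| + `|d.2| + \sum_i M i.
have [B hB] := lattice_bounded M'.
pose c (k : 'I_(B + B).+1) : int := (k : nat)%:Z - B%:Z.
have cP (m : int) : (`|m| <= B)%N -> exists k, c k = m.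
  move=> mB; have k1 : (`|(m + B%:Z)%R| < (B + B).+1)%N by lia.
  by exists (Ordinal k1); rewrite /c /=; lia.
have G := @filter_forall _ _ (fun (k : 'I_N * 'I_(B + B).+1 * 'I_(B + B).+1) =>
  [set t : R | ~ shift (a *~ c k.1.2 + b *~ c k.2) (region (T k.1.1)) (x + t *: d)]) _
  (at_right_proper_filter 0).
have {}G := G (fun k => H k.1.1 _ (ex_intro _ (c k.1.2) (ex_intro _ (c k.2) erefl))).
have G2 : \forall t \near (0 : R)^'+, [/\ 0 < t, t < 1 & forall k : 'I_N * 'I_(B + B).+1 * 'I_(B + B).+1,
    ~ shift (a *~ c k.1.2 + b *~ c k.2) (region (T k.1.1)) (x + t *: d)].
  near=> t; split.
  - by near: t; exact: nbhs_right_gt.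
  - by near: t; exact: nbhs_right_lt.
  - by near: t; exact: G.
have [t [t0 t1 {}G]] := filter_ex G2.
have [i [u [[m [n uE]] /shiftP hx]]] := tiling_cover tilingT (x + t *: d).
have [y1 y2] := hM i _ hx.
have Mi : M i <= \sum_i M i by rewrite (bigD1 i) //= lerDl sumr_ge0.
have td (s : R) : `|t * s| <= `|s| by rewrite normrM (gtr0_norm t0) ler_piMl // ltW.
have t1d := td d.1; have t2d := td d.2.
have n1 := normr_ge0 x.1; have n2 := normr_ge0 x.2; have n3 := normr_ge0 d.1; have n4 := normr_ge0 d.2.
have [||mB nB] := hB m n.
- rewrite -uE (_ : u.1 = x.1 + t * d.1 - (x + t *: d - u).1); last by rewrite /= /GRing.scale /=; ring.
  apply: le_trans (ler_normB _ _) _; have := ler_normD x.1 (t * d.1); rewrite /M'; lra.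
- rewrite -uE (_ : u.2 = x.2 + t * d.2 - (x + t *: d - u).2); last by rewrite /= /GRing.scale /=; ring.
  apply: le_trans (ler_normB _ _) _; have := ler_normD x.2 (t * d.2); rewrite /M'; lra.
have [k kE] := cP m mB; have [l lE] := cP n nB.
by apply: (G (i, k, l)) => /=; rewrite kE lE -uE; apply/shiftP.
Unshelve. all: by end_near. Qed.

(** This is where edge-to-edge enters: in the case of a common edge, the vertex lies on an edge of
    its own polygon, hence is an end of it, and common edges have common ends. *)
Lemma tiling_vertex i0 k0 i u : lattice a b u -> shift u (region (T i)) (vertex (verts (T i0)) k0) ->
  exists2 k, (k < nsides (T i))%N & vertex (verts (T i0)) k0 = u + vertex (verts (T i)) k.
Proof.
move=> Lu hx; set x := vertex (verts (T i0)) k0 in hx *.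
have n0 j := size_verts_gt0 (T j).
have fin k : exists2 k', (k' < nsides (T i))%N & u + vertex (verts (T i)) k = u + vertex (verts (T i)) k'.
  by exists (k %% size (verts (T i)))%N; rewrite ?ltn_mod // vertex_mod.
have [[ii u0]|ne] := pselect (i = i0 /\ u = 0).
  have [k kn kE] := fin k0; exists k => //; rewrite -kE u0 add0r /x ii //.
have xv : vertex (verts (T i0)) k0 \in verts (T i0) by rewrite /vertex mem_nth // ltn_mod.
have xr : region (T i0) x by have [] := polyline_region (vertex_polyline (T i0) k0).
have [[[y yv yE] _]|[k [l [e xe]]]] := tiling_edge_to_edge tilingT Lu ne hx xr.
  have yn : (index y (verts (T i)) < nsides (T i))%N by rewrite index_mem.
  by exists (index y (verts (T i))) => //; rewrite /vertex modn_small // nth_index.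
have xE : x = vertex (verts (T i0)) l \/ x = vertex (verts (T i0)) l.+1.
  have [h|h] := edge_vertex xe; [left|right]; by rewrite /x -vertex_mod h vertex_mod.
have [[e1 e2]|[e1 e2]] := shift_segment_ends e (vertex_neqS (T i0) l).
  by case: xE => ->; rewrite ?e1 ?e2; exact: fin.
by case: xE => ->; rewrite ?e1 ?e2; exact: fin.
Qed.

Lemma tiling_overlap i j u v x : lattice a b u -> lattice a b v ->
  shift u (interior (region (T i))) x -> shift v (interior (region (T j))) x -> i = j /\ u = v.
Proof.
move=> Lu Lv hu /shiftP hv; apply: contrapT => ne.
have Luv : lattice a b (u - v) by apply: latticeD => //; exact: latticeN.
have := @tiling_disjoint _ _ _ _ _ tilingT i j (u - v) Luv.
have ne' : ~ (i = j /\ u - v = 0) by move=> [ij /eqP]; rewrite subr_eq0 => /eqP uv; apply: ne.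
move=> /(_ ne') h; suff : set0 (x - v) by []; rewrite -h; split => //.
apply: shift_interior; apply/shiftP; move/shiftP: hu; congr (interior _ _); vring.
Qed.

Definition corner (d : tile_side T) : R * R := vertex (verts (T (tag d))) (tagged d).

Definition same_vertex : rel (tile_side T) :=
  fun d e => `[< lattice a b (corner d - corner e) >].

Lemma same_vertex_sym : symmetric same_vertex.
Proof. by move=> d e; apply/asboolP/asboolP => /latticeN; rewrite opprB. Qed.

Lemma measure_disjoint_sum (I : finType) (Q : pred I) (K : I -> set R) (th : I -> R) :
  (forall i, Q i -> measurable (K i) /\ lebesgue_measure (K i) = (th i)%:E) ->
  (forall i j, Q i -> Q j -> i <> j -> K i `&` K j = set0) ->
  lebesgue_measure (\bigcup_(i in [set i | Q i]) K i) = (\sum_(i | Q i) th i)%:E.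
Proof.
move=> hK dis; have -> : [set i | Q i] = [set` enum Q].
  by rewrite eqEsubset; split=> i; rewrite /= mem_enum.
rewrite measure_fin_bigcup //=.
- rewrite -fsbig_seq ?enum_uniq // big_enum -sumEFin.
  by apply: eq_bigr => i Qi; case: (hK i Qi).
- move=> i j /=; rewrite !mem_enum => Qi Qj [y Ky]; apply: contrapT => ij.
  by move: Ky; rewrite dis.
- by move=> i; rewrite /= mem_enum => /hK[].
Qed.

(** Each corner at the vertex is translated to the single point [x]. The sets of directions [K] are
    then disjoint, and up to finitely many directions they fill the circle. *)
Lemma torus_vertex_sum (th : tile_side T -> R) (d0 : tile_side T) :
  (forall d, has_angle (region (T (tag d))) (corner d) (th d)) ->
  \sum_(d | same_vertex d0 d) th d = 2 * pi.
Proof.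
move=> /choice[K /choice[E hKE]].
set x := corner d0; pose u d := x - corner d.
have Lu d : same_vertex d0 d -> lattice a b (u d) by move/asboolP.
have move_ d psi (A : set (R * R)) : ahead (corner d) (dir psi) A -> ahead x (dir psi) (shift (u d) A).
  rewrite /ahead; apply: filterS => t h; apply/shiftP; move: h; rewrite (_ : _ - u d = corner d + t *: dir psi) //.
  by rewrite /u; vring.
have mK d : measurable (K d) /\ lebesgue_measure (K d) = (th d)%:E by case: (hKE d).
(* A common direction gives a point interior to two translates; these are equal, and two corners of
   one tile under one translation coincide. *)
have dis i j : same_vertex d0 i -> same_vertex d0 j -> i <> j -> K i `&` K j = set0.
  move=> si sj ij; rewrite eqEsubset; split => // psi [Ki Kj]; apply: ij.
  have [_ _ _ /(_ _ Ki)/move_ hi _] := hKE i; have [_ _ _ /(_ _ Kj)/move_ hj _] := hKE j.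
  have [t [ti tj]] := filter_ex (filterI hi hj).
  have [] := tiling_overlap (Lu _ si) (Lu _ sj) ti tj.
  case: i j {si sj Ki Kj hi hj ti tj} => [i k] [j l] /= ij; subst j.
  rewrite /u /corner /= => /eqP; rewrite (inj_eq (addrI x)) eqr_opp => /eqP e.
  by congr existT; apply: val_inj; apply: (vertex_inj (ltn_ord k) (ltn_ord l)).
have [lc mc] : lebesgue_measure (circle : set R) = (2 * pi)%:E /\ measurable (circle : set R).
  have -> : circle = `[0, 2 * pi[%classic :> set R.
    by rewrite eqEsubset; split=> psi; rewrite /circle /= in_itv.
  have pp := pi_gt0 R; split; last exact: measurable_itv.
  rewrite lebesgue_measure_itv /= lte_fin (_ : 0 < 2 * pi :> R); last by lra.
  by rewrite -EFinB subr0.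
pose Q := same_vertex d0; pose KU := \bigcup_(d in [set d | Q d]) K d.
pose EU := \bigcup_(d in [set d | Q d]) E d.
have fE : finite_set EU.
  by apply: bigcup_finite => [|d _]; [exact: finite_finset|case: (hKE d)].
have mE : measurable EU by apply: countable_measurable => //; exact: finite_set_countable.
have E0 : lebesgue_measure EU = 0%E by apply: countable_lebesgue_measure0; exact: finite_set_countable.
have mKU : measurable KU.
  by apply: fin_bigcup_measurable => [|d _]; [exact: finite_finset|case: (mK d)].
have sub1 : KU `<=` circle by move=> psi [d _ Kd]; case: (hKE d) => _ _ /(_ _ Kd).
(* By [tiling_ahead] some translate is met arbitrarily close to [x] in this direction. Being closed,
   it contains [x], hence has a corner there, and the direction cannot be one of those that leave
   it. *)
have sub2 : circle `<=` KU `|` EU.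
  move=> psi q; apply: contrapT => nKE.
  have [i [v [Lv nah]]] := tiling_ahead x (dir psi).
  have hx : shift v (region (T i)) x.
    apply: contrapT => nx; apply: nah.
    have : ahead (x - v) (dir psi) (~` region (T i)).
      apply: ahead_nbhs; apply: open_nbhs_nbhs; split; last by move/shiftP.
      by apply: closed_openC; exact: region_closed.
    rewrite /ahead; apply: filterS => t h /shiftP h'; apply: h; move: h'.
    by rewrite (_ : x + _ - v = x - v + t *: dir psi) //; vring.
  have [k kn kE] := tiling_vertex Lv hx.
  pose d : tile_side T := existT _ i (Ordinal kn).
  have ud : u d = v by rewrite /u /x /corner kE /= addrK.
  have sd : same_vertex d0 d by apply/asboolP; rewrite -/(u d) ud.
  apply: nah; rewrite -ud.
  have [_ _ _ _ /(_ psi q)] := hKE d.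
  have nK : ~ K d psi by move=> h; apply: nKE; left; exists d.
  have nE : ~ E d psi by move=> h; apply: nKE; right; exists d.
  move=> /(_ nK nE)/move_; rewrite /ahead; apply: filterS => t /shiftP h /shiftP h'.
  exact: h.
have l1 : lebesgue_measure KU = (\sum_(d | Q d) th d)%:E.
  by apply: measure_disjoint_sum => // i j; exact: dis.
have le1 : (lebesgue_measure KU <= lebesgue_measure (circle : set R))%E.
  by apply: le_measure; rewrite ?inE.
have le2 : (lebesgue_measure (circle : set R) <= lebesgue_measure KU)%E.
  have h := @measureU0 _ _ _ lebesgue_measure _ _ mKU mE E0.
  apply: le_trans (_ : (_ <= lebesgue_measure (KU `|` EU))%E) _; last by rewrite [X in (X <= _)%E]h.
  by apply: le_measure; rewrite ?inE //; exact: measurableU.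
by apply/eqP; rewrite eq_le -!lee_fin; apply/andP; split; rewrite -lc -l1.
Qed.

End Tiling.
End TorusVertices.

(** * Sides meeting along an edge of the torus *)

Section TorusEdges.
Context {R : realType}.
Implicit Types (x y u p q : R * R) (A : set (R * R)) (P : polygon R).

Lemma segment_closed p q : closed (segment p q).
Proof.
have -> : segment p q = point_at p q @` `[0, 1]%classic.
  by rewrite eqEsubset; split=> x /= [t t01 <-]; exists t => //; move: t01; rewrite /= in_itv.
apply: compact_closed; first exact: norm_hausdorff.
apply: continuous_compact; last exact: segment_compact.
by apply: continuous_subspaceT; exact: point_at_continuous.
Qed.

Lemma edge_midpoint P k j : (k < size (verts P))%N -> (j < size (verts P))%N -> j != k ->
  ~ edge (verts P) j (point_at (vertex (verts P) k) (vertex (verts P) k.+1) (1 / 2)).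
Proof.
move=> kn jn jk [t /= /andP[t0 t1] e].
have h01 : 0 <= (1 / 2 : R) < 1 by lra.
have [t1'|t1'] := ltP t 1.
  have [|kj _] := polygon_simple kn jn h01 _ (esym e); first by rewrite t0.
  by rewrite kj eqxx in jk.
have tE : t = 1 by apply/eqP; rewrite eq_le t1.
have jn' : (j.+1 %% size (verts P) < size (verts P))%N by rewrite ltn_mod size_verts_gt0.
have h00 : 0 <= (0 : R) < 1 by rewrite lexx ltr01.
have := polygon_simple kn jn' h01 h00; rewrite point_at0 vertex_mod -e tE point_at1.
by move=> /(_ erefl)[_ h]; lra.
Qed.

(** The vector from [p] to [q] turned by a right angle counterclockwise; [orient p q] increases
    along it. *)
Definition normal p q : R * R := (- (q - p).2, (q - p).1).

Lemma edge_near_midpoint P k : (k < size (verts P))%N -> exists2 e : R, 0 < e & forall z,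
  let m := point_at (vertex (verts P) k) (vertex (verts P) k.+1) (1 / 2) in
  `|z.1 - m.1| < e -> `|z.2 - m.2| < e -> polyline P z -> edge (verts P) k z.
Proof.
move=> kn; set m := point_at _ _ _.
have H (j : 'I_(size (verts P))) : \forall z \near m, edge (verts P) j z -> j = k :> nat.
  have [jk|jk] := eqVneq (j : nat) k; first by near=> z.
  have := @open_nbhs_nbhs _ m (~` edge (verts P) j).
  move=> /(_ _)/filterS; apply; first by move=> z h /h.
  split; first by apply: closed_openC; exact: segment_closed.
  exact: edge_midpoint.
have G := filter_forall _ H.
have {}G := G (nbhs_filter m).
have /nbhs_boxP[e e0 h] : nbhs m [set z | forall i : 'I_(size (verts P)), edge (verts P) i z -> i = k :> nat] := G.
exists e => //= z z1 z2 [j jn jz].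
by rewrite -(h z z1 z2 (Ordinal jn) jz).
Unshelve. all: by end_near. Qed.

(** Near its midpoint the edge is the whole boundary, and regularity provides interior points there.
    A segment that stays in the box and on one side of the edge meets no boundary, so that whole
    side is interior. *)
Lemma ahead_normal P k : (k < size (verts P))%N ->
  let p := vertex (verts P) k in let q := vertex (verts P) k.+1 in
  ahead (point_at p q (1 / 2)) (normal p q) (interior (region P)) \/
  ahead (point_at p q (1 / 2)) (- normal p q) (interior (region P)).
Proof.
move=> kn p q; have [e e0 he] := edge_near_midpoint kn; rewrite /= in he.
rewrite -/p -/q in he; set m := point_at p q (1 / 2) in he *.
pose B := [set z : R * R | `|z.1 - m.1| < e /\ `|z.2 - m.2| < e].
have nB : nbhs m B by apply/nbhs_boxP; exists e.
have oB : open B.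
  rewrite (_ : B = ball m e); first exact: ball_open.
  by rewrite eqEsubset; split=> z [z1 z2]; split; move: z1 z2; rewrite /ball /= 1?distrC // => _; rewrite distrC.
have pq : p != q by exact: vertex_neqS.
have Pm : region P m.
  have [] // := @polyline_region _ P m; exists k => //; exists (1 / 2) => //=; lra.
have [z Pz] : exists z, interior (region P `&` B) z.
  have : closure (interior (region P)) m by rewrite region_regular.
  move=> /(_ B nB)[z [Pz Bz]]; exists z; rewrite interiorI; split => //.
  by have /interior_id -> := oB.
have nu x (t : R) : orient p q (x + t *: normal p q) = orient p q x + t * dot (q - p) (q - p).
  by rewrite /normal; vsimp; ring.
have d0 : 0 < dot (q - p) (q - p) by rewrite lt_neqAle dot_ge0 andbT eq_sym dot_eq0 subr_eq0 eq_sym.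
have om : orient p q m = 0 by rewrite orient_point_at orient_xyx orient_xyy !mulr0 addr0.
have cB x y (s : R) : B x -> B y -> 0 <= s <= 1 -> B (point_at x y s).
  move=> [x1 x2] [y1 y2] /andP[s0 s1]; have s2 : 0 <= 1 - s by rewrite subr_ge0.
  have cv (c c' : R) : `|c| < e -> `|c'| < e -> `|(1 - s) * c + s * c'| < e.
    move=> h h'; apply: le_lt_trans (ler_normD _ _) _; rewrite !normrM (ger0_norm s0) (ger0_norm s2).
    have [->|sn] := eqVneq s 0; first by rewrite subr0 mul1r mul0r addr0.
    have sp : 0 < s by rewrite lt_neqAle eq_sym sn.
    have := ler_wpM2l s2 (ltW h); have : s * `|c'| < s * e by rewrite ltr_pM2l.
    lra.
  have E (c : R * R) : (point_at x y s).1 - c.1 = (1 - s) * (x.1 - c.1) + s * (y.1 - c.1) /\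
      (point_at x y s).2 - c.2 = (1 - s) * (x.2 - c.2) + s * (y.2 - c.2).
    by split; rewrite /point_at /= /GRing.scale /=; ring.
  by have [E1 E2] := E m; rewrite /B /mkset E1 E2; split; exact: cv.
have B0 x : B x -> polyline P x -> orient p q x = 0.
  move=> [x1 x2] /(he _ x1 x2)[t _ <-].
  by rewrite orient_point_at orient_xyx orient_xyy !mulr0 addr0.
have side (g : R) w : g != 0 -> region P w -> B w -> 0 < g * orient p q w ->
    ahead m (g *: normal p q) (interior (region P)).
  move=> g0 Pw Bw ow; have := ahead_nbhs (g *: normal p q) nB; rewrite /ahead => aB.
  near=> t; have t0 : 0 < t by near: t; exact: nbhs_right_gt.
  have Bt : B (m + t *: (g *: normal p q)) by near: t.
  have ot : 0 < g * orient p q (m + t *: (g *: normal p q)).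
    rewrite scalerA nu om add0r (_ : _ * _ = g ^+ 2 * (t * dot (q - p) (q - p))); last by ring.
    by apply: mulr_gt0; [rewrite exprn_even_gt0|exact: mulr_gt0].
  apply: region_interior; last by move=> /(B0 _ Bt) h; move: ot; rewrite h mulr0 ltxx.
  apply: contrapT => nP; have [s s01 /(B0 _ (cB _ _ _ Bw Bt s01))] := region_exit Pw nP.
  rewrite orient_point_at => h; have /andP[s0 s1] := s01.
  have : 0 < (1 - s) * (g * orient p q w) + s * (g * orient p q (m + t *: (g *: normal p q))).
    have [->|sn] := eqVneq s 0; first by rewrite subr0 mul1r mul0r addr0.
    have sp : 0 < s by rewrite lt_neqAle eq_sym sn.
    by apply: ltr_wpDl; [rewrite mulr_ge0 ?subr_ge0 // ltW|exact: mulr_gt0].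
  by rewrite mulrCA [s * (g * _)]mulrCA -mulrDr h mulr0 ltxx.
have [zP zB] : (region P `&` B) z by exact: interior_subset Pz.
have [oz|oz|oz] := ltgtP (orient p q z) 0.
- right; rewrite -scaleN1r; by apply: (side _ z) => //; rewrite mulN1r oppr_gt0.
- by left; rewrite -[normal p q]scale1r; apply: (side _ z) => //; rewrite ?oner_eq0 ?mul1r.
(* The interior point found is on the line of the edge; it is first pushed off along the normal. *)
have [s s0 [wP wB]] := interior_perturb (normal p q) Pz.
left; rewrite -[normal p q]scale1r; apply: (side _ _ _ wP wB); first by rewrite oner_eq0.
by rewrite mul1r nu oz add0r; exact: mulr_gt0.
Unshelve. all: by end_near. Qed.

Lemma not_two_steps n k l : (2 < n)%N -> (k.+1 = l %[mod n])%N -> (k = l.+1 %[mod n])%N -> False.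
Proof.
move=> n2 h1 h2; have : (k + 2 == k + 0 %[mod n])%N.
  by rewrite addn0 addn2 -[k.+2]addn1 -modnDml h1 modnDml addn1 -h2.
by rewrite eqn_modDl mod0n modn_small.
Qed.

Section Tiling.
Context (a b : R * R) (N : nat) (T : 'I_N -> polygon R) (tilingT : torus_tiling a b T).
Implicit Types d r : tile_side T.

Let shiftD u v A : shift u (shift v A) = shift (u + v) A.
Proof.
by rewrite eqEsubset; split=> x; [move=> /shiftP/shiftP h|move=> /shiftP h; apply/shiftP/shiftP];
  [apply/shiftP; move: h|move: h]; congr (A _); vring.
Qed.

Let shift0 A : shift 0 A = A.
Proof. by rewrite eqEsubset; split=> x; [move/shiftP|move=> h; apply/shiftP]; rewrite subr0. Qed.

Lemma same_torus_edge_equiv : equivalence_rel (same_torus_edge a b (T := T)).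
Proof.
have S d e : same_torus_edge a b d e -> same_torus_edge a b e d.
  move=> /asboolP[u Lu h]; apply/asboolP; exists (- u); first exact: latticeN.
  by rewrite -h shiftD addNr shift0.
have tr d e f : same_torus_edge a b d e -> same_torus_edge a b e f -> same_torus_edge a b d f.
  move=> /asboolP[u Lu h] /asboolP[v Lv h']; apply/asboolP; exists (v + u); first exact: latticeD.
  by rewrite -shiftD h h'.
move=> d e f; split; first by apply/asboolP; exists 0; [exact: lattice0|exact: shift0].
by move=> de; apply/idP/idP; [apply: tr; exact: S|exact: tr].
Qed.

Lemma side_edge_shift d r u : shift u (side_edge d) = side_edge r ->
  let p := vertex (verts (T (tag r))) (tagged r) in
  let q := vertex (verts (T (tag r))) (tagged r).+1 in
  let p' := u + vertex (verts (T (tag d))) (tagged d) in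
  let q' := u + vertex (verts (T (tag d))) (tagged d).+1 in
  (p = p' /\ q = q') \/ (p = q' /\ q = p').
Proof. by move=> h p q p' q'; apply: shift_segment_ends => //; exact: vertex_neqS. Qed.

Lemma side_length_shift d r u : shift u (side_edge d) = side_edge r ->
  side_length (T (tag d)) (tagged d) = side_length (T (tag r)) (tagged r).
Proof.
have D p q : edist (u + p) (u + q) = edist p q by rewrite /edist; congr enorm; vring.
move=> /side_edge_shift /=; rewrite /side_length => -[[-> ->]|[-> ->]]; rewrite D //.
by rewrite edistC.
Qed.

Lemma ahead_side_edge d r u : shift u (side_edge d) = side_edge r ->
  let p := vertex (verts (T (tag r))) (tagged r) in
  let q := vertex (verts (T (tag r))) (tagged r).+1 in
  ahead (point_at p q (1 / 2)) (normal p q) (shift u (interior (region (T (tag d))))) \/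
  ahead (point_at p q (1 / 2)) (- normal p q) (shift u (interior (region (T (tag d))))).
Proof.
move=> /side_edge_shift /= h.
have := ahead_normal (ltn_ord (tagged d)).
move: h; set p' := vertex (verts (T (tag d))) _; set q' := vertex (verts (T (tag d))) _.
set A := interior _ => h /=.
have mv x y (z z' : R * R) : y = u + x -> z = z' -> ahead x z A -> ahead y z' (shift u A).
  move=> -> -> ; rewrite /ahead; apply: filterS => t h'; apply/shiftP; move: h'.
  by rewrite (_ : u + x + _ - u = x + t *: z') //; vring.
case: h => -[-> ->] [h|h].
- by left; apply: mv h; [vring|rewrite /normal; vring].
- by right; apply: mv h; [vring|rewrite /normal; vring].
- by right; apply: mv h; [apply: pair_ext; vsimp; field|rewrite /normal; vring].
- by left; apply: mv h; [apply: pair_ext; vsimp; field|rewrite /normal; vring].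
Qed.

Lemma side_edge_inj d e r u : tag d = tag e -> shift u (side_edge d) = side_edge r ->
  shift u (side_edge e) = side_edge r -> d = e.
Proof.
case: d e => [i k] [j l] /= ij; subst j => /side_edge_shift /= hk /side_edge_shift /= hl.
have n0 := polygon_size (T i).
have [h|[h1 h2]] : vertex (verts (T i)) k = vertex (verts (T i)) l \/
    (vertex (verts (T i)) k = vertex (verts (T i)) l.+1 /\
     vertex (verts (T i)) k.+1 = vertex (verts (T i)) l).
- move: hk hl; set p := vertex (verts (T (tag r))) _; set q := vertex _ _.+1.
  move=> [[-> ->]|[-> ->]] [[e1 e2]|[e1 e2]]; move: (addrI u e1) (addrI u e2) => {}e1 {}e2.
  + by left.
  + by right.
  + by right.
  + by left.
- by congr existT; apply: val_inj; exact: (vertex_inj (ltn_ord k) (ltn_ord l)).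
exfalso; exact: (not_two_steps n0 (vertex_eq h2) (vertex_eq h1)).
Qed.

(** Each such side has its tile, after translation, on one of the two sides of the edge at its
    midpoint. Of three, two would be on the same side, and their tiles would overlap. *)
Lemma side_multiplicity r : (#|[set d | same_torus_edge a b d r]%SET| <= 2)%N.
Proof.
rewrite leqNgt; apply/negP => /card_gt2P[d1 [d2 [d3 [[]]]]].
rewrite !inE => -[u1 L1 e1] [u2 L2 e2] [u3 L3 e3] [n12 n23 n31].
have H d e u v w x : lattice a b u -> lattice a b v -> shift u (side_edge d) = side_edge r ->
    shift v (side_edge e) = side_edge r -> ahead x w (shift u (interior (region (T (tag d))))) ->
    ahead x w (shift v (interior (region (T (tag e))))) -> d = e.
  move=> Lu Lv hd he ad ae; have [t [td te]] := filter_ex (filterI ad ae).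
  have [de uv] := tiling_overlap tilingT Lu Lv td te.
  by rewrite -uv in he; exact: side_edge_inj hd he.
have := ahead_side_edge e1; have := ahead_side_edge e2; have := ahead_side_edge e3 => /=.
move=> [h3|h3] [h2|h2] [h1|h1].
- by rewrite (H _ _ _ _ _ _ L1 L2 e1 e2 h1 h2) eqxx in n12.
- by rewrite (H _ _ _ _ _ _ L2 L3 e2 e3 h2 h3) eqxx in n23.
- by rewrite (H _ _ _ _ _ _ L3 L1 e3 e1 h3 h1) eqxx in n31.
- by rewrite (H _ _ _ _ _ _ L1 L2 e1 e2 h1 h2) eqxx in n12.
- by rewrite (H _ _ _ _ _ _ L1 L2 e1 e2 h1 h2) eqxx in n12.
- by rewrite (H _ _ _ _ _ _ L3 L1 e3 e1 h3 h1) eqxx in n31.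
- by rewrite (H _ _ _ _ _ _ L2 L3 e2 e3 h2 h3) eqxx in n23.
- by rewrite (H _ _ _ _ _ _ L1 L2 e1 e2 h1 h2) eqxx in n12.
Qed.

(** Each side of a tile is charged to the representative of its class, which has the same length and
    receives at most two charges. *)
Lemma sum_perimeters : \sum_i perimeter (T i) <= 2 * total_edge_length a b T.
Proof.
have E := same_torus_edge_equiv.
have eqv : {in [set: tile_side T]%SET & &, equivalence_rel (same_torus_edge a b (T := T))}.
  by move=> d e f _ _ _; exact: E.
have len0 d : 0 <= side_length (T (tag d)) (tagged d) by exact: enorm_ge0.
have -> : \sum_i perimeter (T i) = \sum_(d : tile_side T) side_length (T (tag d)) (tagged d).
  rewrite /perimeter (sig_big_dep _ _ (fun i (k : 'I_(nsides (T i))) => side_length (T i) k)) /=.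
  by [].
have rep d : exists2 r, r \in torus_edges a b T & same_torus_edge a b d r.
  have pP := equivalence_partitionP eqv; have tX := transversalP pP.
  have Pd : finset.pblock (equivalence_partition (same_torus_edge a b (T := T)) [set: tile_side T]%SET) d \in
      equivalence_partition (same_torus_edge a b (T := T)) [set: tile_side T]%SET.
    by rewrite pblock_mem // (cover_partition pP) finset.in_setT.
  exists (transversal_repr d (torus_edges a b T) (finset.pblock (equivalence_partition
    (same_torus_edge a b (T := T)) [set: tile_side T]%SET) d)).
    exact: (repr_mem_transversal tX).
  by rewrite -(pblock_equivalence_partition eqv) ?finset.in_setT //; exact: (repr_mem_pblock tX).
apply: (@le_trans _ _ (\sum_(d : tile_side T) \sum_(r in torus_edges a b T | same_torus_edge a b d r)
    side_length (T (tag r)) (tagged r))).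
  apply: ler_sum => d _; have [r rX dr] := rep d.
  rewrite (bigD1 r) ?rX //= (_ : side_length _ (tagged d) = side_length (T (tag r)) (tagged r)).
    by rewrite lerDl sumr_ge0.
  by move/asboolP: dr => [u _]; exact: side_length_shift.
rewrite (exchange_big_dep (fun r => r \in torus_edges a b T)) /=; last by move=> d r _ /andP[].
rewrite /total_edge_length mulr_sumr; apply: ler_sum => r rX.
rewrite sumr_const [leRHS]mulr_natl; apply: ler_wpMn2l => //.
apply: leq_trans (side_multiplicity r).
by apply: subset_leq_card; apply/fintype.subsetP => d; rewrite finset.inE rX; exact: (fun h => h).
Qed.

End Tiling.
End TorusEdges.

(** * Counting *)

Section Counting.
Context {R : realType}.

(** Turns finitely many strict bounds into a single strict gap, so that corners with different
    angles can be counted with one common lower bound. *)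
Lemma finite_gap (I : finType) (Q : pred I) (f : I -> R) (c : R) :
  (forall i, Q i -> c < f i) -> exists2 g, c < g & forall i, Q i -> g <= f i.
Proof.
move=> h; exists (\big[Order.min/c + 1]_(i | Q i) f i); last by move=> i Qi; exact: bigmin_le_cond.
apply/bigmin_gtP; split=> //; lra.
Qed.

(* A corner of weight 2, 3, 5 is the smallest angle al of the pentagon, another angle of the
   pentagon, the reflex angle of a quadrilateral. *)
Definition weighted_angle (al th : R) (w : nat) : Prop :=
  [\/ w = 2 /\ th = al, [/\ w = 3, pi / 2 < th & pi - al < th],
      w = 5 /\ pi < th | w = 0%N /\ 0 <= th].

(** The extreme cases of weight 9 are three smallest angles with one other, three others, and two
    smallest angles with a reflex one. The bound on [al] is what excludes five smallest angles, of
    weight 10. *)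
Lemma vertex_counts (al be ga : R) (n2 n3 n5 : nat) :
  2 * pi / 5 < al -> pi / 2 < be -> pi - al < be -> pi < ga ->
  n2%:R * al + n3%:R * be + n5%:R * ga <= 2 * pi -> (2 * n2 + 3 * n3 + 5 * n5 <= 9)%N.
Proof.
move=> a1 b1 b2 g1 S; have pp := pi_gt0 R.
have al0 : 0 <= al by lra.
have be0 : 0 <= be by lra.
have ga0 : 0 <= ga by lra.
have p2 := mulr_ge0 (ler0n R n2) al0; have p3 := mulr_ge0 (ler0n R n3) be0.
have bound (k n : nat) (x : R) : 0 <= x -> (k <= n)%N -> k%:R * x <= n%:R * x.
  by move=> x0 kn; apply: ler_wpM2r => //; rewrite ler_nat.
have n5le : (n5 <= 1)%N.
  rewrite leqNgt; apply/negP => /(bound 2 n5 ga ga0); lra.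
case: n5 n5le S => [|[|//]] _; rewrite ?mul0r ?mul1r ?addr0 => S.
  have n3le : (n3 <= 3)%N.
    rewrite leqNgt; apply/negP => /(bound 4 n3 be be0); lra.
  case: n3 n3le p3 S => [|[|[|[|//]]]] _ p3 S.
  - have h : (n2 <= 4)%N by rewrite leqNgt; apply/negP => /(bound 5 n2 al al0); lra.
    by clear -h; lia.
  - have h : (n2 <= 3)%N by rewrite leqNgt; apply/negP => /(bound 4 n2 al al0); lra.
    by clear -h; lia.
  - have h : (n2 <= 1)%N by rewrite leqNgt; apply/negP => /(bound 2 n2 al al0); lra.
    by clear -h; lia.
  - have h : (n2 <= 0)%N by rewrite leqNgt; apply/negP => /(bound 1 n2 al al0); lra.
    by clear -h; lia.
have n3le : (n3 <= 1)%N.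
  rewrite leqNgt; apply/negP => /(bound 2 n3 be be0); lra.
case: n3 n3le p3 S => [|[|//]] _ p3 S.
- have h : (n2 <= 2)%N by rewrite leqNgt; apply/negP => /(bound 3 n2 al al0); lra.
  by clear -h; lia.
- have h : (n2 <= 0)%N by rewrite leqNgt; apply/negP => /(bound 1 n2 al al0); lra.
  by clear -h; lia.
Qed.

Lemma vertex_weights (I : finType) (Q : pred I) (al : R) (th : I -> R) (w : I -> nat) :
  2 * pi / 5 < al -> (forall i, Q i -> weighted_angle al (th i) (w i)) ->
  \sum_(i | Q i) th i = 2 * pi -> (\sum_(i | Q i) w i <= 9)%N.
Proof.
move=> a1 ok S; have pp := pi_gt0 R.
have [b0 b0P hb0] : exists2 g, pi / 2 < g & forall i, Q i && (w i == 3) -> g <= th i.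
  apply: finite_gap => i /andP[Qi /eqP wi].
  by have [[e _]|[_ h _]|[e _]|[e _]] := ok i Qi; rewrite ?e // in wi.
have [b1 b1P hb1] : exists2 g, pi - al < g & forall i, Q i && (w i == 3) -> g <= th i.
  apply: finite_gap => i /andP[Qi /eqP wi].
  by have [[e _]|[_ _ h]|[e _]|[e _]] := ok i Qi; rewrite ?e // in wi.
have [ga gaP hga] : exists2 g, pi < g & forall i, Q i && (w i == 5) -> g <= th i.
  apply: finite_gap => i /andP[Qi /eqP wi].
  by have [[e _]|[e _ _]|[_ h]|[e _]] := ok i Qi; rewrite ?e // in wi.
pose be := Num.max b0 b1.
have hbe i : Q i && (w i == 3) -> be <= th i by move=> h; rewrite ge_max hb0 ?hb1.
pose n (k : nat) := (\sum_(i | Q i) (w i == k))%N.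
have -> : (\sum_(i | Q i) w i = 2 * n 2 + 3 * n 3 + 5 * n 5)%N.
  rewrite /n !big_distrr /= -!big_split /=; apply: eq_bigr => i Qi.
  by have [[-> _]|[-> _ _]|[-> _]|[-> _]] := ok i Qi.
apply: (@vertex_counts al be ga) => //; try by rewrite lt_max ?b0P ?b1P ?orbT.
rewrite -S /n !natr_sum !mulr_suml -!big_split /=; apply: ler_sum => i Qi.
have [[e t]|[e _ _]|[e _]|[e t]] := ok i Qi; rewrite e /= ?mul1r ?mul0r ?addr0 ?add0r //.
- by rewrite t.
- by apply: hbe; rewrite Qi e.
- by apply: hga; rewrite Qi e.
Qed.

Section Tiling.
Context (a b : R * R) (N : nat) (T : 'I_N -> polygon R) (tilingT : torus_tiling a b T).

(** Double counting over pairs of corners at the same vertex: in the sum of all weights times 2 pi,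
    each 2 pi is replaced by the angle sum at the corner. After exchanging the sums each angle is
    multiplied by the weight of its vertex, at most 9. *)
Lemma tiling_weights (al : R) (th : tile_side T -> R) (w : tile_side T -> nat) :
  2 * pi / 5 < al -> (forall d, has_angle (region (T (tag d))) (corner d) (th d)) ->
  (forall d, weighted_angle al (th d) (w d)) ->
  2 * pi * \sum_d (w d)%:R <= 9 * \sum_d th d.
Proof.
move=> a1 hth ok; have pp := pi_gt0 R.
have th0 d : 0 <= th d.
  by have [[_ ->]|[_ h _]|[_ h]|[_ h]] := ok d; lra.
rewrite mulrC mulr_suml mulr_sumr.
under eq_bigr => d _ do rewrite -(torus_vertex_sum tilingT d hth) mulr_sumr.
rewrite (exchange_big_dep xpredT) //=; apply: ler_sum => d _.
rewrite -mulr_suml; apply: ler_wpM2r => //; rewrite -natr_sum (ler_nat _ _ 9).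
apply: (vertex_weights a1 (fun d _ => ok d)).
rewrite -[RHS](torus_vertex_sum tilingT d hth); apply: eq_bigl => e.
exact: same_vertex_sym.
Qed.

End Tiling.
Definition cairo_bound : R := 2 * Num.sqrt (2 + Num.sqrt 3).

Lemma sqrt3_tan : Num.sqrt 3 = 3 * tan (pi / 6) :> R.
Proof.
have t0 := @tan_pi6_gt0 R; apply/eqP; rewrite -(eqrXn2 (n := 2)) ?sqrtr_ge0 //; last by lra.
by rewrite sqr_sqrtr // exprMn tan_pi6_sqr; apply/eqP; field.
Qed.

Lemma cairo_bound_half_sqr : (cairo_bound / 2) ^+ 2 = 2 + Num.sqrt 3.
Proof.
rewrite (_ : cairo_bound / 2 = Num.sqrt (2 + Num.sqrt 3)); last by rewrite /cairo_bound; field.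
by rewrite sqr_sqrtr // addr_ge0 // sqrtr_ge0.
Qed.

Lemma cairo_bound_ge0 : 0 <= cairo_bound.
Proof. by rewrite mulr_ge0 // sqrtr_ge0. Qed.

Lemma sqrt3_itv : 8 / 5 <= (Num.sqrt 3 : R) <= 26 / 15.
Proof.
have s3 : Num.sqrt 3 ^+ 2 = 3 :> R by rewrite sqr_sqrtr.
have s0 : 0 <= Num.sqrt 3 :> R by exact: sqrtr_ge0.
apply/andP; split.
  rewrite -(@ler_pXn2r _ 2) ?nnegrE ?s3 //; lra.
rewrite -(@ler_pXn2r _ 2) ?nnegrE ?s3 //; lra.
Qed.

Lemma cairo_bound_itv : 189 / 50 <= cairo_bound <= 228 / 59.
Proof.
have e := cairo_bound_half_sqr; have c0 := cairo_bound_ge0; have /andP[s1 s2] := sqrt3_itv.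
suff /andP[h1 h2] : 189 / 100 <= cairo_bound / 2 <= 114 / 59 by apply/andP; split; lra.
have c1 : 0 <= cairo_bound / 2 by rewrite divr_ge0.
apply/andP; split.
  rewrite -(@ler_pXn2r _ 2) ?nnegrE ?e //; lra.
rewrite -(@ler_pXn2r _ 2) ?nnegrE ?e //; lra.
Qed.

Lemma half_sqr_lt (x y : R) : 0 <= x -> x < y -> (x / 2) ^+ 2 < (y / 2) ^+ 2.
Proof. by move=> x0 xy; rewrite ltr_pXn2r ?nnegrE //; lra. Qed.

Lemma half_sqr_ge (x : R) : 0 <= x -> (189 / 100) ^+ 2 <= (x / 2) ^+ 2 -> 189 / 50 <= x.
Proof.
move=> x0; rewrite ler_pXn2r ?nnegrE //; last by rewrite divr_ge0.
by move=> h; lra.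
Qed.

Lemma nonconvex_perimeter (P : polygon R) : quadrilateral P -> nonconvex P -> unit_area P ->
  91 / 20 <= perimeter P.
Proof.
move=> P4 nc aP; have [i [e [e13 dP]]] := nonconvex_dart P4 nc aP.
have h := dart_perimeter P4 e13 dP aP.
have p0 : 0 <= perimeter P by apply: sumr_ge0 => k _; exact: enorm_ge0.
have q0 : 0 <= 91 / 20 :> R by rewrite divr_ge0.
rewrite -(@ler_pXn2r _ 4) ?nnegrE //; apply: le_trans h.
have h1 : (91 / 20) ^+ 2 <= 83 / 4 :> R by clear; lra.
have h2 : (83 / 4) ^+ 2 <= 432 :> R by clear; lra.
by apply: le_trans h2; rewrite (exprM _ 2 2) ler_pXn2r ?nnegrE ?exprn_ge0 // divr_ge0.
Qed.

Lemma vertex_angle_mod (p : nat -> R * R) m : vertex_angle p (m %% 5) = vertex_angle p m.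
Proof. by rewrite /vertex_angle /cyc5 !modnDml modn_mod. Qed.

Lemma sum_vertex_angles (p : nat -> R * R) : ccw5 p -> \sum_(m < 5) vertex_angle p m = 3 * pi.
Proof.
move=> h; rewrite -(sum_interior_angles5 h) !big_ord_recr !big_ord0 /= !interior_vertex_angle.
rewrite -(vertex_angle_mod p 5) (_ : 5 %% 5 = 0)%N //; ring.
Qed.

(** [interior_angle] at index k is the angle at vertex k + 1, so vertex [m] has index [m - 1],
    written [m + 4] modulo 5. *)
Lemma interior_angle_pred (p : nat -> R * R) (m : 'I_5) :
  vertex_angle p m = interior_angle p (inord ((m + 4) %% 5) : 'I_5).
Proof.
rewrite interior_vertex_angle inordK ?ltn_mod // -(vertex_angle_mod p (_.+1)).
by congr vertex_angle; case: m => [[|[|[|[|[|m]]]]]].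
Qed.

Section Tiles.
Context (P T0 : polygon R) (e0 : nat) (m0 : 'I_5).
Context (P5 : pentagon P) (e14 : e0 = 1%N \/ e0 = 4%N).
Let p0 := pentagon_vertices T0 e0.
Context (ccw_p0 : ccw5 p0) (cT0 : congruent P T0).
Context (m0_min : forall m : 'I_5, m != m0 ->
  pi / 2 < vertex_angle p0 m /\ pi - vertex_angle p0 m0 < vertex_angle p0 m).

Let sum_single n (i0 : 'I_n) : \sum_(i < n) (i == i0)%:R = 1 :> R.
Proof. by rewrite (bigD1 i0) //= eqxx big1 ?addr0 // => i /negPf ->. Qed.

(** The last clause is the linear certificate. The bracket is 28 pi - 27 pi = pi for a pentagon and
    10 pi - 18 pi = - 8 pi for a quadrilateral, while by [tiling_weights] its sum over all tiles is
    at most 0. *)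
Lemma tile_weights (Q : polygon R) : unit_area Q ->
  congruent P Q \/ (quadrilateral Q /\ nonconvex Q) ->
  exists (th : nat -> R) (w : nat -> nat),
   [/\ forall k, (k < nsides Q)%N -> has_angle (region Q) (vertex (verts Q) k) (th k),
     forall k, weighted_angle (vertex_angle p0 m0) (th k) (w k) &
     cairo_bound * pi <= perimeter Q * pi +
       17 / 200 * (2 * pi * (\sum_(k < nsides Q) (w k)%:R) - 9 * \sum_(k < nsides Q) th k)].
Proof.
have pp := pi_gt0 R; have /andP[c1 c2] := cairo_bound_itv.
have ord_sum n (f : 'I_n.+1 -> 'I_n.+1) (F : 'I_n.+1 -> R) : injective f ->
    \sum_(k < n.+1) F (f (inord k)) = \sum_k F k.
  by move=> fi; rewrite [RHS](reindex_inj fi); apply: eq_bigr => k _; rewrite inord_val.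
move=> aQ [cQ|[Q4 nc]].
  have [Q5 [e1 [he1 h1 [s si sE]]]] := congruent_pentagons P5 cT0 cQ e14 ccw_p0.
  have [s' si' s'E] := pentagon_tile Q5 he1 h1.
  exists (fun k => vertex_angle p0 (s (s' (inord k)))).
  exists (fun k => if s (s' (inord k)) == m0 then 2 else 3)%N.
  split.
  - move=> k; rewrite Q5 => k5; rewrite -sE.
    by have := s'E (inord k); rewrite inordK.
  - move=> k; have [->|ne] := eqVneq (s (s' (inord k))) m0; first by constructor 1.
    by have [h2 h3] := m0_min ne; constructor 2.
  have per : 189 / 50 <= perimeter Q.
    have [le|lt] := leP cairo_bound (perimeter Q); first exact: le_trans c1 le.
    have h := short_pentagon h1 (area5_pentagon_vertices Q5 he1 h1 aQ).
    have q0 : 0 <= perimeter Q by apply: sumr_ge0 => k _; exact: enorm_ge0.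
    have [] := h.
      rewrite perim5_pentagon_vertices // -sqrt3_tan -cairo_bound_half_sqr.
      exact: half_sqr_lt.
    by rewrite perim5_pentagon_vertices // => h2 _ _; exact: half_sqr_ge.
  rewrite Q5 (ord_sum _ (fun k => s (s' k)) (fun m => vertex_angle p0 m)); last exact: inj_comp.
  rewrite (ord_sum _ (fun k => s (s' k)) (fun m => (if m == m0 then 2 else 3)%N%:R)); last exact: inj_comp.
  rewrite sum_vertex_angles //.
  have -> : \sum_(m < 5) (if m == m0 then 2 else 3)%N%:R = 14 :> R.
    rewrite (eq_bigr (fun m : 'I_5 => 3 - (m == m0)%:R)); last first.
      by move=> m _; case: eqVneq => _ /=; ring.
    by rewrite sumrB sum_single sumr_const card_ord; ring.
  (* The multiplier 17/200 is at least 228/59 - 189/50, as pentagons require, and at most an eighth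
     of 91/20 - 228/59, as quadrilaterals require. *)
  have h := @ler_wpM2r _ pi (ltW pp) cairo_bound (perimeter Q + 17 / 200).
  have {}h := h ltac:(lra); lra.
have [i [e [e13 dQ]]] := nonconvex_dart Q4 nc aQ.
have [s si sE] := dart_tile Q4 e13 dQ; have [d0 d1 dS] := dart_angles dQ.
exists (fun k => dart_angle (quad_vertices Q i e) (s (inord k))).
exists (fun k => if s (inord k) == ord0 then 5 else 0)%N.
split.
- by move=> k; rewrite Q4 => k4; have := sE (inord k); rewrite inordK.
- move=> k; have [->|ne] := eqVneq (s (inord k)) ord0; first by constructor 3.
  by constructor 4.
rewrite Q4 (ord_sum _ s (fun m => dart_angle (quad_vertices Q i e) m)) // dS.
rewrite (ord_sum _ s (fun m => (if m == ord0 then 5 else 0)%N%:R)) //.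
have -> : \sum_(m < 4) (if m == ord0 then 5 else 0)%N%:R = 5 :> R.
  rewrite (eq_bigr (fun m : 'I_4 => 5 * (m == ord0)%:R)); last first.
    by move=> m _; case: eqVneq => _ /=; ring.
  by rewrite -mulr_sumr sum_single mulr1.
have per := nonconvex_perimeter Q4 nc aQ.
(* 17/25 is eight times 17/200. *)
have h := @ler_wpM2r _ pi (ltW pp) cairo_bound (perimeter Q - 17 / 25).
have {}h := h ltac:(lra); lra.
Qed.

End Tiles.

Section Main.
Context (a b : R * R) (N : nat) (T : 'I_N -> polygon R) (P : polygon R).
Context (tilingT : torus_tiling a b T) (P5 : pentagon P).
Context (areaT : forall i, unit_area (T i)).
Context (tilesT : forall i, congruent P (T i) \/ (quadrilateral (T i) /\ nonconvex (T i))).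

Lemma sum_perimeters_ge : N%:R * cairo_bound <= \sum_i perimeter (T i).
Proof.
have pp := pi_gt0 R; have /andP[c1 c2] := cairo_bound_itv.
rewrite -[N in N%:R]card_ord mulr_natl -sumr_const.
have [all_long|] := pselect (forall i, cairo_bound <= perimeter (T i)); first exact: ler_sum.
move=> /existsNP[i0 /negP]; rewrite -ltNge => lt0.
have cT0 : congruent P (T i0).
  (* A tile of perimeter below the Cairo bound is no quadrilateral (at least 91/20) and, next, no
     reducible pentagon (at least 4). *)
  have [//|[q4 nc]] := tilesT i0; have := nonconvex_perimeter q4 nc (areaT i0); lra.
have T05 : pentagon (T i0).
  by have [e _] := congruent_vertices cT0; rewrite /pentagon /nsides e.
have nr : ~ reducible (T i0).
  move=> /(reducible_pentagon T05 (areaT i0)); lra.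
have [e0 e14 ccw0] := convex_pentagon T05 nr.
have q0 : 0 <= perimeter (T i0) by apply: sumr_ge0 => k _; exact: enorm_ge0.
have [|_ pairs big] := short_pentagon ccw0 (area5_pentagon_vertices T05 e14 ccw0 (areaT i0)).
  rewrite perim5_pentagon_vertices // -sqrt3_tan -cairo_bound_half_sqr.
  exact: half_sqr_lt.
set p0 := fun k => _ in ccw0 pairs big.
pose m0 : 'I_5 := [arg min_(m < ord0) vertex_angle p0 m]%O.
have m0_le (m : 'I_5) : vertex_angle p0 m0 <= vertex_angle p0 m.
  by rewrite /m0; case: Order.TotalTheory.arg_minP => // i _ /(_ m isT).
(* Two angles have sum above pi, and the larger of the two exceeds pi/2. *)
have m0_min (m : 'I_5) : m != m0 ->
    pi / 2 < vertex_angle p0 m /\ pi - vertex_angle p0 m0 < vertex_angle p0 m.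
  move=> ne; have := m0_le m.
  have := pairs (inord ((m + 4) %% 5)) (inord ((m0 + 4) %% 5)).
  rewrite -!interior_angle_pred => h.
  have {}h : pi < vertex_angle p0 m + vertex_angle p0 m0.
    apply: h; apply: contra ne => /eqP/(congr1 val); rewrite /= !inordK ?ltn_mod // => /eqP.
    rewrite !(addnC _ 4%N) eqn_modDl !modn_small // => /eqP h; exact/eqP/val_inj.
  by move=> h'; split; lra.
have m0_big : 2 * pi / 5 < vertex_angle p0 m0 by rewrite interior_angle_pred.
have /choice[th /choice[w hw]] := fun i => tile_weights P5 e14 ccw0 cT0 m0_min (areaT i) (tilesT i).
pose thd (d : tile_side T) := th (tag d) (tagged d).
pose wd (d : tile_side T) := w (tag d) (tagged d).
have := @tiling_weights a b N T tilingT (vertex_angle p0 m0) thd wd m0_big.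
have H1 d : has_angle (region (T (tag d))) (corner d) (thd d).
  by have [h _ _] := hw (tag d); exact: h.
have H2 d : weighted_angle (vertex_angle p0 m0) (thd d) (wd d).
  by have [_ h _] := hw (tag d); exact: h.
move=> /(_ H1 H2).
have -> : \sum_d (wd d)%:R = \sum_i \sum_(k < nsides (T i)) (w i k)%:R :> R.
  by rewrite (sig_big_dep _ _ (fun i (k : 'I_(nsides (T i))) => (w i k)%:R)).
have -> : \sum_d thd d = \sum_i \sum_(k < nsides (T i)) th i k.
  by rewrite (sig_big_dep _ _ (fun i (k : 'I_(nsides (T i))) => th i k)).
move=> W; rewrite -(ler_pM2r pp).
have L : \sum_(i < N) cairo_bound * pi <= \sum_i (perimeter (T i) * pi +
    17 / 200 * (2 * pi * (\sum_(k < nsides (T i)) (w i k)%:R) - 9 * \sum_(k < nsides (T i)) th i k)).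
  by apply: ler_sum => i _; have [_ _ h] := hw i.
move: L; rewrite big_split /= -!mulr_suml -mulr_sumr sumrB -!mulr_sumr.
move: W; lra.
Qed.

Lemma perimeter_per_tile_ge : Num.sqrt (2 + Num.sqrt 3) <= perimeter_per_tile a b T.
Proof.
have N0 : (0 < N)%N.
  by have [i _] := tiling_cover tilingT 0; case: i => i; apply: leq_ltn_trans.
have h1 := sum_perimeters_ge; have h2 := sum_perimeters tilingT.
rewrite /perimeter_per_tile ler_pdivlMr ?ltr0n //.
have : N%:R * cairo_bound <= 2 * total_edge_length a b T by exact: le_trans h1 h2.
rewrite /cairo_bound mulrCA ler_pM2l // mulrC; lra.
Qed.

End Main.

End Counting.

(** * Tangential pentagons *)

Section Tangential.
Context {R : realType}.
Implicit Types (A : set (R * R)) (P : polygon R).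

Lemma enorm_le (u : R * R) : enorm u <= `|u.1| + `|u.2|.
Proof.
have n1 := normr_ge0 u.1; have n2 := normr_ge0 u.2.
rewrite -(@ler_pXn2r _ 2) ?nnegrE ?enorm_ge0 ?addr_ge0 // expr2 enormK /dot -!expr2.
rewrite -(real_normK (num_real u.1)) -(real_normK (num_real u.2)).
by have := mulr_ge0 n1 n2; rewrite sqrrD; lra.
Qed.

Lemma ball_interior A c (r : R) x : (forall y, edist c y <= r -> A y) -> edist c x < r ->
  interior A x.
Proof.
move=> h xr; apply/nbhs_boxP; exists ((r - edist c x) / 2); first by rewrite divr_gt0 // subr_gt0.
move=> y y1 y2; apply: h; apply: le_trans (edist_triangle c x y) _.
have := enorm_le (y - x); rewrite -/(edist x y) /= => h; lra.
Qed.

Lemma convex_point_at A x y (t : R) : convex_set A -> A x -> A y -> 0 <= t <= 1 ->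
  A (point_at x y t).
Proof.
move=> cA Ax Ay /andP[t0 t1].
have := cA y x (Itv01 t0 t1); rewrite !inE => /(_ Ay Ax).
by rewrite /point_at addrC.
Qed.

Lemma convex_interior A w z (t : R) : convex_set A -> interior A w -> A z -> 0 <= t < 1 ->
  interior A (point_at w z t).
Proof.
move=> cA /nbhs_boxP[e e0 h] Az /andP[t0 t1]; have t2 : 0 < 1 - t by rewrite subr_gt0.
apply/nbhs_boxP; exists ((1 - t) * e); first exact: mulr_gt0.
move=> y y1 y2; pose w' := w + (1 - t)^-1 *: (y - point_at w z t).
have t3 : 1 - t != 0 by rewrite gt_eqF.
have -> : y = point_at w' z t.
  by apply: pair_ext; rewrite /w' /point_at /= /GRing.scale /=; field.
apply: convex_point_at => //; last by rewrite t0 ltW.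
apply: h; rewrite /w' /= addrC addKr /GRing.scale /= normrM gtr0_norm ?invr_gt0 // mulrC ltr_pdivrMr // [ltRHS]mulrC.
  exact: y1.
exact: y2.
Qed.

(** Change of a squared distance along a direction of negative derivative. The step - d / (q - d)
    stays below the double of the minimiser and below 1. *)
Lemma quadratic_descent (d q : R) : d < 0 -> 0 <= q ->
  exists2 s : R, 0 < s < 1 & 2 * s * d + s ^+ 2 * q < 0.
Proof.
move=> d0 q0; have qd : 0 < q - d by lra.
have s0 : 0 < - d / (q - d) by rewrite divr_gt0 // oppr_gt0.
have [->|qn] := eqVneq q 0; first by exists (1 / 2); lra.
have qp : 0 < q by rewrite lt_neqAle eq_sym qn.
exists (- d / (q - d)); first by rewrite s0 ltr_pdivrMr // mul1r; lra.
set s := _ / _ in s0 *; have sE : s * (q - d) = - d by rewrite divfK // gt_eqF.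
rewrite (_ : _ + _ = s * (2 * d + s * q)); last by ring.
rewrite pmulr_rlt0 // (_ : s * q = - d + s * d); last by rewrite -sE; ring.
have : s * d < 0 by rewrite pmulr_rlt0.
lra.
Qed.

Section Center.
Context (P : polygon R) (c : R * R) (r : R).
Context (r0 : 0 < r) (cP : convex_set (region P)).
Context (disk : forall x, edist c x <= r -> region P x).

Lemma center_interior : interior (region P) c.
Proof.
by apply: (@ball_interior _ c r) => //; rewrite /edist subrr /enorm /dot /= !mul0r addr0 sqrtr0.
Qed.

Lemma edge_polyline k x : edge (verts P) k x -> polyline P x.
Proof.
move=> h; exists (k %% size (verts P))%N; first by rewrite /= ltn_mod size_verts_gt0.
by rewrite edge_mod.
Qed.

Lemma edge_point_at k x y (t : R) : edge (verts P) k x -> edge (verts P) k y -> 0 <= t <= 1 ->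
  edge (verts P) k (point_at x y t).
Proof.
move=> [s /andP[s0 s1] <-] [s' /andP[s0' s1'] <-] /andP[t0 t1].
have t2 : 0 <= 1 - t by rewrite subr_ge0.
exists ((1 - t) * s + t * s'); last by vring.
have h1 := mulr_ge0 t2 s0; have h2 := mulr_ge0 t0 s0'.
have h3 : (1 - t) * s <= (1 - t) * 1 by exact: ler_wpM2l.
have h4 : t * s' <= t * 1 by exact: ler_wpM2l.
apply/andP; split; lra.
Qed.

Lemma edist_sqr (x y : R * R) : edist x y ^+ 2 = dot (y - x) (y - x).
Proof. by rewrite expr2 enormK. Qed.

(** If the product were negative, the edge would enter the open disk from [x] towards [y]. If it
    were positive, a point of the open disk would lie beyond [x], and convexity would put [x],
    between it and [y], in the interior. This argument also covers a contact point at an end of the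
    edge. *)
Lemma tangent_point k x y : edge (verts P) k x -> edist c x = r -> edge (verts P) k y ->
  dot (x - c) (y - x) = 0.
Proof.
move=> ex xr ey.
have xI z : edge (verts P) k z -> ~ interior (region P) z.
  by move=> /edge_polyline/polyline_region[].
have q0 := dot_ge0 (y - x).
have far z : r ^+ 2 <= dot (z - c) (z - c) \/ interior (region P) z.
  have [le|lt] := leP r (edist c z); last by right; exact: ball_interior disk lt.
  by left; rewrite -edist_sqr ler_pXn2r // nnegrE ?ltW // (lt_le_trans r0).
apply/eqP; rewrite eq_le; apply/andP; split; rewrite leNgt; apply/negP => dlt.
  have nd : - dot (x - c) (y - x) < 0 by rewrite oppr_lt0.
  have [s /andP[s0 s1] sE] := quadratic_descent nd q0.
  have [] := far (x - s *: (y - x)).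
    rewrite -xr edist_sqr (_ : dot (x - s *: (y - x) - c) _ = dot (x - c) (x - c) +
      (2 * s * - dot (x - c) (y - x) + s ^+ 2 * dot (y - x) (y - x))); first by lra.
    by vsimp; ring.
  move=> wI; apply: (xI _ ex).
  have s2 : 0 < 1 + s by lra.
  have Py : region P y by have [] := polyline_region (edge_polyline ey).
  have := @convex_interior _ _ y (s / (1 + s)) cP wI Py.
  rewrite (_ : point_at _ y _ = x); last first.
    by apply: pair_ext; rewrite /point_at /= /GRing.scale /=; field; rewrite gt_eqF.
  by apply; rewrite divr_ge0 ?ltW // ltr_pdivrMr // mul1r; lra.
have [s /andP[s0 s1] sE] := quadratic_descent dlt q0.
have ep : edge (verts P) k (point_at x y s) by apply: edge_point_at => //; rewrite !ltW.
have [|//] := far (point_at x y s); last by exact: xI.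
rewrite -xr edist_sqr (_ : dot (point_at x y s - c) _ = dot (x - c) (x - c) +
  (2 * s * dot (x - c) (y - x) + s ^+ 2 * dot (y - x) (y - x))); first by lra.
by vsimp; ring.
Qed.

(** The radius to the contact point is the height of the triangle over the edge. *)
Lemma tangent_orient k x : edge (verts P) k x -> edist c x = r ->
  `|orient c (vertex (verts P) k) (vertex (verts P) k.+1)| =
  r * edist (vertex (verts P) k) (vertex (verts P) k.+1).
Proof.
set p := vertex (verts P) k; set q := vertex (verts P) k.+1 => ex xr.
have ep : edge (verts P) k p by exists 0; rewrite ?point_at0 //= lexx ler01.
have eq : edge (verts P) k q by exists 1; rewrite ?point_at1 //= lexx ler01.
have dp := tangent_point ex xr ep; have dq := tangent_point ex xr eq.
have d0 : dot (x - c) (q - p) = 0.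
  have -> : dot (x - c) (q - p) = dot (x - c) (q - x) - dot (x - c) (p - x) by vsimp; ring.
  by rewrite dp dq subrr.
have cE : orient c p q = cross (x - c) (q - p).
  by case: ex => t _ <-; rewrite -/p -/q; vsimp; ring.
have h := enormM_sqr (x - c) (q - p); rewrite d0 expr0n add0r /= in h.
rewrite cE -xr /edist; apply/eqP; rewrite -(eqrXn2 (n := 2)) ?mulr_ge0 ?enorm_ge0 //.
by rewrite h real_normK ?num_real.
Qed.

Lemma otri_ray k x : otri c (vertex (verts P) k) (vertex (verts P) k.+1) x ->
  exists s t : R, [/\ 0 < s, 0 <= t < 1 &
    x = point_at c (point_at (vertex (verts P) k) (vertex (verts P) k.+1) t) s].
Proof.
move=> [al [be [ga [al0 be0 ga0 e ->]]]].
have s0 : 0 < be + ga by exact: addr_gt0.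
exists (be + ga), (ga / (be + ga)); split => //.
  by rewrite divr_ge0 ?ltW // ltr_pdivrMr // mul1r ltrDr.
have -> : al = 1 - (be + ga) by rewrite -e; ring.
by apply: pair_ext; rewrite /point_at /= /GRing.scale /=; field; rewrite gt_eqF.
Qed.

(** By convexity a ray from the centre meets the boundary only once, so a common point leads to the
    same boundary point, which determines the edge by simplicity. *)
Lemma otri_disjoint k l : (k < size (verts P))%N -> (l < size (verts P))%N ->
  otri c (vertex (verts P) k) (vertex (verts P) k.+1) `&`
  otri c (vertex (verts P) l) (vertex (verts P) l.+1) !=set0 -> k = l.
Proof.
move=> kn ln [x [/otri_ray[s [t [s0 t01 E]]] /otri_ray[s' [t' [s0' t01' E']]]]].
set y := point_at (vertex (verts P) k) _ _ in E; set y' := point_at (vertex (verts P) l) _ _ in E'.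
have W : forall t : R, 0 <= t < 1 -> 0 <= t <= 1 by move=> w /andP[-> /ltW].
have ey : edge (verts P) k y by exists t => //; exact: W.
have ey' : edge (verts P) l y' by exists t' => //; exact: W.
have ray (z z' : R * R) (u u' : R) : 0 < u -> u < u' -> point_at c z u = point_at c z' u' ->
    polyline P z -> polyline P z' -> False.
  move=> u0 uu h /polyline_region[Pz _] /polyline_region[_ nz']; apply: nz'.
  have u0' : 0 < u' by exact: lt_trans uu.
  have un : u' != 0 by rewrite gt_eqF.
  have -> : z' = point_at c z (u / u').
    have h1 := congr1 fst h; have h2 := congr1 snd h.
    move: h1 h2; rewrite /point_at /= /GRing.scale /= => h1 h2.
    apply: pair_ext; rewrite /point_at /= /GRing.scale /=; apply: (mulfI un).
      rewrite (_ : u' * (_ + _) = (1 - u) * c.1 + u * z.1 - (1 - u') * c.1); last by field.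
      by rewrite h1; ring.
    rewrite (_ : u' * (_ + _) = (1 - u) * c.2 + u * z.2 - (1 - u') * c.2); last by field.
    by rewrite h2; ring.
  apply: convex_interior => //; first exact: center_interior.
  by rewrite divr_ge0 ?ltW // ltr_pdivrMr // mul1r.
have py := edge_polyline ey; have py' := edge_polyline ey'.
have [lt|gt|ss] := ltgtP s s'.
- by case: (ray y y' s s') => //; rewrite -E -E'.
- by case: (ray y' y s' s) => //; rewrite -E -E'.
have yy : y = y'.
  have h : s *: (y - y') = 0.
    rewrite (_ : s *: _ = point_at c y s - point_at c y' s'); first by rewrite -E -E' subrr.
    by rewrite ss; vring.
  by move/eqP: h; rewrite scaler_eq0 gt_eqF //= subr_eq0 => /eqP.
by have [] := polygon_simple kn ln t01 t01' yy.
Qed.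

(** The open triangles over the edges are disjoint and contained in the convex region. *)
Lemma fan_area : ((\sum_(k < size (verts P))
  `|orient c (vertex (verts P) k) (vertex (verts P) k.+1)| / 2)%:E <= area (region P))%E.
Proof.
set v := vertex (verts P); set n := size (verts P).
have /choice[V hV] : forall k, exists V : set (R * R), [/\ measurable V, V `<=` otri c (v k) (v k.+1) &
    ((`|orient c (v k) (v k.+1)| / 2)%:E <= area V)%E].
  by move=> k; exact: otri_area.
have mV k : measurable (V k) by case: (hV k).
have tV : trivIset [set` enum 'I_n] (fun k : 'I_n => V k).
  move=> i j _ _ [x [xi xj]]; apply: val_inj; apply: (otri_disjoint (ltn_ord i) (ltn_ord j)).
  by exists x; have [_ si _] := hV i; have [_ sj _] := hV j; split; [exact: si|exact: sj].
have mU : measurable (\bigcup_(k in [set` enum 'I_n]) V k).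
  by apply: fin_bigcup_measurable => //; exact: finite_seq.
have sU : \bigcup_(k in [set` enum 'I_n]) V k `<=` region P.
  move=> x [k _]; have [_ sk _] := hV k => /sk [al [be [ga [al0 be0 ga0 e ->]]]].
  have cv : forall x y (t : R), region P x -> region P y -> 0 <= t <= 1 -> region P (point_at x y t).
    by move=> *; exact: convex_point_at.
  have Pv j : region P (v j) by have [] := polyline_region (vertex_polyline P j).
  have Pc := interior_subset center_interior.
  apply: (convex_tri cv Pc (Pv k) (Pv k.+1)).
  by exists al, be, ga; split => //; exact: ltW.
have le := area_le mU (@region_measurable _ P) sU.
apply: le_trans le; rewrite /area (@measure_fin_bigcup _ _ _ (lebesgue_measure \x lebesgue_measure)%E) //; last by move=> k _; exact: mV.
rewrite -fsbig_seq ?enum_uniq // big_enum -sumEFin.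
by apply: lee_sum => k _; case: (hV k).
Qed.

Lemma tangent_length_sqr k x : edge (verts P) k x -> edist c x = r -> forall y, edge (verts P) k y ->
  edist c y ^+ 2 = r ^+ 2 + edist y x ^+ 2.
Proof.
move=> ex xr y ey; have d := tangent_point ex xr ey.
rewrite -xr !edist_sqr (_ : dot (y - c) (y - c) = dot (x - c) (x - c) + dot (x - y) (x - y) +
  2 * dot (x - c) (y - x)); first by rewrite d mulr0 addr0.
by vsimp; ring.
Qed.

Lemma edge_length k x : edge (verts P) k x -> edist (vertex (verts P) k) (vertex (verts P) k.+1) =
  edist (vertex (verts P) k) x + edist (vertex (verts P) k.+1) x.
Proof.
move=> [t /andP[t0 t1] <-]; set p := vertex _ k; set q := vertex _ k.+1.
rewrite /edist (_ : point_at p q t - p = t *: (q - p)); last by vring.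
rewrite (_ : point_at p q t - q = (1 - t) *: - (q - p)); last by vring.
by rewrite !enormZ ?subr_ge0 // enormN; ring.
Qed.

(** The two tangents from a vertex have equal length [d]; the second equation is r = d tan (theta /
    2) in polynomial form, with theta the angle at the vertex. *)
Lemma tangent_length_angle k x x' : edge (verts P) k x -> edist c x = r ->
  edge (verts P) k.+1 x' -> edist c x' = r ->
  let d := edist (vertex (verts P) k.+1) x in
  edist (vertex (verts P) k.+1) x' = d /\
  (r ^+ 2 + d ^+ 2) * (1 - cos (convex_angle P k) ^+ 2) = 2 * d ^+ 2 * (1 - cos (convex_angle P k)).
Proof.
set a := vertex (verts P) k; set v := vertex (verts P) k.+1; set b := vertex (verts P) k.+2.
move=> ex xr ex' xr' d.
have in0 : 0 <= (0 : R) <= 1 by rewrite lexx ler01.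
have in1 : 0 <= (1 : R) <= 1 by rewrite lexx ler01.
have ea : edge (verts P) k a by exists 0; rewrite ?point_at0.
have ev : edge (verts P) k v by exists 1; rewrite ?point_at1.
have ev' : edge (verts P) k.+1 v by exists 0; rewrite ?point_at0.
have eb' : edge (verts P) k.+1 b by exists 1; rewrite ?point_at1.
have l1 := tangent_length_sqr ex xr ev; have l2 := tangent_length_sqr ex' xr' ev'.
have d0 : 0 <= d by exact: enorm_ge0.
have dE : edist v x' = d.
  by apply/eqP; rewrite -(eqrXn2 (n := 2)) ?enorm_ge0 //; apply/eqP; apply: (addrI (r ^+ 2)); rewrite -l2 l1.
split=> //.
have c0 : cross (a - v) (b - v) != 0.
  have := polygon_corners P k; rewrite -/a -/v -/b; apply: contra => /eqP h; apply/eqP.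
  by rewrite -[RHS]oppr0 -h; vsimp; ring.
have a0 := cross_neq0l c0; have b0 := cross_neq0r c0.
have dot1 : dot (a - v) (c - v) = d * enorm (a - v).
  have := tangent_point ex xr ea; have := tangent_point ex xr ev.
  rewrite /d; case: ex => t /andP[t0 t1] <-; rewrite -/a -/v.
  have -> : edist v (point_at a v t) = (1 - t) * enorm (a - v).
    by rewrite /edist -enormZ ?subr_ge0 //; congr enorm; vring.
  rewrite -mulrA enormK => h1 h2.
  have -> : dot (a - v) (c - v) = (1 - t) * dot (a - v) (a - v) +
    (dot (point_at a v t - c) (v - point_at a v t) - dot (point_at a v t - c) (a - point_at a v t)).
    by vsimp; ring.
  by rewrite h1 h2 subrr addr0.
have dot2 : dot (b - v) (c - v) = d * enorm (b - v).
  have := tangent_point ex' xr' eb'; have := tangent_point ex' xr' ev'.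
  rewrite -dE; case: ex' => t /andP[t0 t1] <-; rewrite -/b -/v.
  have -> : edist v (point_at v b t) = t * enorm (b - v).
    by rewrite /edist -enormZ //; congr enorm; vring.
  rewrite -mulrA enormK => h1 h2.
  have -> : dot (b - v) (c - v) = t * dot (b - v) (b - v) +
    (dot (point_at v b t - c) (v - point_at v b t) - dot (point_at v b t - c) (b - point_at v b t)).
    by vsimp; ring.
  by rewrite h1 h2 subrr addr0.
rewrite /convex_angle angleE -/a -/v -/b.
set C := cos _; have abE : dot (a - v) (b - v) = enorm (a - v) * enorm (b - v) * C by exact: ang_cos.
have vE : dot (c - v) (c - v) = r ^+ 2 + d ^+ 2 by rewrite -l1 edistC edist_sqr.
(* The Gram determinant of three vectors of the plane vanishes. *)
have gram : dot (c - v) (c - v) * cross (a - v) (b - v) ^+ 2 =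
    dot (a - v) (c - v) ^+ 2 * dot (b - v) (b - v) + dot (b - v) (c - v) ^+ 2 * dot (a - v) (a - v) -
    2 * dot (a - v) (c - v) * dot (b - v) (c - v) * dot (a - v) (b - v).
  by vsimp; ring.
have cr : cross (a - v) (b - v) ^+ 2 = (enorm (a - v) * enorm (b - v)) ^+ 2 * (1 - C ^+ 2).
  by rewrite mulrBr mulr1 -exprMn -abE enormM_sqr; ring.
move: gram; rewrite vE cr dot1 dot2 abE -!enormK => gram.
have ab0 : (enorm (a - v) * enorm (b - v)) ^+ 2 != 0 by rewrite expf_neq0 // mulf_neq0 // enorm_eq0.
by apply: (mulfI ab0); rewrite mulrCA gram; ring.
Qed.

End Center.

Lemma cos_2pi3 : cos (2 * pi / 3) = - (1 / 2) :> R.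
Proof.
have pp := pi_gt0 R.
have c0 : cos (pi / 6) != 0 :> R by rewrite gt_eqF // cos_gt0_pihalf //; lra.
have t := @tan_pi6_sqr R; rewrite /tan expr_div_n in t.
have c2 : cos (pi / 6) ^+ 2 = 3 / 4 :> R.
  have c1 : cos (pi / 6) ^+ 2 != 0 :> R by rewrite expf_neq0.
  have h : sin (pi / 6) ^+ 2 = 1 / 3 * cos (pi / 6) ^+ 2 :> R by rewrite -t divfK.
  by have := cos2Dsin2 (pi / 6 : R); rewrite h; lra.
have -> : 2 * pi / 3 = - (pi / 6 + pi / 6) + pi :> R by field.
by rewrite cosDpi cosN cosD -!expr2 sin2cos2 c2; field.
Qed.

(** The position of the two right angles only matters for their being distinct, so Cairo and
    Prismatic pentagons are treated together. *)
Lemma tangential_perimeter (d : nat) (C : polygon R) : d = 1%N \/ d = 2%N -> tangential_pentagon d C -> unit_area C ->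
  perimeter C <= cairo_bound.
Proof.
move=> hd [C5 cC [c [r [r0 disk tan]]] [i i5 angles]] aC.
have s5 : size (verts C) = 5%N by [].
have /choice[x0 hx0] : forall k, exists x, edge (verts C) k x /\ edist c x = r.
  move=> k; have [|x ex xr] := tan (k %% 5)%N; first by rewrite C5 ltn_mod.
  by exists x; split=> //; rewrite -edge_mod s5.
(* The contact points are made periodic in the index, so that the cyclic sum of the tangent lengths
   can be shifted. *)
pose X k := x0 (k %% 5)%N.
have eX k : edge (verts C) k (X k) by rewrite -edge_mod s5; have [] := hx0 (k %% 5)%N.
have rX k : edist c (X k) = r by have [] := hx0 (k %% 5)%N.
pose de k := edist (vertex (verts C) k.+1) (X k).
have T k := tangent_length_angle r0 cC disk (eX k) (rX k) (eX k.+1) (rX k.+1).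
have de0 k : 0 <= de k by exact: enorm_ge0.
(* The qualified [trigo.tan] is the function; [tan] alone names the tangency hypothesis here. *)
have t0 := @tan_pi6_gt0 R; set tau := trigo.tan _ in t0.
have t2 : tau ^+ 2 = 1 / 3 by exact: tan_pi6_sqr.
have deE k : (k < 5)%N -> de k = if (k == i) || (k == (i + d) %% 5)%N then r else r * tau.
  move=> k5; have [_] := T k; rewrite -/(de k) angles //; case: ifP => _.
    rewrite cos_pihalf expr0n /= subr0 !mulr1 => h.
    apply/eqP; rewrite -(eqrXn2 (n := 2)) ?(ltW r0) //; apply/eqP; lra.
  rewrite cos_2pi3 => h.
  have rt := mulr_ge0 (ltW r0) (ltW t0).
  apply/eqP; rewrite -(eqrXn2 (n := 2)) //; apply/eqP; rewrite [RHS]exprMn t2; move: h; rewrite (_ : (- (1 / 2)) ^+ 2 = 1 / 4 :> R); last by field.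
  lra.
have sumde : \sum_(k < 5) de k = 2 * r + 3 * (r * tau).
  rewrite (eq_bigr (fun k : 'I_5 => if ((k : nat) == i) || ((k : nat) == (i + d) %% 5)%N
    then r else r * tau)); last by move=> k _; exact: deE.
  rewrite !big_ord_recr big_ord0 /=.
  by case: hd => ->; case: i i5 {angles deE} => [|[|[|[|[|i]]]]] //= _; ring.
have per : perimeter C = 2 * (2 * r + 3 * (r * tau)).
  rewrite (perimeter_shift C 1) C5.
  rewrite (eq_bigr (fun k : 'I_5 => de k + de k.+1)); last first.
    by move=> k _; rewrite /side_length add1n (edge_length (eX k.+1)); have [-> _] := T k.
  rewrite big_split /= (_ : \sum_(k < 5) de k.+1 = \sum_(k < 5) de k); first by rewrite sumde; ring.
  apply: (@sum_shift _ 5 1 de) => k.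
  by rewrite /de /X modnDr -addSn -s5 vertexD.
have := fan_area r0 cC disk; rewrite /area aC lee_fin.
rewrite (eq_bigr (fun k : 'I_(size (verts C)) => r / 2 * side_length C k)); last first.
  by move=> k _; rewrite (tangent_orient r0 cC disk (eX k) (rX k)) /side_length; ring.
rewrite -mulr_sumr -/(nsides C) -/(perimeter C) => ar.
have p0 : 0 <= perimeter C by apply: sumr_ge0 => k _; exact: enorm_ge0.
have le : (perimeter C / 2) ^+ 2 <= (cairo_bound / 2) ^+ 2.
  rewrite cairo_bound_half_sqr sqrt3_tan -/tau.
  (* One factor is the half perimeter r (2 + 3 tau); what remains is the area of the fan, at most
     1. *)
  have -> : (perimeter C / 2) ^+ 2 = (2 + 3 * tau) * (r / 2 * perimeter C).
    by rewrite {1}expr2 {1}per; field.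
  by rewrite -[leRHS]mulr1 ler_wpM2l //; lra.
move: le; rewrite ler_pXn2r ?nnegrE ?divr_ge0 ?cairo_bound_ge0 //; lra.
Qed.

End Tangential.

Theorem theorem3p10 (R : realType) (a b : R * R) (N : nat)
    (T : 'I_N -> polygon R) (P : polygon R)
    (tilingT : torus_tiling a b T)
    (pentagonP : pentagon P) (areaP : unit_area P) (efficientP : efficient P)
    (areaT : forall i : 'I_N, unit_area (T i))
    (tilesT : forall i : 'I_N,
       congruent P (T i) \/ (quadrilateral (T i) /\ nonconvex (T i))) :
  (forall C : polygon R, unit_area C -> cairo C \/ prismatic C ->
     perimeter C / 2 <= perimeter_per_tile a b T) /\
  Num.sqrt (2 + Num.sqrt 3) <= perimeter_per_tile a b T.
Proof.
have bound := perimeter_per_tile_ge tilingT pentagonP areaT tilesT.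
split=> // C areaC tangentialC; apply: le_trans bound.
have le : perimeter C <= cairo_bound.
  by case: tangentialC => h; apply: tangential_perimeter h areaC; [right|left].
by move: le; rewrite /cairo_bound; lra.
Qed.
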